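(* Let $(\Omega,\Sigma,\mu)$ be a complete and saturated finite measure space, let $X$ be a separable Asplund space, and let $\bar x\in X$. Let $\varphi\colon X\times\Omega\to(-\infty,\infty]$ be such that, for some neighborhood $U$ of $\bar x$: (a) there is an integrable $\ell\colon\Omega\to[0,\infty)$ such that $\varphi(\cdot,\omega)$ is (finite and) Lipschitz continuous on $U$ with modulus $\ell(\omega)$ for every $\omega\in\Omega$; (b) $\varphi(x,\cdot)$ is measurable, and $\mu$-integrable, for every $x\in U$; (c) the multifunction $\omega\mapsto\partial\varphi(\bar x,\omega)$ is $w^*$-scalarly measurable. Let $I_\varphi(x):=\int\varphi(x,\omega)\,d\mu$. Then $\partial\varphi(\bar x,\cdot)$ is Gelfand integrable and $$\partial I_\varphi(\bar x)\subset\int\partial\varphi(\bar x,\omega)\,d\mu=\int\partial^\circ\varphi(\bar x,\omega)\,d\mu,$$ where the integrals are Gelfand integrals; these Gelfand integrals coincide with the $w^*$-integral of $\partial^\circ\varphi(\bar x,\cdot)$, and with the Bochner integrals of the respective multifunctions. Moreover, the inclusion holds as an equality provided that $\varphi(\cdot,\omega)$ is regular at $\bar x$ for every $\omega\in\Omega$.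
   Context: All Banach spaces are real; $X^*$ is the topological dual and $w^*$ refers to the weak$^*$ topology on $X^*$. A Banach space is Asplund if every continuous convex function on an open convex subset is Fréchet differentiable on a dense subset of it. A finite measure space $(\Omega,\Sigma,\mu)$ is saturated if for every $E\in\Sigma$ with $\mu(E)>0$ the space $L^1_E(\mu)$ of $\mu$-integrable functions on $(E,\Sigma_E,\mu)$, $\Sigma_E=\{A\cap E\mid A\in\Sigma\}$, is nonseparable in the $L^1$-norm. For $\phi\colon X\to(-\infty,\infty]$ locally Lipschitzian around $\bar x$: the limiting subdifferential $\partial\phi(\bar x)$ is the set of $x^*\in X^*$ for which there exist sequences $x_k\to\bar x$ (in norm) and $x_k^*\to x^*$ (in $w^*$) with $\liminf_{x\to x_k}\frac{\phi(x)-\phi(x_k)-\langle x_k^*,x-x_k\rangle}{\|x-x_k\|}\ge0$ for every $k$; $\phi^\circ(\bar x;h):=\limsup_{x\to\bar x,\,\theta\downarrow0}\frac{\phi(x+\theta h)-\phi(x)}{\theta}$; the generalized gradient is $\partial^\circ\phi(\bar x):=\{x^*\in X^*\mid\langle x^*,h\rangle\le\phi^\circ(\bar x;h)\ \forall h\in X\}$; $\phi$ is regular at $\bar x$ if $\phi'(\bar x;h)=\lim_{\theta\downarrow0}\frac{\phi(\bar x+\theta h)-\phi(\bar x)}{\theta}$ exists and equals $\phi^\circ(\bar x;h)$ for every $h$. $\partial\varphi(\bar x,\omega)$, $\partial^\circ\varphi(\bar x,\omega)$ refer to $\varphi(\cdot,\omega)$ at $\bar x$. Integrals: $f\colon\Omega\to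 X^*$ is $w^*$-scalarly measurable if $\langle f(\cdot),x\rangle$ is measurable for every $x\in X$; such an $f$ is Gelfand integrable if there is $x^*\in X^*$ with $\langle x^*,x\rangle=\int\langle f(\omega),x\rangle d\mu$ for all $x$, and then $\int f\,d\mu:=x^*$. The support function of a nonempty $C\subset X^*$ is $s(x,C):=\sup_{x^*\in C}\langle x^*,x\rangle$. $\Gamma\colon\Omega\rightrightarrows X^*$ is $w^*$-scalarly measurable (integrable) if $\omega\mapsto s(x,\Gamma(\omega))$ is measurable (integrable) for every $x\in X$. The Gelfand integral of $\Gamma$ is $\int\Gamma\,d\mu:=\{\int f\,d\mu\mid f\in\mathcal S^1_\Gamma\}$, with $\mathcal S^1_\Gamma$ the set of Gelfand integrable $f$ with $f(\omega)\in\Gamma(\omega)$ a.e.; $\Gamma$ is Gelfand integrable if this set is nonempty. The Bochner integral of $\Gamma$ is defined analogously with Bochner integrable a.e. selectors. For a $w^*$-scalarly integrable $\Gamma$ with $w^*$-compact convex values, the $w^*$-integral $w^*\text{-}\int\Gamma\,d\mu$ is the unique $w^*$-compact convex set $C\subset X^*$ with $s(x,C)=\int s(x,\Gamma(\omega))\,d\mu$ for every $x\in X$. *)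

(* Defs.v *)
From HB Require Import structures.
From mathcomp Require Import all_boot all_order all_algebra.
From mathcomp Require Import all_classical all_reals all_analysis.
From mathcomp Require Import measurable_realfun.

Set Implicit Arguments.
Unset Strict Implicit.
Unset Printing Implicit Defensive.

Import Order.TTheory GRing.Theory Num.Theory.
Import numFieldNormedType.Exports.

Local Open Scope classical_set_scope.
Local Open Scope ring_scope.

Section Dual.
Context {R : realType} (X : normedModType R).

Definition is_dual : {pred X -> R^o} :=
  [pred f : X -> R^o | `[< scalar f /\ continuous f >]].

Lemma is_dual_submod_closed : submod_closed is_dual.
Proof.
split.
  apply/asboolP; split; first by move=> a x y /=; rewrite mulr0 addr0.
  exact: (@cst_continuous X R^o 0).
move=> a f g /asboolP[fl fc] /asboolP[gl gc]; apply/asboolP; split.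
  move=> b x y; rewrite !fctE /= fl gl /GRing.scale /=.
  by rewrite !mulrDr addrACA !mulrA (mulrC a b).
by move=> x; apply: continuousD; [apply: continuousZr; exact: fc | exact: gc].
Qed.

HB.instance Definition _ :=
  GRing.isSubmodClosed.Build R (X -> R^o) is_dual is_dual_submod_closed.

Record dual := Dual { dual_fun :> X -> R^o ; dualP : dual_fun \in is_dual }.

HB.instance Definition _ := [isSub for dual_fun].
HB.instance Definition _ := [Choice of dual by <:].
HB.instance Definition _ := [SubChoice_isSubLmodule of dual by <:].

Implicit Types f g : dual.

Lemma dual_scalar f : scalar f.
Proof. by have /asboolP[] := dualP f. Qed.

Lemma dual_continuous f : continuous (f : X -> R).
Proof. by have /asboolP[] := dualP f. Qed.

HB.instance Definition _ f := GRing.isLinear.Build R X R^o *%R f (dual_scalar f).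

Definition dual_norm f : R := sup [set `|f x| | x in [set x : X | `|x| <= 1]].

Let unit_image f := [set `|f x| | x in [set x : X | `|x| <= 1]].

Let unit_image_neq0 f : unit_image f !=set0.
Proof. by exists `|f 0|, 0; rewrite //= normr0. Qed.

Let unit_image_ub f : has_ubound (unit_image f).
Proof.
have [y [_ /(_ (y + 1))]] : \forall r \near +oo, forall x, `|f x| <= r * `|x|.
  apply/(linear_boundedP (f : {linear X -> R^o})).
  apply: continuous_linear_bounded; exact: dual_continuous.
rewrite ltrDl ltr01 => /(_ isT) fy.
exists `|y + 1| => _ [x /= x1 <-]; apply: le_trans (fy x) _.
apply: le_trans (ler_norm _) _.
by rewrite normrM normr_id ler_piMr.
Qed.

Lemma le_dual_norm f x : `|f x| <= dual_norm f * `|x|.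
Proof.
have [->|x0] := eqVneq x 0; first by rewrite linear0 !normr0 mulr0.
have nx : 0 < `|x| by rewrite normr_gt0.
rewrite -ler_pdivrMr // -[`|x|^-1]gtr0_norm ?invr_gt0 // mulrC -normrM.
have -> : `|x|^-1 * f x = f (`|x|^-1 *: x) by rewrite linearZ.
apply: ub_le_sup; first exact: unit_image_ub.
by exists (`|x|^-1 *: x) => //=; rewrite normrZ normfV normr_id mulVf ?gt_eqF.
Qed.

Let dual_norm_le f c : (forall x, `|x| <= 1 -> `|f x| <= c) -> dual_norm f <= c.
Proof.
by move=> fc; apply: ge_sup; [exact: unit_image_neq0|move=> _ [x /= /fc ? <-]].
Qed.

Let dual_norm_ge0 f : 0 <= dual_norm f.
Proof.
apply: ub_le_sup; first exact: unit_image_ub.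
by exists 0; rewrite /= ?linear0 normr0.
Qed.

Let dual_le_norm f x : `|x| <= 1 -> `|f x| <= dual_norm f.
Proof. by move=> x1; rewrite (le_trans (le_dual_norm f x)) // ler_piMr. Qed.

Let dual_normD f g : dual_norm (f + g) <= dual_norm f + dual_norm g.
Proof.
apply: dual_norm_le => x x1.
by rewrite (le_trans (ler_normD (f x) (g x))) // lerD // dual_le_norm.
Qed.

Let dual_normZ_le (a : R) f : dual_norm (a *: f) <= `|a| * dual_norm f.
Proof.
apply: dual_norm_le => x x1.
by rewrite [X in `|X|](_ : _ = a * f x) // normrM ler_wpM2l // dual_le_norm.
Qed.

Let dual_normZ (a : R) f : dual_norm (a *: f) = `|a| * dual_norm f.
Proof.
apply/le_anti; rewrite dual_normZ_le /=.
have [->|a0] := eqVneq a 0; first by rewrite normr0 mul0r dual_norm_ge0.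
rewrite -ler_pdivlMl ?normr_gt0 // -normfV.
by have := dual_normZ_le a^-1 (a *: f); rewrite scalerA mulVf // scale1r.
Qed.

Let dual_norm_eq0 f : dual_norm f = 0 -> f = 0.
Proof.
move=> f0; apply/val_inj/funext => x /=; apply/eqP; rewrite -normr_le0.
by rewrite (le_trans (le_dual_norm f x)) // f0 mul0r.
Qed.

HB.instance Definition _ :=
  Lmodule_isNormed.Build R dual dual_normD dual_normZ dual_norm_eq0.

(* The canonical topology of dual X is the norm topology; wdual X is the same
   set with the topology of pointwise convergence on X. *)
Definition wdual :=
  initial_topology (fun f : dual => (f : {ptws X -> R^o})).
HB.instance Definition _ := Topological.on wdual.

Definition wstar_compact (C : set dual) := compact (C : set wdual).

Definition support_fun (x : X) (C : set dual) : \bar R :=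
  ereal_sup [set (xs x)%:E | xs in C].

End Dual.

Section BanachSpaces.
Context {R : realType} (X : normedModType R).

Definition separable := exists2 D : set X, countable D & dense D.

Definition asplund :=
  forall (D : set X) (f : X -> R),
    open D -> convex_set D -> {in D, continuous f} -> convex_function D f ->
    D `<=` closure [set x | D x /\ differentiable f x].

End BanachSpaces.

Section Subdifferentials.
Context {R : realType} {X : normedModType R}.
Local Open Scope ereal_scope.
Implicit Types (phi : X -> \bar R) (x h : X) (xs : dual X).

(* In \bar R, +oo - +oo = -oo, so the condition fails when phi x = +oo. *)
Definition frechet_subgradient phi x xs :=
  0 <= limf_einf
    (fun y => (phi y - phi x - (xs (y - x)%R)%:E) * (`|y - x|^-1)%:E) x^'.

Definition limiting_subdifferential phi x : set (dual X) :=
  [set xs | exists (u : nat -> X) (us : nat -> dual X),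
    [/\ u @ \oo --> x,
        (us : nat -> wdual X) @ \oo --> (xs : wdual X) &
        forall k, frechet_subgradient phi (u k) (us k)]].

Definition clarke_derivative phi x h : \bar R :=
  limf_esup
    (fun p : X * R => (phi (p.1 + p.2 *: h)%R - phi p.1) * (p.2^-1)%:E)
    (filter_prod (nbhs x) 0^'+).

Definition generalized_gradient phi x : set (dual X) :=
  [set xs | forall h, (xs h)%:E <= clarke_derivative phi x h].

Definition regular_at phi x :=
  forall h, (phi (x + t *: h)%R - phi x) * (t^-1)%:E @[t --> 0^'+]
              --> clarke_derivative phi x h.

End Subdifferentials.

Section Saturation.
Context {R : realType} {d : measure_display} {T : measurableType d}.
Variable mu : {measure set T -> \bar R}.
Local Open Scope ereal_scope.

(* Functions need only be integrable over E, and their values off E are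
   irrelevant, so that T -> R stands for the functions on E. *)
Definition L1_separable (E : set T) :=
  exists g : nat -> T -> R,
    (forall n, mu.-integrable E (EFin \o g n)) /\
    forall f : T -> R, mu.-integrable E (EFin \o f) ->
      forall e : R, (0 < e)%R ->
        exists n, \int[mu]_(w in E) (`|f w - g n w|)%:E < e%:E.

Definition saturated :=
  forall E : set T, measurable E -> 0 < mu E -> ~ L1_separable E.

End Saturation.

Section BochnerIntegral.
Context {R : realType} {d : measure_display} {T : measurableType d}.
Context {V : normedModType R}.
Variable mu : {measure set T -> \bar R}.
Implicit Types (f s : T -> V).

Definition simple_fun s :=
  finite_set (range s) /\ forall v, measurable (s @^-1` [set v]).

Definition simple_integral s : V :=
  \sum_(v \in range s) fine (mu (s @^-1` [set v])) *: v.

Definition bochner_approx f (u : nat -> T -> V) :=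
  [/\ forall n, simple_fun (u n),
      {ae mu, forall w, u n w @[n --> \oo] --> f w} &
      (\int[mu]_w (`|f w - u n w|)%:E)%E @[n --> \oo] --> 0%E].

Definition bochner_integrable f := exists u, bochner_approx f u.

Definition is_bochner_integral f (y : V) :=
  exists2 u, bochner_approx f u & simple_integral (u n) @[n --> \oo] --> y.

Definition set_bochner_integral (G : T -> set V) : set V :=
  [set y | exists f, [/\ bochner_integrable f, {ae mu, forall w, G w (f w)} &
                         is_bochner_integral f y]].

End BochnerIntegral.

Section WeakStarIntegrals.
Context {R : realType} {d : measure_display} {T : measurableType d}.
Context {X : normedModType R}.
Variable mu : {measure set T -> \bar R}.
Implicit Types (f : T -> dual X) (G : T -> set (dual X)).
Local Open Scope ereal_scope.

Definition wstar_scalarly_measurable f :=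
  forall x, measurable_fun [set: T] (fun w => f w x : R).

Definition is_gelfand_integral f (y : dual X) :=
  forall x, mu.-integrable [set: T] (fun w => (f w x)%:E) /\
            (y x)%:E = \int[mu]_w (f w x)%:E.

Definition gelfand_integrable f :=
  wstar_scalarly_measurable f /\ exists y, is_gelfand_integral f y.

Definition gelfand_selectors G : set (T -> dual X) :=
  [set f | gelfand_integrable f /\ {ae mu, forall w, G w (f w)}].

Definition set_gelfand_integrable G := gelfand_selectors G !=set0.

Definition set_gelfand_integral G : set (dual X) :=
  [set y | exists2 f, gelfand_selectors G f & is_gelfand_integral f y].

Definition set_wstar_scalarly_measurable G :=
  forall x, measurable_fun [set: T] (fun w => support_fun x (G w)).

Definition set_wstar_scalarly_integrable G :=
  forall x, mu.-integrable [set: T] (fun w => support_fun x (G w)).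

Definition is_wstar_integral G (C : set (dual X)) :=
  [/\ set_wstar_scalarly_integrable G,
      forall w, G w !=set0 /\ wstar_compact (G w) /\ convex_set (G w) &
      unique (fun K : set (dual X) =>
        [/\ wstar_compact K, convex_set K &
            forall x, support_fun x K = \int[mu]_w support_fun x (G w)]) C].

End WeakStarIntegrals.

(* Main.v *)
(** The Clarke directional derivative s(w) of phi(., w) at xbar is a sublinear
    functional whose minorants form the generalized gradient. Since X* is separable
    (X being separable and Asplund), there is a smooth variational principle on X, which
    yields an approximate mean value inequality; together with Milman's theorem it shows
    that the extreme minorants of s(w) are limiting subgradients. Every minorant y of
    the integral of s is the integral of a measurable selection of minorants of s(w)
    (project y on the convex set of these integrals in a Hilbert norm), and by saturation
    the selection may be taken extreme: take one which is extremal for a greedy sequence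
    of orthogonal directions, and perturb it along a function orthogonal to countably
    many given ones if it fails to be extreme. Hence all the integrals in the theorem
    are the set of minorants of the integral of s. A limiting subgradient of I_phi is such
    a minorant by the reverse Fatou lemma, and conversely in the regular case because then
    the minorants are dominated by the directional derivative of I_phi. *)

From HB Require Import structures.
Require Import Defs.
From mathcomp Require Import all_boot all_order all_algebra.
From mathcomp Require Import all_classical all_reals all_analysis.
From mathcomp Require Import measurable_realfun ring lra zify.

Import Order.TTheory GRing.Theory Num.Theory.
Import numFieldNormedType.Exports.

Local Open Scope classical_set_scope.
Local Open Scope ring_scope.

Set Implicit Arguments.
Unset Strict Implicit.
Unset Printing Implicit Defensive.

(** Limiting subdifferentials need not be convex, and only the extreme minorants of the Clarke
    derivative are sure to belong to them; this is why a selection must be extreme, and where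
    saturation enters. Neither a measurable selection theorem nor Krein-Milman is invoked: a dense
    sequence of [X] is fixed, and maximizing successively along it singles out one extreme minorant
    through countable infima, which are measurable in a parameter and yield Hahn-Banach as well. The
    same sequence, scaled into the unit ball and weighted by [2 ^- n.+1], turns dual vectors into
    bounded real sequences, whose weighted sums of squares define a Hilbert norm; nearest points in
    it replace separation of convex sets. Selections are dominated by the integrable [l] only, so
    their squares need not be integrable: the norm on selections carries the density [1 / (1 + l)],
    which brings products of size [(1 + l) ^+ 2] back to integrable size. The smooth function behind
    the variational principle is the conjugate of a rotund weak-star lower semicontinuous function,
    built from a dense sequence of the dual. *)

(** * Series weighted by [2 ^- n.+1] *)

Section WeightedSums.
Context {R : realType}.
Implicit Types (a b : nat -> R) (M c e : R).

(** The weights add up to 1, so a uniform bound on the terms is also a bound on the sum. [limn] is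
    meaningful only for a convergent series, hence the bound [M] carried by the lemmas below. *)
Definition wsum a : R := limn (series (fun n => a n / 2 ^+ n.+1)).

Let psum a (m : nat) : R := series (fun n => a n / 2 ^+ n.+1) m.

Let psumS a m : psum a m.+1 = psum a m + a m / 2 ^+ m.+1.
Proof. by rewrite /psum seriesSr. Qed.

Let halfS m : (2 ^- m : R) = 2 ^- m.+1 + 2 ^- m.+1.
Proof. by rewrite exprS invfM; set t := 2 ^- m; field. Qed.

Let psum_dist a M m k : (forall n, `|a n| <= M) ->
  `|psum a (m + k) - psum a m| <= M * (2 ^- m - 2 ^- (m + k)).
Proof.
move=> aM; elim: k => [|k IH]; first by rewrite addn0 !subrr normr0 mulr0.
rewrite addnS psumS addrAC (le_trans (ler_normD _ _))//.
have -> : M * (2 ^- m - 2 ^- (m + k).+1) = M * (2 ^- m - 2 ^- (m + k)) + M * 2 ^- (m + k).+1.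
  by rewrite [in RHS](halfS (m + k)); ring.
apply: lerD => //; rewrite normrM [X in _ * X]ger0_norm ?invr_ge0 ?exprn_ge0//.
by rewrite ler_wpM2r ?invr_ge0 ?exprn_ge0.
Qed.

Let bnd_ge0 a M : (forall n, `|a n| <= M) -> 0 <= M.
Proof. by move=> /(_ 0%N); exact: le_trans. Qed.

Let half0 e : 0 < e -> exists m, 2 ^- m < e.
Proof.
move=> e0; have /cvgrPdist_lt/(_ _ e0)[m _ /(_ m (leqnn m))] :
    (fun n => 1 * 2^-1 ^+ n) @ \oo --> (0 : R).
  by apply: (@cvg_geometric R 1 2^-1); rewrite ger0_norm ?invr_ge0// invf_lt1// ltr1n.
rewrite mul1r sub0r normrN exprVn ger0_norm ?invr_ge0 ?exprn_ge0// => ?.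
by exists m.
Qed.

Let psum_cvg a M : (forall n, `|a n| <= M) -> psum a @ \oo --> wsum a.
Proof.
move=> aM; suff : cvgn (psum a) by [].
apply: normed_cvg; apply: nondecreasing_is_cvgn.
  by apply/nondecreasing_seqP => n; rewrite /= !seriesSr ler_wpDr.
exists M => _ [m _ <-].
pose c n := `|a n|; have cM n : `|c n| <= M by rewrite normr_id.
have -> : [normed series (fun n => a n / 2 ^+ n.+1)] m = psum c m.
  rewrite /psum /series /=; apply: eq_bigr => i _.
  by rewrite normrM [X in _ * X]ger0_norm ?invr_ge0 ?exprn_ge0.
have := psum_dist 0 m cM; rewrite {2}/psum /series/= big_geq// subr0 expr0 invr1 => h.
rewrite (le_trans (ler_norm _))// (le_trans h)// -[leRHS]mulr1 ler_wpM2l//.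
  exact: bnd_ge0 cM.
Qed.

Let wsum_tail a M m : (forall n, `|a n| <= M) -> `|wsum a - psum a m| <= M * 2 ^- m.
Proof.
move=> aM; have h : (fun k => `|psum a k - psum a m|) @ \oo --> `|wsum a - psum a m|.
  by apply: cvg_norm; apply: cvgB; [exact: psum_cvg aM|exact: cvg_cst].
apply: (@closed_cvg _ _ \oo _ (fun k => `|psum a k - psum a m|) [set x | x <= M * 2 ^- m]) => //.
exists m => // k /= mk; rewrite -(subnKC mk) (le_trans (psum_dist _ _ aM))//.
by rewrite ler_wpM2l ?(bnd_ge0 aM)// gerBl ?invr_ge0 ?exprn_ge0.
Qed.

Lemma cvg_wsum a M : (forall n, `|a n| <= M) ->
  series (fun n => a n / 2 ^+ n.+1) @ \oo --> wsum a.
Proof. exact: psum_cvg. Qed.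

Lemma wsumD a b M : (forall n, `|a n| <= M) -> (forall n, `|b n| <= M) ->
  wsum (fun n => a n + b n) = wsum a + wsum b.
Proof.
move=> aM bM; have abM n : `|a n + b n| <= M + M.
  by rewrite (le_trans (ler_normD _ _))// lerD.
apply: (cvg_unique _ (psum_cvg abM)) => //.
have -> : psum (fun n => a n + b n) = (fun n => psum a n + psum b n).
  apply/funext => n; rewrite /psum /series/= -big_split/=.
  by apply: eq_bigr => i _; rewrite mulrDl.
by apply: cvgD; [exact: psum_cvg aM|exact: psum_cvg bM].
Qed.

Lemma wsumZ a M c : (forall n, `|a n| <= M) -> wsum (fun n => c * a n) = c * wsum a.
Proof.
move=> aM; have caM n : `|c * a n| <= `|c| * M by rewrite normrM ler_wpM2l.
apply: (cvg_unique _ (psum_cvg caM)) => //.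
have -> : psum (fun n => c * a n) = (fun n => c * psum a n).
  apply/funext => n; rewrite /psum /series/= mulr_sumr.
  by apply: eq_bigr => i _; rewrite mulrA.
by apply: cvgMl_tmp; exact: psum_cvg aM.
Qed.

Lemma wsum_ge0 a M : (forall n, `|a n| <= M) -> (forall n, 0 <= a n) -> 0 <= wsum a.
Proof.
move=> aM a0; apply: (@closed_cvg _ _ \oo _ (psum a) [set x | 0 <= x]) => //.
- by apply: nearW => m; apply: sumr_ge0 => i _; rewrite divr_ge0 ?exprn_ge0.
- exact: psum_cvg aM.
Qed.

Lemma wsumN a M : (forall n, `|a n| <= M) -> wsum (fun n => - a n) = - wsum a.
Proof.
move=> aM; rewrite -mulN1r -(wsumZ (-1) aM); congr wsum.
by apply/funext => n; rewrite mulN1r.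
Qed.

Lemma le_wsum a b M : (forall n, `|a n| <= M) -> (forall n, `|b n| <= M) ->
  (forall n, a n <= b n) -> wsum a <= wsum b.
Proof.
move=> aM bM ab; rewrite -subr_ge0 -(wsumN aM) -(@wsumD _ _ M)//; last first.
  by move=> n; rewrite normrN.
apply: (@wsum_ge0 _ (M + M)) => n; last by rewrite subr_ge0.
by rewrite (le_trans (ler_normB _ _))// lerD.
Qed.

Lemma wsum_cst c : wsum (fun=> c) = c.
Proof.
apply/eqP; rewrite -subr_eq0 -normr_le0; apply/ler_addgt0Pl => e e0.
have c1 : 0 < `|c| + `|c| + 1 by rewrite ltr_wpDl// addr_ge0.
have [m me] := half0 (divr_gt0 e0 c1).
have cM (n : nat) : `|c| <= `|c| by [].
have h k : psum (fun=> c) k = c - c * 2 ^- k.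
  elim: k => [|k IH]; first by rewrite /psum /series/= big_geq// expr0 invr1 mulr1 subrr.
  by rewrite psumS IH (halfS k); ring.
have := wsum_tail m cM; rewrite h addr0 => t.
have -> : wsum (fun=> c) - c = (wsum (fun=> c) - (c - c * 2 ^- m)) - c * 2 ^- m by ring.
rewrite (le_trans (ler_normB _ _))//.
rewrite normrM [X in _ + _ * X]ger0_norm ?invr_ge0 ?exprn_ge0//.
apply: le_trans (lerD t (lexx _)) _; rewrite -mulrDl.
move: me; rewrite ltr_pdivlMr// => /ltW; apply: le_trans.
by rewrite mulrC ler_wpM2l ?invr_ge0 ?exprn_ge0// lerDl.
Qed.

Lemma wsum_norm_le a M : (forall n, `|a n| <= M) -> `|wsum a| <= M.
Proof.
move=> aM; rewrite ler_norml -[M in - M]wsum_cst -[M in _ && (_ <= M)]wsum_cst.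
have cM (n : nat) : `|M| <= M by rewrite ger0_norm// (bnd_ge0 aM).
rewrite -(wsumN cM); apply/andP; split; apply: (@le_wsum _ _ M) => // n.
- by rewrite normrN; exact: cM 0%N.
- by have := aM n; rewrite ler_norml => /andP[].
- by rewrite (le_trans (ler_norm _)).
Qed.

Lemma le_wsum_term a M m : (forall n, `|a n| <= M) -> (forall n, 0 <= a n) ->
  a m / 2 ^+ m.+1 <= wsum a.
Proof.
move=> aM a0; have ps : nondecreasing_seq (psum a).
  by apply/nondecreasing_seqP => n; rewrite psumS lerDl divr_ge0// exprn_ge0.
have := nondecreasing_cvgn_le ps (cvgP _ (psum_cvg aM)) m.+1.
rewrite (cvg_lim _ (psum_cvg aM))//; apply: le_trans.
by rewrite psumS lerDr sumr_ge0// => i _; rewrite divr_ge0// exprn_ge0.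
Qed.

(** The tails are at most [M * 2 ^- m] uniformly in [i], so finitely many terms decide. An arbitrary
    filter is allowed because the lemma serves for weak-star neighbourhoods as well as for
    sequences. *)
Lemma wsum_lsc (I : Type) (F : set_system I) {FF : Filter F} a (b : I -> nat -> R) M :
  (forall n, `|a n| <= M) -> (\forall i \near F, forall n, `|b i n| <= M) ->
  (forall n e, 0 < e -> \forall i \near F, a n <= b i n + e) ->
  forall e, 0 < e -> \forall i \near F, wsum a <= wsum (b i) + e.
Proof.
move=> aM bM ab e e0; have M0 := bnd_ge0 aM.
have c1 : 0 < M + M + 1 by rewrite ltr_wpDl// addr_ge0.
have e2 : 0 < e / 2 by rewrite divr_gt0.
have [m me] := half0 (divr_gt0 e2 c1).
have : \forall i \near F, psum a m <= psum (b i) m + e / 2.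
  have : \forall i \near F, forall n, (n < m)%N -> a n <= b i n + e / 2.
    elim: m {me} => [|m IH]; first exact: nearW.
    have h := ab m _ e2.
    apply: filterS2 IH h => i h1 h2 n; rewrite ltnS leq_eqVlt => /orP[/eqP ->//|].
    exact: h1.
  apply: filterS => i h.
  suff : psum a m <= psum (b i) m + e / 2 * (1 - 2 ^- m).
    move=> /le_trans; apply; rewrite lerD2l -[leRHS]mulr1 ler_wpM2l ?divr_ge0// ?ltW//.
  elim: m {me} h => [|m IH] h.
    by rewrite /psum /series/= !big_geq// expr0 invr1 subrr mulr0 addr0.
  rewrite !psumS; have h1 := IH (fun n nm => h n (ltnW nm)).
  have h2 := h m (ltnSn m).
  have : a m / 2 ^+ m.+1 <= (b i m + e / 2) / 2 ^+ m.+1.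
    by rewrite ler_wpM2r// invr_ge0 exprn_ge0.
  rewrite (halfS m) in h1; move: h1; set t := 2 ^- m.+1 => h1 h3; nra.
apply: filterS2 bM => i bM h.
have := wsum_tail m aM; have := wsum_tail m bM.
rewrite !ler_norml => /andP[t1 t2] /andP[t3 t4].
move: me; rewrite ltr_pdivlMr// => me.
have : M * 2 ^- m + M * 2 ^- m <= e / 2.
  apply: le_trans (ltW me); rewrite -mulrDl mulrC ler_wpM2l ?invr_ge0 ?exprn_ge0//.
  by rewrite lerDl.
by move: (M * 2 ^- m) t1 t2 t3 t4 => z; lra.
Qed.

Lemma wsum_cvg (I : Type) (F : set_system I) {FF : Filter F} a (b : I -> nat -> R) M :
  (forall n, `|a n| <= M) -> (\forall i \near F, forall n, `|b i n| <= M) ->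
  (forall n, b ^~ n @ F --> a n) -> (fun i => wsum (b i)) @ F --> wsum a.
Proof.
move=> aM bM ab; apply/cvgrPdist_le => e e0.
have h1 : \forall i \near F, wsum a <= wsum (b i) + e.
  apply: (wsum_lsc aM bM) => // n d d0.
  have /cvgrPdist_le/(_ _ d0) := ab n; apply: filterS => i.
  by rewrite ler_norml => /andP[_]; rewrite lerBlDl.
have h2 : \forall i \near F, wsum (fun n => - a n) <= wsum (fun n => - b i n) + e.
  apply: (@wsum_lsc _ F _ _ (fun i n => - b i n) M) => //.
  - by move=> n; rewrite normrN.
  - by apply: filterS bM => i h n; rewrite normrN.
  move=> n d d0; have /cvgrPdist_le/(_ _ d0) := ab n; apply: filterS => i.
  by rewrite ler_norml => /andP[+ _]; lra.
apply: filterS3 bM h1 h2 => i bM h1; rewrite (wsumN aM) (wsumN bM) => h2.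
by rewrite ler_norml; apply/andP; split; lra.
Qed.

End WeightedSums.

(** * Dense sequences and pointwise limits of functionals *)

Definition dense_seq {R : realType} {X : normedModType R} (x : nat -> X) :=
  forall z e, 0 < e -> exists n, `|z - x n| < e.

Lemma separable_dense_seq {R : realType} (X : normedModType R) : separable X ->
  exists x : nat -> X, dense_seq x.
Proof.
case=> D cD dD.
have [d0 [d0D _]] : D `&` setT !=set0.
  by rewrite setIC; apply: dD; [exists 0|exact: openT].
have /pfcard_geP[D0|[f]] : (D #<= [set: nat])%card by [].
  by move: d0D; rewrite D0.
exists f => z e e0; have [y [yb yD]] : ball z e `&` D !=set0.
  apply: dD; [by exists z; exact: ballxx|exact: ball_open].
have [n _ ny] : (f @` setT) y by apply: surj.
exists n.
by rewrite ny; move: yb; rewrite -ball_normE.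
Qed.

Section DualToolkit.
Context {R : realType} {X : normedModType R}.
Implicit Types (p q : dual X) (x y : X) (a c M : R).

Lemma dual_ext p q : (forall x, p x = q x) -> p = q.
Proof. by move=> pq; apply/val_inj/funext => x /=; exact: pq. Qed.

Lemma dualDE p q x : (p + q) x = p x + q x. Proof. by []. Qed.
Lemma dualNE p x : (- p) x = - p x. Proof. by []. Qed.
Lemma dualBE p q x : (p - q) x = p x - q x. Proof. by []. Qed.
Lemma dualZE a p x : (a *: p) x = a * p x. Proof. by []. Qed.
Lemma dual0E x : (0 : dual X) x = 0. Proof. by []. Qed.
Lemma dual_add p x y : p (x + y) = p x + p y. Proof. exact: linearD. Qed.
Lemma dual_sub p x y : p (x - y) = p x - p y. Proof. exact: linearB. Qed.
Lemma dual_opp p x : p (- x) = - p x. Proof. exact: linearN. Qed.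
Lemma dual_scale p a x : p (a *: x) = a * p x. Proof. exact: linearZ. Qed.
Lemma dual_zero p : p 0 = 0. Proof. exact: linear0. Qed.

Lemma dual_norm_ub p x : `|p x| <= `|p| * `|x|.
Proof. exact: le_dual_norm. Qed.

Lemma dual_ub p x : p x <= `|p| * `|x|.
Proof. exact: le_trans (ler_norm _) (dual_norm_ub p x). Qed.

Lemma dual_norm_le p c : 0 <= c -> (forall x, p x <= c * `|x|) -> `|p| <= c.
Proof.
move=> c0 pc; apply: ge_sup; first by exists `|p 0|, 0; rewrite //= normr0.
move=> _ [x /= x1 <-]; apply: (@le_trans _ _ (c * `|x|)); last by rewrite ler_piMr.
by rewrite ler_norml pc andbT lerNl -dual_opp (le_trans (pc _))// normrN.
Qed.

(** A one-sided bound is enough since [f (- x) = - f x]; [M] may have any sign, which is why its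
    absolute value appears in the proof. *)
Lemma dual_of (f : X -> R) M : (forall x y, f (x + y) = f x + f y) ->
  (forall a x, f (a *: x) = a * f x) -> (forall x, f x <= M * `|x|) ->
  exists p, forall x, p x = f x.
Proof.
move=> fD fZ fM.
have fs : scalar (f : X -> R^o) by move=> a x y; rewrite fD fZ.
pose lf := GRing.isLinear.Build R X R^o *%R f fs.
pose F : {linear X -> R^o} := HB.pack (f : X -> R^o) lf.
have fc : continuous (F : X -> R^o).
  apply: bounded_linear_continuous; apply/linear_boundedP.
  exists `|M|; split => // r Mr x; apply: (@le_trans _ _ (`|M| * `|x|)); last first.
    by rewrite ler_wpM2r// ltW.
  have fMx y : f y <= `|M| * `|y|.
    by rewrite (le_trans (fM _))// ler_wpM2r// ler_norm.
  rewrite ler_norml fMx andbT lerNl; have := fMx (- x).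
  by rewrite normrN -scaleN1r fZ mulN1r.
have fd : (f : X -> R^o) \in @is_dual R X by apply/asboolP.
by exists (Dual fd).
Qed.

Lemma dense_dual_eq0 (u : nat -> X) p : dense_seq u -> (forall n, p (u n) = 0) -> p = 0.
Proof.
move=> du pu; apply: dual_ext => x; apply/eqP; rewrite dual0E -normr_le0.
apply/ler_addgt0Pl => e e0; rewrite addr0.
have p1 : 0 < `|p| + 1 by rewrite ltr_wpDl.
have [n xn] := du x _ (divr_gt0 e0 p1).
have -> : p x = p (x - u n) by rewrite dual_sub pu subr0.
rewrite (le_trans (dual_norm_ub _ _))//.
move: xn; rewrite ltr_pdivlMr// => /ltW; apply: le_trans.
by rewrite mulrC ler_wpM2l// lerDl.
Qed.

(** The common bound [M] makes the functionals equicontinuous, so convergence spreads from the dense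
    sequence to all of [X]. The weak-star limits of sequences below are produced in this way. *)
Lemma dual_ptlim (u : nat -> X) (p : nat -> dual X) M : dense_seq u ->
  (forall k, `|p k| <= M) -> (forall n, cvgn (fun k => p k (u n) : R)) ->
  exists2 q : dual X, `|q| <= M & forall x, (fun k => p k x : R) @ \oo --> (q x : R).
Proof.
move=> du pM pu; have M0 : 0 <= M by apply: le_trans (pM 0%N).
have cv x : cvgn (fun k => p k x : R).
  apply: cauchy_cvg; apply: cauchy_exP => e e0.
  have M1 : 0 < M + 1 by rewrite ltr_wpDl.
  have e2 : 0 < e / 2 by rewrite divr_gt0.
  have [n xn] := du x _ (divr_gt0 e2 M1).
  exists (limn (fun k => p k (u n) : R)).
  have /cvgrPdist_lt/(_ _ e2) := pu n; apply: filterS => k h.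
  rewrite -ball_normE /=.
  have -> : limn (fun k => p k (u n) : R) - p k x =
    (limn (fun k => p k (u n) : R) - p k (u n)) - p k (x - u n).
    by rewrite dual_sub; set L := limn _; ring.
  rewrite (le_lt_trans (ler_normB _ _))// [e in _ < e]splitr ltr_leD//.
  rewrite (le_trans (dual_norm_ub _ _))//.
  move: xn; rewrite ltr_pdivlMr// => /ltW; apply: le_trans.
  by rewrite mulrC ler_wpM2l// (le_trans (pM k))// lerDl.
have cl x : (fun k => p k x : R) @ \oo --> limn (fun k => p k x : R) := cv x.
have [|||q qE] := @dual_of (fun x => limn (fun k => p k x : R)) M.
- move=> x y; apply/cvg_lim => //.
  rewrite [X in X @ _ --> _](_ : _ = (fun k => p k x + p k y : R)); first exact: cvgD.
  by apply/funext => k; rewrite dual_add.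
- move=> a x; apply/cvg_lim => //.
  rewrite [X in X @ _ --> _](_ : _ = (fun k => a * p k x : R)); first exact: cvgMl_tmp.
  by apply/funext => k; rewrite dual_scale.
- move=> x; apply: limr_le => //; apply: nearW => k.
  by rewrite (le_trans (dual_ub _ _))// ler_wpM2r.
exists q; last by move=> x; rewrite qE.
apply: dual_norm_le => // x; rewrite qE; apply: limr_le => //; apply: nearW => k.
by rewrite (le_trans (dual_ub _ _))// ler_wpM2r.
Qed.

End DualToolkit.

(** * Sublinear functionals, their faces and extreme minorants *)

Section Sublinear.
Context {R : realType} {X : normedModType R}.
Implicit Types (s : X -> R) (e g : dual X) (x y u v : X) (M : R).

Definition sublinear M s := [/\ forall x y, s (x + y) <= s x + s y,
  forall t x, 0 <= t -> s (t *: x) = t * s x & forall x, s x <= M * `|x|].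

Definition extreme_minorant s e := (forall u, e u <= s u) /\
  forall g, (forall u, e u + g u <= s u) -> (forall u, e u - g u <= s u) -> g = 0.

Lemma sublinear0 M s : sublinear M s -> s 0 = 0.
Proof. by case=> _ h _; rewrite -(scale0r 0) h// mul0r. Qed.

Lemma sublinear_opp M s x : sublinear M s -> - s (- x) <= s x.
Proof.
by move=> ss; case: (ss) => h _ _; rewrite -subr_ge0 opprK -(sublinear0 ss) -[X in s X](subrr x) h.
Qed.

Lemma sublinear_norm_le M s x : sublinear M s -> `|s x| <= M * `|x|.
Proof.
move=> ss; have [_ _ h] := ss; rewrite ler_norml h andbT.
by rewrite (le_trans _ (sublinear_opp x ss))// lerN2 (le_trans (h _))// normrN.
Qed.

Lemma sublinear_lip M s x y : sublinear M s -> `|s x - s y| <= M * `|x - y|.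
Proof.
move=> [h1 _ h2]; rewrite ler_norml; apply/andP; split.
- rewrite lerNl opprB lerBlDr; have := h1 (y - x) x; rewrite subrK => /le_trans; apply.
  by rewrite lerD2r (le_trans (h2 _))// distrC.
- rewrite lerBlDr; have := h1 (x - y) y; rewrite subrK => /le_trans; apply.
  by rewrite lerD2r.
Qed.

(** The one-sided derivative of [s] at [x] in the direction [u]: by homogeneity the terms with
    [n > 0] are the difference quotients of step [1 / n], and they decrease with [n]. The minorants
    of [face s x] are the minorants of [s] that touch [s] at [x]. A countable infimum keeps
    measurability in a parameter. *)
Definition face s x u := infs (fun n => s (u + n%:R *: x) - n%:R * s x) 0.

Lemma infs_le_term (a : nat -> R) c n : (forall n, c <= a n) -> infs a 0 <= a n.
Proof.
by move=> ca; apply: ge_inf; [exists c => _ [k _ <-]|exists n].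
Qed.

Lemma le_infs (a : nat -> R) c : (forall n, c <= a n) -> c <= infs a 0.
Proof.
by move=> ca; apply: lb_le_inf; [exists (a 0%N), 0%N|move=> _ [k _ <-]].
Qed.

Section Face.
Variables (M : R) (s : X -> R) (x : X).
Hypothesis ss : sublinear M s.

Let subD : forall x y, s (x + y) <= s x + s y. Proof. by case: ss. Qed.
Let subZ : forall t x, 0 <= t -> s (t *: x) = t * s x. Proof. by case: ss. Qed.

Let face_lb u n : - s (- u) <= s (u + n%:R *: x) - n%:R * s x.
Proof.
rewrite lerNl opprB lerBlDr -subZ//.
by have := subD (- u) (u + n%:R *: x); rewrite addKr addrC.
Qed.

(** The right-hand side decreases with [r], so a real [r] is compared with a larger integer. *)
Lemma face_real u r : 0 <= r -> face s x u <= s (u + r *: x) - r * s x.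
Proof.
move=> r0; have [n rn] : exists n : nat, r <= n%:R.
  by exists (Num.bound r); apply/ltW/archi_boundP.
apply: le_trans (infs_le_term n (face_lb u)) _.
have := subD (u + r *: x) ((n%:R - r) *: x).
rewrite -addrA -scalerDl (addrC r) subrK subZ ?subr_ge0//.
move: (s _) (s _) => A B; lra.
Qed.

Lemma face_le u : face s x u <= s u.
Proof. by have := face_real u (lexx 0); rewrite scale0r addr0 mul0r subr0. Qed.

Lemma face_opp : face s x (- x) <= - s x.
Proof.
have := face_real (- x) ler01; rewrite scale1r addNr (sublinear0 ss) mul1r sub0r.
exact.
Qed.

Lemma sublinear_face : sublinear M (face s x).
Proof.
have fD u v : face s x (u + v) <= face s x u + face s x v.
  rewrite -lerBlDl; apply: le_infs => m; rewrite lerBlDl -lerBlDr.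
  apply: le_infs => n; rewrite lerBlDr.
  apply: le_trans (@face_real _ (n%:R + m%:R) _) _; first by rewrite addr_ge0.
  have := subD (u + n%:R *: x) (v + m%:R *: x).
  rewrite addrACA -scalerDl mulrDl; move: (s _) (s _) (s _) (s _) => A B C D; lra.
split => //.
- suff h t u : 0 < t -> face s x (t *: u) <= t * face s x u.
    move=> t u; rewrite le_eqVlt => /orP[/eqP <-|t0].
      rewrite scale0r mul0r; apply/le_anti/andP; split.
        by rewrite (le_trans (face_le 0))// (sublinear0 ss).
      by rewrite (le_trans _ (le_infs (face_lb 0)))// oppr0 (sublinear0 ss) oppr0.
    apply/le_anti; rewrite h//= -ler_pdivlMl//.
    apply: le_trans (h _ _ _); last by rewrite invr_gt0.
    by rewrite scalerA mulVf ?gt_eqF// scale1r.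
  move=> t0; rewrite -ler_pdivrMl//; apply: le_infs => n; rewrite ler_pdivrMl//.
  apply: le_trans (@face_real _ (t * n%:R) _) _; first by rewrite mulr_ge0// ltW.
  by rewrite -scalerA -scalerDr subZ ?(ltW t0)// mulrBr mulrA lexx.
- by move=> u; rewrite (le_trans (face_le u))//; case: ss.
Qed.

Lemma le_face e : (forall u, e u <= s u) -> e x = s x -> forall u, e u <= face s x u.
Proof.
move=> es ex u; apply: le_infs => n; rewrite -ex -dual_scale lerBrDr -dual_add.
exact: es.
Qed.

End Face.

(** Monotonicity serves subadditivity: indices chosen separately for [u] and [v] are replaced by
    their maximum. *)
Lemma sublinear_infs M (S : nat -> X -> R) : (forall k, sublinear M (S k)) ->
  (forall k m u, (k <= m)%N -> S m u <= S k u) ->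
  sublinear M (fun u => infs (S^~ u) 0).
Proof.
move=> fs fs_le.
have fs_lb u k : - (M * `|u|) <= S k u.
  by have := sublinear_norm_le u (fs k); rewrite ler_norml => /andP[].
have fl_le k u : infs (S^~ u) 0 <= S k u by exact: infs_le_term k (fs_lb u).
split.
- move=> u v; rewrite -lerBlDl; apply: le_infs => m; rewrite lerBlDl -lerBlDr.
  apply: le_infs => n; rewrite lerBlDr (le_trans (fl_le (maxn m n) _))//.
  have [h _ _] := fs (maxn m n); rewrite (le_trans (h _ _))//.
  by rewrite lerD// fs_le// ?leq_maxl ?leq_maxr.
- suff h t u : 0 < t -> infs (S^~ (t *: u)) 0 <= t * infs (S^~ u) 0.
    move=> t u; rewrite le_eqVlt => /orP[/eqP <-|t0].
      rewrite scale0r mul0r; apply/le_anti/andP; split.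
        by rewrite (le_trans (fl_le 0%N 0))//= (sublinear0 (fs 0%N)).
      by apply: le_infs => n; rewrite (sublinear0 (fs n)).
    apply/le_anti; rewrite h//= -ler_pdivlMl//.
    apply: le_trans (h _ _ _); last by rewrite invr_gt0.
    by rewrite scalerA mulVf ?gt_eqF// scale1r.
  move=> t0; rewrite -ler_pdivrMl//; apply: le_infs => n; rewrite ler_pdivrMl//.
  by have [_ h2 _] := fs n; rewrite -h2 ?(ltW t0)// fl_le.
- by move=> u; rewrite (le_trans (fl_le 0%N u))//; case: (fs 0%N).
Qed.

Fixpoint faces s (x : nat -> X) k :=
  if k is k'.+1 then face (faces s x k') (x k') else s.

(** A lexicographic maximization along [x]: among the minorants of [s], those largest at [x 0],
    among these the ones largest at [x 1], and so on. For a dense sequence a single functional is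
    left. *)
Definition face_limit s (x : nat -> X) u := infs (fun k => faces s x k u) 0.

Section FaceLimit.
Variables (M : R) (s : X -> R) (x : nat -> X).
Hypotheses (ss : sublinear M s) (dx : dense_seq x).

Let fs k : sublinear M (faces s x k).
Proof. by elim: k => //= k; exact: sublinear_face. Qed.

Let fs_lb u k : - (M * `|u|) <= faces s x k u.
Proof. by have := sublinear_norm_le u (fs k); rewrite ler_norml => /andP[]. Qed.

Let fs_le k m u : (k <= m)%N -> faces s x m u <= faces s x k u.
Proof.
elim: m => [|m IH]; first by rewrite leqn0 => /eqP ->.
rewrite leq_eqVlt => /orP[/eqP ->//|]; rewrite ltnS => /IH; apply: le_trans.
exact: face_le (fs m) _.
Qed.

Let fl_le k u : face_limit s x u <= faces s x k u.
Proof. exact: infs_le_term k (fs_lb u). Qed.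

Let fl_opp k : face_limit s x (- x k) <= - faces s x k (x k).
Proof. exact: le_trans (fl_le k.+1 _) (face_opp (x k) (fs k)). Qed.

Let fl_sublinear : sublinear M (face_limit s x).
Proof. exact: sublinear_infs. Qed.

(** The face of stage [k.+1] has no width left in the direction [x k], which [fl_opp] records;
    density and the Lipschitz bound carry this over to every [u]. *)
Let fl_oppE u : face_limit s x (- u) = - face_limit s x u.
Proof.
apply/le_anti/andP; split; last first.
  by have := sublinear_opp (- u) fl_sublinear; rewrite (opprK u).
apply/ler_addgt0Pl => e e0.
have M1 : 0 < `|M| + 1 by rewrite ltr_wpDl.
have e2 : 0 < e / 2 by rewrite divr_gt0.
have [n un] := dx u (divr_gt0 e2 M1).
have h1 := sublinear_lip (- u) (- x n) fl_sublinear.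
have h2 := sublinear_lip u (x n) fl_sublinear.
have h3 : M * `|u - x n| <= e / 2.
  move: un; rewrite ltr_pdivlMr// => /ltW; apply: le_trans.
  by rewrite mulrC ler_wpM2l// (le_trans (ler_norm _))// lerDl.
have h4 : face_limit s x (- x n) <= - face_limit s x (x n).
  by rewrite (le_trans (fl_opp n))// lerN2 fl_le.
rewrite [`|- u - - x n|](_ : _ = `|u - x n|) in h1; last by rewrite opprK addrC distrC.
move: h1 h2 h3 h4; rewrite !ler_norml.
move: (face_limit _ _ _) (face_limit _ _ _) (face_limit _ _ _) (face_limit _ _ _).
move=> A B C D /andP[? ?] /andP[? ?] ? ?; lra.
Qed.

Lemma face_limit_dual : exists e : dual X, forall u, e u = face_limit s x u.
Proof.
have [hD hZ hM] := fl_sublinear; apply: dual_of hM => [u v|a u].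
  apply/le_anti; rewrite hD/= -lerN2 opprD -!fl_oppE opprD.
  exact: hD.
have [/hZ//|a0] := leP 0 a.
have -> : a *: u = - ((- a) *: u) by rewrite scaleNr opprK.
by rewrite fl_oppE hZ ?oppr_ge0 1?ltW// mulNr opprK.
Qed.

(** If [e + g] and [e - g] are minorants, both stay in the current face at every stage, because [e]
    is already maximal at [x k]; hence [g (x k) = 0] for all [k], and [g] vanishes on a dense
    set. *)
Lemma face_limit_extreme e : (forall u, e u = face_limit s x u) ->
  extreme_minorant s e /\ e (x 0%N) = s (x 0%N).
Proof.
move=> eE; have es u : e u <= s u by rewrite eE; exact: fl_le 0%N u.
have ek k : faces s x k (x k) <= e (x k).
  by rewrite eE -[face_limit _ _ _]opprK -fl_oppE lerNr fl_opp.
split; last by apply/le_anti; rewrite es/= (ek 0%N).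
split => // g eg1 eg2.
have gk k : (forall u, e u + g u <= faces s x k u) /\ (forall u, e u - g u <= faces s x k u) ->
    g (x k) = 0.
  move=> [h1 h2]; have := h1 (x k); have := h2 (x k); have := ek k.
  by move: (faces _ _ _ _) => A ? ? ?; lra.
apply: (dense_dual_eq0 dx) => k; refine (gk k _); elim: k => // k [IH1 IH2].
have gk0 := gk _ (conj IH1 IH2).
have ekE : e (x k) = faces s x k (x k).
  by apply/le_anti; rewrite ek andbT; have := IH1 (x k); rewrite gk0 addr0.
split.
  by apply: (@le_face _ _ (e + g)) => //; rewrite dualDE gk0 addr0.
by apply: (@le_face _ _ (e - g)) => //; rewrite dualBE gk0 subr0.
Qed.

End FaceLimit.

(** The prescribed direction [h] is put in front of the dense sequence, so it is the first to be
    maximized. *)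
Lemma hahn_banach_extreme (x : nat -> X) M s h : dense_seq x -> sublinear M s ->
  exists2 e, extreme_minorant s e & e h = s h.
Proof.
move=> dx ss; pose y n := if n is n'.+1 then x n' else h.
have dy : dense_seq y by move=> z e e0; have [n ?] := dx z _ e0; exists n.+1.
have [e eE] := face_limit_dual ss dy; exists e; by have [] := face_limit_extreme ss dy eE.
Qed.

Lemma norming_dual (x : nat -> X) h : dense_seq x ->
  exists2 e : dual X, `|e| <= 1 & e h = `|h|.
Proof.
move=> dx; have ss : sublinear 1 (fun x : X => `|x|).
  split => *; [exact: ler_normD| |by rewrite mul1r].
  by rewrite normrZ ger0_norm.
have [e [eh _] ?] := hahn_banach_extreme h dx ss.
by exists e => //; apply: dual_norm_le => // u; rewrite mul1r.
Qed.

End Sublinear.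

Lemma measurable_face_limit {R : realType} {X : normedModType R} d (T : measurableType d)
    (M : T -> R) (s : T -> X -> R) (x : nat -> X) (u : X) :
  (forall w, sublinear (M w) (s w)) ->
  (forall v, measurable_fun setT (s^~ v)) ->
  measurable_fun setT (fun w => face_limit (s w) x u).
Proof.
move=> ss ms.
have fs k w : sublinear (M w) (faces (s w) x k).
  by elim: k => //= k; exact: sublinear_face.
have lb k v w : - (M w * `|v|) <= faces (s w) x k v.
  by have := sublinear_norm_le v (fs k w); rewrite ler_norml => /andP[].
apply: measurable_fun_infs => [w _|k].
  by exists (- (M w * `|u|)) => _ [k _ <-].
elim: k u => [|k IH] v /=; first exact: ms.
apply: measurable_fun_infs => [w _|n].
  exists (- faces (s w) x k (- v)) => _ [n _ <-].
  have [h1 h2 _] := fs k w; rewrite lerNl opprB lerBlDr -h2//.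
  by have := h1 (- v) (v + n%:R *: x k); rewrite addKr addrC.
apply: measurable_funB; first exact: IH.
by apply: measurable_funM => //; exact: IH.
Qed.

(** * Infimal convolution and Milman's theorem *)

Section Milman.
Context {R : realType} {X : normedModType R}.
Variable x : nat -> X.
Hypothesis dx : dense_seq x.
Implicit Types (s : X -> R) (e g : dual X) (M : R).

(** The infimal convolution of [A] with the reflection of [B], computed along the dense sequence.
    Its minorants are the [p] with [p <= A] and [- p <= B]; it is used both for splitting a
    functional and for testing extremality. *)
Definition inf_conv (A B : X -> R) u := infs (fun n => A (u + x n) + B (x n)) 0.

Section InfConv.
Variables (M1 M2 : R) (A B : X -> R).
Hypotheses (sA : sublinear M1 A) (sB : sublinear M2 B).
Hypothesis AB0 : forall h, 0 <= A h + B h.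

Let lb u h : - A (- u) <= A (u + h) + B h.
Proof.
have [hD _ _] := sA; have := hD (- u) (u + h); rewrite addKr.
by have := AB0 h; move: (A h) (A _) (A _) (B h) => a b c d; lra.
Qed.

Lemma inf_conv_ge u c : (forall h, c <= A (u + h) + B h) -> c <= inf_conv A B u.
Proof. by move=> h; apply: le_infs => n. Qed.

Lemma inf_conv_le u h : inf_conv A B u <= A (u + h) + B h.
Proof.
apply/ler_addgt0Pl => e e0.
have M0 : 0 < `|M1| + `|M2| + 1 by rewrite ltr_wpDl// addr_ge0.
have [n hn] := dx h (divr_gt0 e0 M0).
apply: le_trans (infs_le_term n (fun n => lb u (x n))) _.
have := sublinear_lip (u + x n) (u + h) sA; have := sublinear_lip (x n) h sB.
have -> : u + x n - (u + h) = x n - h by rewrite opprD addrACA subrr add0r.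
rewrite !ler_norml => /andP[_ h1] /andP[_ h2].
move: hn; rewrite ltr_pdivlMr// distrC => hn.
have := normr_ge0 (x n - h); move: hn h1 h2; move: `|x n - h| => r hn h1 h2 r0.
have h3 : M1 * r <= `|M1| * r by rewrite ler_wpM2r// ler_norm.
have h4 : M2 * r <= `|M2| * r by rewrite ler_wpM2r// ler_norm.
move: (A _) (A _) (B _) (B _) h1 h2 h3 h4 hn => a1 a2 b1 b2 h1 h2 h3 h4 hn; nra.
Qed.

Lemma sublinear_inf_conv : sublinear M1 (inf_conv A B).
Proof.
have [AD AZ AM] := sA; have [BD BZ BM] := sB.
have c_le u : inf_conv A B u <= A u.
  by have := inf_conv_le u 0; rewrite addr0 (sublinear0 sB) addr0.
split.
- move=> u v; rewrite -lerBlDl; apply: inf_conv_ge => h; rewrite lerBlDl -lerBlDr.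
  apply: inf_conv_ge => k; rewrite lerBlDr.
  apply: le_trans (inf_conv_le _ (k + h)) _.
  have := AD (u + k) (v + h); have := BD k h; rewrite addrACA.
  by move: (A _) (A _) (A _) (B _) (B _) (B _) => a b c a' b' c'; lra.
- suff h t u : 0 < t -> inf_conv A B (t *: u) <= t * inf_conv A B u.
    move=> t u; rewrite le_eqVlt => /orP[/eqP <-|t0].
      rewrite scale0r mul0r; apply/le_anti/andP; split.
        by rewrite (le_trans (c_le 0))// (sublinear0 sA).
      by apply: inf_conv_ge => k; rewrite add0r.
    apply/le_anti; rewrite h//= -ler_pdivlMl//.
    apply: le_trans (h _ _ _); last by rewrite invr_gt0.
    by rewrite scalerA mulVf ?gt_eqF// scale1r.
  move=> t0; rewrite -ler_pdivrMl//; apply: inf_conv_ge => h; rewrite ler_pdivrMl//.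
  by rewrite (le_trans (inf_conv_le _ (t *: h)))// -scalerDr AZ ?BZ ?(ltW t0)// mulrDr.
- by move=> u; rewrite (le_trans (c_le u)).
Qed.

Lemma inf_conv_le_l u : inf_conv A B u <= A u.
Proof. by have := inf_conv_le u 0; rewrite addr0 (sublinear0 sB) addr0. Qed.

Lemma inf_conv_le_r u : inf_conv A B u <= B (- u).
Proof. by have := inf_conv_le u (- u); rewrite subrr (sublinear0 sA) add0r. Qed.

End InfConv.

(* Two closed half-planes: the cone of pairs (a u, b u) misses the open negative
   quadrant, hence lies above a line through the origin. *)
Lemma convex_weight M (a b : X -> R) : sublinear M a -> sublinear M b ->
  (forall u, 0 <= a u \/ 0 <= b u) ->
  exists2 t, 0 <= t <= 1 & forall u, 0 <= t * a u + (1 - t) * b u.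
Proof.
move=> [aD aZ aM] [bD bZ bM] ab.
(* The coefficients below are chosen so that subadditivity bounds [a] and [b] at the combination by
   the same number, [b u * a v - b v * a u], which is negative under the contrary assumption. *)
have cross u v : a u < 0 -> b v < 0 -> b v * a u <= b u * a v.
  move=> au bv; rewrite leNgt; apply/negP => lt.
  have av : 0 <= a v by case: (ab v) => //; rewrite leNgt bv.
  have bu : 0 <= b u by case: (ab u) => //; rewrite leNgt au.
  have s0 : 0 <= a v - b v by lra.
  have t0 : 0 <= b u - a u by lra.
  have := aD ((a v - b v) *: u) ((b u - a u) *: v).
  have := bD ((a v - b v) *: u) ((b u - a u) *: v).
  rewrite !aZ// !bZ//; case: (ab ((a v - b v) *: u + (b u - a u) *: v)).
    by move=> h _ /(le_trans h); nra.
  by move=> h /(le_trans h) + _; nra.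
(* A weight is admissible if it lies above the quotients coming from [b v < 0] and below those
   coming from [a u < 0]. The supremum of the former is taken; 0 is added to keep the set
   nonempty. *)
pose E := [set t | t = 0 \/ exists2 v, b v < 0 & t = - b v / (a v - b v)].
have av v : b v < 0 -> 0 <= a v by move=> bv; case: (ab v) => //; rewrite leNgt bv.
have bu u : a u < 0 -> 0 <= b u by move=> au; case: (ab u) => //; rewrite leNgt au.
have E1 : ubound E 1.
  move=> t [->|[v bv ->]]; first exact: ler01.
  have av0 := av _ bv; have lt0 : 0 < a v - b v by lra.
  by rewrite ler_pdivrMr//; lra.
have E0 : E 0 by left.
have supE t : E t -> t <= sup E by move=> Et; apply: ub_le_sup => //; exists 1.
exists (sup E); first by rewrite (supE 0)//=; apply: ge_sup => //; exists 0.
move=> u; have [au|au] := ltP (a u) 0.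
  have bu0 := bu _ au.
  have : sup E <= b u / (b u - a u).
    apply: ge_sup; first by exists 0.
    move=> t [->|[v bv ->]]; first by rewrite divr_ge0//; lra.
    have := av _ bv; have := cross _ _ au bv => h h'.
    rewrite ler_pdivrMr; last by lra.
    rewrite mulrAC ler_pdivlMr; last by lra.
    by nra.
  by rewrite ler_pdivlMr; [nra|lra].
have [bv|bv] := ltP (b u) 0.
  have : - b u / (a u - b u) <= sup E by apply: supE; right; exists u.
  by rewrite ler_pdivrMr; [nra|lra].
have s0 : 0 <= sup E by exact: supE.
have s1 : sup E <= 1 by apply: ge_sup => //; exists 0.
by rewrite addr_ge0// mulr_ge0//; lra.
Qed.

Lemma sublinearZ M t s : 0 <= t -> sublinear M s -> sublinear (t * M) (fun u => t * s u).
Proof.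
move=> t0 [h1 h2 h3]; split => *.
- by rewrite -mulrDr ler_wpM2l.
- by rewrite h2// mulrCA.
- by rewrite -mulrA ler_wpM2l.
Qed.

Lemma sublinearB M s e : sublinear M s -> sublinear (M + `|e|) (fun u => s u - e u).
Proof.
move=> [h1 h2 h3]; split.
- by move=> u v; have := h1 u v; rewrite dual_add; lra.
- by move=> t u t0; rewrite h2// dual_scale mulrBr.
- move=> u; rewrite mulrDl lerD// -dual_opp (le_trans (dual_ub _ _))// normrN.
  exact: lexx.
Qed.

(** [convex_weight] puts [e] below [t * s0 + (1 - t) * s1], the infimal convolution splits [e] into
    [b <= t * s0] and [e - b <= (1 - t) * s1], and extremality forces [b = t *: e]. In dual terms,
    an extreme point of the hull of two convex sets lies in one of them. *)
Lemma extreme_minorant_max M s0 s1 s e : sublinear M s0 -> sublinear M s1 ->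
  (forall u, s0 u <= s u) -> (forall u, s1 u <= s u) ->
  extreme_minorant s e -> (forall u, e u <= s0 u \/ e u <= s1 u) ->
  (forall u, e u <= s0 u) \/ (forall u, e u <= s1 u).
Proof.
move=> ss0 ss1 s0s s1s [es ee] e01.
have [t /andP[t0 t1] ht] : exists2 t, 0 <= t <= 1 &
    forall u, 0 <= t * (s0 u - e u) + (1 - t) * (s1 u - e u).
  apply: (@convex_weight (M + `|e|)); [exact: sublinearB|exact: sublinearB|].
  by move=> u; case: (e01 u) => ?; [left|right]; rewrite subr_ge0.
have t1' : 0 <= 1 - t by rewrite subr_ge0.
pose A u := t * s0 u; pose B u := (1 - t) * s1 u - e u.
have sA : sublinear (t * M) A by exact: sublinearZ.
have sB : sublinear ((1 - t) * M + `|e|) B by apply/sublinearB/sublinearZ.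
have AB u : 0 <= A u + B u by have := ht u; rewrite /A /B; lra.
have [b [hb _] _] := hahn_banach_extreme 0 dx (sublinear_inf_conv sA sB AB).
have bA u : b u <= t * s0 u by exact: le_trans (hb u) (inf_conv_le_l sA sB AB u).
have bB u : e u - b u <= (1 - t) * s1 u.
  have := le_trans (hb (- u)) (inf_conv_le_r sA sB AB (- u)).
  by rewrite opprK /B dual_opp; move: (b u) (e u) (s1 u) => ? ? ?; lra.
(* Both [e + (b - t *: e)] and [e - (b - t *: e)] lie below convex combinations of [e] with [s0], or
   with [s1], hence below [s]. *)
have : b - t *: e = 0.
  apply: ee => u; rewrite dualBE dualZE.
    have := bA u; have := s0s u; have := es u.
    by move: (b u) (e u) (s0 u) (s u) => ? ? ? ?; nra.
  have := bB u; have := s1s u; have := es u.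
  by move: (b u) (e u) (s1 u) (s u) => ? ? ? ?; nra.
move=> /eqP; rewrite subr_eq0 => /eqP bE.
move: t0; rewrite le_eqVlt => /orP[/eqP t0|t0].
  right=> u; have := bB u; rewrite bE dualZE -t0 mul0r subr0.
  by rewrite subr0 mul1r.
by left=> u; have := bA u; rewrite bE dualZE ler_pM2l.
Qed.

Definition sup_fun (S : set (dual X)) h : R := sup [set (p h : R) | p in S].

Section SupFun.
Variables (M : R) (S : set (dual X)).
Hypotheses (S0 : S !=set0) (SM : forall p, S p -> `|p| <= M).

Let hasub h : has_ubound [set (p h : R) | p in S].
Proof.
exists (M * `|h|) => _ [p Sp <-].
by rewrite (le_trans (dual_ub _ _))// ler_wpM2r// SM.
Qed.

Lemma sup_fun_ub p h : S p -> p h <= sup_fun S h.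
Proof. by move=> Sp; apply: ub_le_sup => //; exists p. Qed.

Lemma sup_fun_le h c : (forall p, S p -> p h <= c) -> sup_fun S h <= c.
Proof.
have [p Sp] := S0 => hc; apply: ge_sup; first by exists (p h), p.
by move=> _ [q Sq <-]; exact: hc.
Qed.

Lemma sublinear_sup_fun : sublinear M (sup_fun S).
Proof.
split.
- by move=> u v; apply: sup_fun_le => p Sp; rewrite dual_add lerD// sup_fun_ub.
- suff h t u : 0 < t -> sup_fun S (t *: u) <= t * sup_fun S u.
    move=> t u; rewrite le_eqVlt => /orP[/eqP <-|t0].
      rewrite scale0r mul0r; apply/le_anti/andP; split.
        by apply: sup_fun_le => p _; rewrite dual_zero.
      by have [p Sp] := S0; rewrite -(dual_zero p) sup_fun_ub.
    apply/le_anti; rewrite h//= -ler_pdivlMl//.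
    apply: le_trans (h _ _ _); last by rewrite invr_gt0.
    by rewrite scalerA mulVf ?gt_eqF// scale1r.
  by move=> t0; apply: sup_fun_le => p Sp; rewrite dual_scale ler_pM2l// sup_fun_ub.
- move=> h; apply: sup_fun_le => p Sp.
  by rewrite (le_trans (dual_ub _ _))// ler_wpM2r// SM.
Qed.

End SupFun.

(* Milman's theorem for the upper limit of a decreasing sequence of bounded sets. *)
Lemma extreme_minorant_approx M (D : nat -> set (dual X)) s e :
  (forall n p, D n p -> `|p| <= M) -> (forall n m p, (n <= m)%N -> D m p -> D n p) ->
  (forall h c, (exists n, forall p, D n p -> p h <= c) -> s h <= c) ->
  (forall h c, s h < c -> exists n, forall p, D n p -> p h <= c) ->
  extreme_minorant s e ->
  forall k n d, 0 < d -> exists2 p, D n p & forall i, (i < k)%N -> `|p (x i) - e (x i)| <= d.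
Proof.
move=> DM Dd Ds1 Ds2 ex; have [es _] := ex.
(* [supp Q] says that [e] stays below the upper limit of the support functions of the sets [D n] cut
   down to [Q]. The proof shrinks [Q] from [setT] by successive halving without losing this. *)
pose supp (Q : set (dual X)) :=
  forall h n d, 0 < d -> exists p, [/\ D n p, Q p & e h < p h + d].
have suppT : supp setT.
  move=> h n d d0; apply: contrapT => hn.
  have : s h <= e h - d.
    apply: Ds1; exists n => p Dp; rewrite leNgt; apply/negP => lt; apply: hn.
    by exists p; split => //; move: lt; rewrite ltrBlDr.
  by have := es h; move: (e h) (s h) => ? ? ? ?; lra.
(* If one half is eventually empty, the other inherits the property at once. Otherwise [e] is
   everywhere below the larger of the two limiting support functions, so by extremality it is below
   one of them. *)
have split_supp Q (P : set (dual X)) : supp Q ->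
    supp (Q `&` P) \/ supp (Q `&` ~` P).
  move=> sQ; have subsupp n0 (P1 P2 : set (dual X)) : (forall p, P1 p \/ P2 p) ->
      (forall p, D n0 p -> ~ (Q `&` P1) p) -> supp (Q `&` P2).
    move=> P12 no h n d d0; have [p [Dp Qp hp]] := sQ h (maxn n n0) d d0.
    exists p; split => //; first by apply: Dd Dp; rewrite leq_maxl.
    split => //; have [P1p|//] := P12 p; exfalso; apply: (no p) => //.
    by apply: Dd Dp; rewrite leq_maxr.
  have [[n0 no]|ne0] := pselect (exists n0, forall p, D n0 p -> ~ (Q `&` P) p).
    by right; apply: subsupp no => p; have [|] := pselect (P p); [left|right].
  have [[n0 no]|ne1] := pselect (exists n0, forall p, D n0 p -> ~ (Q `&` ~` P) p).
    by left; apply: subsupp no => p; have [|] := pselect (P p); [right|left].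
  have nonempty P' : ~ (exists n0, forall p, D n0 p -> ~ (Q `&` P') p) ->
      forall n, D n `&` (Q `&` P') !=set0.
    move=> h n; apply: contrapT => hn; apply: h; exists n => p Dp QPp.
    by apply: hn; exists p.
  have D0 := nonempty _ ne0; have D1 := nonempty _ ne1.
  pose sg P' u := infs (fun n => sup_fun (D n `&` (Q `&` P')) u) 0.
  have ssup P' n : D n `&` (Q `&` P') !=set0 -> sublinear M (sup_fun (D n `&` (Q `&` P'))).
    by move=> ?; apply: sublinear_sup_fun => // p [/DM].
  have lb P' u : (forall n, D n `&` (Q `&` P') !=set0) ->
      forall n, - (M * `|u|) <= sup_fun (D n `&` (Q `&` P')) u.
    move=> h n; have := sublinear_norm_le u (ssup P' n (h n)).
    by rewrite ler_norml => /andP[].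
  have ssg P' : (forall n, D n `&` (Q `&` P') !=set0) -> sublinear M (sg P').
    move=> h; apply: sublinear_infs => [n|k m u km]; first exact: ssup.
    apply: sup_fun_le; first exact: h.
    move=> p [Dp QPp]; apply: (@sup_fun_ub M) => [q [/DM]//|].
    by split => //; exact: Dd km Dp.
  have sgs P' u : (forall n, D n `&` (Q `&` P') !=set0) -> sg P' u <= s u.
    move=> h; apply/ler_addgt0Pl => d d0.
    have [n hn] : exists n, forall p, D n p -> p u <= d + s u by apply: Ds2; rewrite ltrDr.
    apply: le_trans (infs_le_term n (lb P' u h)) _; apply: sup_fun_le; first exact: h.
    by move=> p [Dp _]; exact: hn.
  have esg P' : (forall n, D n `&` (Q `&` P') !=set0) -> (forall u, e u <= sg P' u) ->
      supp (Q `&` P').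
    move=> h esg u n d d0; apply: contrapT => no.
    have : e u <= e u - d; last by move: (e u) => ?; lra.
    apply: le_trans (esg u) _; apply: le_trans (infs_le_term n (lb P' u h)) _.
    apply: sup_fun_le; first exact: h.
    move=> p [Dp QPp]; rewrite leNgt; apply/negP => lt; apply: no.
    by exists p; split => //; move: lt; rewrite ltrBlDr.
  have [] := @extreme_minorant_max M (sg P) (sg (~` P)) s e (ssg _ D0) (ssg _ D1)
    (fun u => sgs _ u D0) (fun u => sgs _ u D1) ex.
  - move=> u; apply: contrapT => /not_orP[/negP + /negP]; rewrite -!ltNge => l0 l1.
    pose c := Num.max (sg P u) (sg (~` P) u).
    have ce : c < e u by rewrite gt_max l0 l1.
    pose c' := (c + e u) / 2.
    have [n0 h0] : exists n, sup_fun (D n `&` (Q `&` P)) u <= c'.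
      apply: contrapT => no; have : c' <= sg P u.
        by apply: le_infs => n; rewrite leNgt; apply/negP => /ltW ?; apply: no; exists n.
      have : sg P u <= c by rewrite le_max lexx.
      by rewrite /c'; move: ce; lra.
    have [n1 h1] : exists n, sup_fun (D n `&` (Q `&` ~` P)) u <= c'.
      apply: contrapT => no; have : c' <= sg (~` P) u.
        by apply: le_infs => n; rewrite leNgt; apply/negP => /ltW ?; apply: no; exists n.
      have : sg (~` P) u <= c by rewrite le_max lexx orbT.
      by rewrite /c'; move: ce; lra.
    have d0 : 0 < (e u - c) / 2 by rewrite divr_gt0// subr_gt0.
    have [p [Dp Qp]] := sQ u (maxn n0 n1) _ d0.
    suff : p u <= c' by rewrite /c'; move: (p u : R) => pu; lra.
    have [Pp|Pp] := pselect (P p).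
      apply: le_trans h0; apply: (@sup_fun_ub M) => [q [/DM]//|].
      by split => //; apply: Dd Dp; rewrite leq_maxl.
    apply: le_trans h1; apply: (@sup_fun_ub M) => [q [/DM]//|].
    by split => //; apply: Dd Dp; rewrite leq_maxr.
  - by move=> h; left; exact: esg.
  - by move=> h; right; exact: esg.
(* The complementary half cannot support [e]: on it [p (- h) + d < e (- h)]. *)
have supp_near Q h d : 0 < d -> supp Q -> supp (Q `&` [set p | p h <= e h + d]).
  move=> d0 /split_supp - /(_ [set p | p h <= e h + d])[//|sQ]; exfalso.
  have [p [_ [_ /=]]] := sQ (- h) 0%N d d0.
  by rewrite !dual_opp => /negP; rewrite -ltNge; move: (p h : R) (e h : R) => a b; lra.
move=> k n d d0.
have : exists Q, supp Q /\ forall p, Q p -> forall i, (i < k)%N -> `|p (x i) - e (x i)| <= d.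
  elim: k => [|k [Q [sQ hQ]]]; first by exists setT.
  exists (Q `&` [set p | p (x k) <= e (x k) + d] `&` [set p | p (- x k) <= e (- x k) + d]).
  split; first by apply: (supp_near) => //; exact: supp_near.
  move=> p [[Qp p1] p2] i; rewrite ltnS leq_eqVlt => /orP[/eqP ->|]; last exact: hQ.
  move: p1 p2; rewrite /= !dual_opp; move: (p (x k) : R) (e (x k) : R) => a b h1 h2.
  by rewrite ler_norml; apply/andP; split; lra.
move=> [Q [sQ hQ]]; have [p [Dp Qp _]] := sQ 0 n d d0.
by exists p => //; exact: hQ.
Qed.

End Milman.

(** * Countable nets and separability of the dual of an Asplund space *)

Section CountableNets.
Context {R : realType} {X : normedModType R}.
Implicit Types (e : R) (S : set (dual X)).

Definition countable_net e S :=
  exists c : nat -> dual X, forall p, S p -> exists n, `|p - c n| <= e.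

Lemma countable_net_sub e S1 S2 : S1 `<=` S2 -> countable_net e S2 -> countable_net e S1.
Proof. by move=> S12 [c hc]; exists c => p /S12 /hc. Qed.

Lemma countable_net_bigcup (I : countType) e (S : I -> set (dual X)) :
  (forall i, countable_net e (S i)) -> countable_net e (\bigcup_i S i).
Proof.
move=> hS; have [c hc] := choice hS.
exists (fun k => if unpickle k is Some (i, n) then c i n else 0).
move=> p [i _ Sp]; have [n pn] := hc i p Sp.
by exists (pickle (i, n)); rewrite pickleK.
Qed.

Lemma countable_netU e S1 S2 :
  countable_net e S1 -> countable_net e S2 -> countable_net e (S1 `|` S2).
Proof.
move=> h1 h2; have : countable_net e (\bigcup_b (if b then S1 else S2)).
  by apply: countable_net_bigcup => -[].
by apply: countable_net_sub => p [?|?]; [exists true|exists false].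
Qed.

(** Nets of the unit ball at the scales [m.+1%:R^-1] are enlarged by integer factors [k]; the
    triples of indices are enumerated through [pickle]. *)
Lemma countable_net_dense :
  (forall e, 0 < e -> countable_net e [set p | `|p| <= 1]) ->
  exists d : nat -> dual X, dense_seq d.
Proof.
move=> h; have hm m : countable_net m.+1%:R^-1 [set p : dual X | `|p| <= 1].
  by apply: h; rewrite invr_gt0.
have [c hc] := choice hm.
exists (fun i => if unpickle i is Some (k, m, n) then k%:R *: c m n else 0) => p e e0.
pose k := (Num.bound `|p|).+1.
have pk : `|p| <= k%:R.
  by rewrite (le_trans (ltW (archi_boundP (normr_ge0 p))))// ler_nat.
have k0 : 0 < k%:R :> R by [].
have ek : 0 < e / k%:R by rewrite divr_gt0.
have [m _ /(_ m (leqnn m)) hm'] : \forall m \near \oo, m.+1%:R^-1 < e / k%:R.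
  by have /cvgrPdist_lt/(_ _ ek) := @cvg_harmonic R; apply: filterS => m;
     rewrite sub0r normrN ger0_norm ?invr_ge0.
have [|n hn] := hc m (k%:R^-1 *: p).
  by rewrite /= normrZ ger0_norm ?invr_ge0// ler_pdivrMl// mulr1.
exists (pickle (k, m, n)); rewrite pickleK.
have -> : p - k%:R *: c m n = k%:R *: (k%:R^-1 *: p - c m n).
  by rewrite scalerBr scalerA divff ?scale1r// gt_eqF.
rewrite normrZ ger0_norm ?ler0n// mulrC -ltr_pdivlMr//.
exact: le_lt_trans hn hm'.
Qed.

End CountableNets.

(** Oddness of the derivative is what turns the one-sided estimate available for a supremum of
    functionals into a two-sided one. *)
Lemma differentiable_small_o {R : realType} {X : normedModType R} (f : X -> R) u :
  differentiable f u -> exists2 l : X -> R, (forall x, l (- x) = - l x) &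
  forall e, 0 < e -> exists2 r, 0 < r &
    forall h, `|h| <= r -> `|f (u + h) - f u - l h| <= e * `|h|.
Proof.
move=> df; exists ('d f u : X -> R) => [x|e e0]; first exact: linearN.
have /eqaddoP/(_ _ e0)/nbhs_ballP[r /= r0 hr] := diff_locally df.
have r20 : 0 < r / 2 by rewrite divr_gt0.
exists (r / 2) => // h hr2; have := hr h; rewrite -ball_normE /= sub0r normrN.
have lt : `|h| < r by rewrite (le_lt_trans hr2)// ltr_pdivrMr// mulr_natr mulr2n ltrDl.
by move=> /(_ lt); rewrite /= !fctE /= [h + u]addrC opprD addrA.
Qed.

Section AsplundDual.
Context {R : realType} {X : normedModType R}.

Lemma asplund_sublinear M (s : X -> R) : asplund X -> sublinear M s ->
  exists u, differentiable s u.
Proof.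
move=> aX ss; have [hD hZ _] := ss.
have : closure [set x | setT x /\ differentiable s x] 0.
  apply: aX => //.
  - exact: openT.
  - move=> u _; apply/cvgrPdist_le => e e0.
    have M1 : 0 < `|M| + 1 by rewrite ltr_wpDl.
    apply/nbhs_ballP; exists (e / (`|M| + 1)) => /=; first by rewrite divr_gt0.
    move=> v; rewrite -ball_normE /= ltr_pdivlMr// => uv.
    rewrite (le_trans (sublinear_lip u v ss))//; move: (ltW uv); apply: le_trans.
    by rewrite mulrC ler_wpM2l// (le_trans (ler_norm _))// lerDl.
  - move=> t a b _ _; rewrite convRE.
    by rewrite (le_trans (hD _ _))// !hZ// subr_ge0.
by move=> /(_ setT filterT)[u [[_ ?] _]]; exists u.
Qed.

Variable x : nat -> X.
Hypotheses (dx : dense_seq x) (aX : asplund X).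

(** [A] keeps the functionals of the ball all of whose rational slices lack a countable [e]-net; the
    removed part [B] is covered by countably many slices that have one. If [A] were nonempty,
    differentiability of its support function at some [u] would give a slice whose trace on [A] has
    diameter at most [e]; together with [B] that slice would have a net after all. *)
Lemma asplund_dual_separable : exists d : nat -> dual X, dense_seq d.
Proof.
apply: countable_net_dense => e e0.
pose slice (i : nat * rat) := [set b : dual X | `|b| <= 1 /\ ratr i.2 < (b (x i.1) : R)].
pose A := [set a : dual X | `|a| <= 1 /\ forall i, slice i a -> ~ countable_net e (slice i)].
pose B := \bigcup_(i : nat * rat) [set b | slice i b /\ countable_net e (slice i)].
have netB : countable_net e B.
  apply: countable_net_bigcup => i; have [h|h] := pselect (countable_net e (slice i)).
    by apply: countable_net_sub h => b [].
  by exists (fun=> 0) => b [_ /h].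
have AB b : `|b| <= 1 -> ~ A b -> B b.
  move=> b1 nA; apply: contrapT => nB; apply: nA; split => // i sb ni.
  by apply: nB; exists i.
have [a0|noA] := pselect (A !=set0); last first.
  by apply: countable_net_sub netB => b b1; apply: AB => // Ab; apply: noA; exists b.
exfalso; have A1 a : A a -> `|a| <= 1 by case.
have [u /differentiable_small_o[l lN hl]] := asplund_sublinear aX (sublinear_sup_fun a0 A1).
set s := sup_fun A in hl.
have e4 : 0 < e / 4 by rewrite divr_gt0.
have [r r0 hr] := hl _ e4; pose al := e / 4 * r.
have al0 : 0 < al by rewrite mulr_gt0.
(* Smulian's argument: a functional of [A] that almost attains [s u] is squeezed against the
   derivative on the sphere of radius [r]. *)
have key a : A a -> s u - al < a u -> forall h, `|h| = r -> `|(a h : R) - l h| <= e / 2 * r.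
  move=> Aa au; have half h : `|h| = r -> (a h : R) <= l h + e / 2 * r.
    move=> hr'; have := hr h; rewrite hr' lexx => /(_ isT); rewrite ler_norml => /andP[_].
    have := sup_fun_ub A1 (u + h) Aa; rewrite -/s dual_add.
    move: au; rewrite /al; have -> : e / 2 * r = e / 4 * r + e / 4 * r by field.
    by move: (a h : R) (a u : R) (e / 4 * r) => ? ? ?; lra.
  move=> h hr'; have := half h hr'; have := half (- h); rewrite normrN => /(_ hr').
  rewrite dual_opp lN; move: (a h : R) (e / 2 * r) => ? ? ? ?.
  by rewrite ler_norml; apply/andP; split; lra.
(* The slice has to be cut at some [x n] and at a rational level. The margins [al / 4] and [al / 2]
   ensure [s u - al < b u] for every [b] in it. *)
have al4 : 0 < al / 4 by rewrite divr_gt0.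
have [n un] := dx u al4.
have [a Aa au] : exists2 a, A a & s u - al / 4 < a u.
  apply: contrapT => no; have : s u <= s u - al / 4.
    apply: (sup_fun_le a0) => a Aa; rewrite leNgt; apply/negP => lt.
    by apply: no; exists a.
  by lra.
have close (b : dual X) : `|b| <= 1 -> `|(b u : R) - b (x n)| < al / 4.
  move=> b1; rewrite -dual_sub (le_lt_trans (dual_norm_ub _ _))// (le_lt_trans _ un)//.
  by rewrite ler_piMl.
have an : s u - al / 2 < a (x n).
  have := close _ (A1 _ Aa); rewrite ltr_norml => /andP[_].
  by move: (a u : R) (a (x n) : R) au => ? ?; lra.
have [q /andP[q1 q2]] : exists q : rat, (s u - al / 2 < ratr q < a (x n)).
  by have [q] := rat_in_itvoo an; rewrite in_itv /= => ?; exists q.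
have [_ /(_ (n, q))] := Aa; apply; first by split; [exact: A1|].
have netA : countable_net e [set b | A b /\ s u - al < b u].
  exists (fun=> a) => b [Ab bu]; exists 0%N; apply: dual_norm_le; first exact: ltW.
  have au' : s u - al < a u by move: (a u : R) au => ? ?; lra.
  move=> h; have [->|h0] := eqVneq h 0; first by rewrite dual_zero normr0 mulr0.
  have nh : 0 < `|h| by rewrite normr_gt0.
  pose k := (r / `|h|) *: h.
  have kr : `|k| = r by rewrite normrZ ger0_norm ?divr_ge0// ?ltW// divfK ?gt_eqF.
  have -> : h = (`|h| / r) *: k.
    by rewrite scalerA mulrA divfK ?gt_eqF// divff ?scale1r// gt_eqF.
  have kE : (b - a) k <= e * r.
    have := key _ Ab bu k kr; have := key _ Aa au' k kr.
    rewrite dualBE !ler_norml => /andP[t1 _] /andP[_ t2].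
    move: (b k : R) (a k : R) t1 t2 => ? ?.
    by have -> : e * r = e / 2 * r + e / 2 * r by [field]; move: (e / 2 * r) => ?; lra.
  have t0 : 0 < `|h| / r by rewrite divr_gt0.
  rewrite dual_scale normrZ kr (ger0_norm (ltW t0)).
  by rewrite [leRHS]mulrCA ler_pM2l.
apply: countable_net_sub (countable_netU netB netA).
move=> b [b1 bq] /=; have [Ab|/(AB _ b1) ?] := pselect (A b); last by left.
right; split => //; have := close _ b1; rewrite ltr_norml => /andP[+ _].
by move: (b u : R) (b (x n) : R) bq => ? ? /=; lra.
Qed.

End AsplundDual.

(** * A smooth convex function from a rotund function on the dual *)

Section SmoothConvex.
Context {R : realType} {X : normedModType R}.
Variables (x : nat -> X) (d : nat -> dual X).
Hypotheses (dx : dense_seq x) (dd : dense_seq d).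
Implicit Types (a b : dual X) (u y z : X) (e M : R).

Definition unit_seq n : X := (1 + `|x n|)^-1 *: x n.
Local Notation v := unit_seq.

Let x1 n : 0 < 1 + `|x n|. Proof. by rewrite ltr_pwDl. Qed.

Lemma unit_seq_le1 n : `|v n| <= 1.
Proof.
rewrite normrZ ger0_norm ?invr_ge0 ?(ltW (x1 n))// ler_pdivrMl// mulr1.
by rewrite lerDr.
Qed.

Lemma unit_seqE n : x n = (1 + `|x n|) *: v n.
Proof. by rewrite scalerA divff ?scale1r// gt_eqF. Qed.

Lemma unit_seq_dual_eq0 a : (forall n, a (v n) = 0) -> a = 0.
Proof.
by move=> av; apply: (dense_dual_eq0 dx) => n; rewrite unit_seqE dual_scale av mulr0.
Qed.

(** The bound [M] makes closeness on the [v n] propagate to every point; the accuracy asked for at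
    [v n] absorbs the scaling factor [1 + |x n|]. *)
Lemma unit_seq_near (I : Type) (F : set_system I) {FF : Filter F} (b : I -> dual X) a M :
  (\forall i \near F, `|b i| <= M) ->
  (forall n e, 0 < e -> \forall i \near F, `|(b i (v n) : R) - a (v n)| <= e) ->
  forall u e, 0 < e -> \forall i \near F, `|(b i u : R) - a u| <= e.
Proof.
move=> bM bv u e e0.
have M1 : 0 < `|M| + `|a| + 1 by rewrite ltr_wpDl// addr_ge0.
have e2 : 0 < e / 2 by rewrite divr_gt0.
have [n un] := dx u (divr_gt0 e2 M1).
have := bv n _ (divr_gt0 e2 (x1 n)); apply: filterS2 bM => i bM h.
have -> : (b i u : R) - a u = (b i - a) (u - x n) + (b i - a) (x n).
  by rewrite -dual_add subrK.
rewrite (le_trans (ler_normD _ _))// [leRHS]splitr lerD//.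
  rewrite (le_trans (dual_norm_ub _ _))//.
  move: un; rewrite ltr_pdivlMr// => /ltW; apply: le_trans; rewrite mulrC ler_wpM2l//.
  rewrite (le_trans (ler_normB _ _))// -addrA lerD//; last by rewrite lerDl.
  by rewrite (le_trans bM)// ler_norm.
rewrite unit_seqE dual_scale normrM ger0_norm ?(ltW (x1 n))//.
by move: h; rewrite ler_pdivlMr// mulrC dualBE.
Qed.

(** The support function of the zonotope that is the sum of the segments joining 0 to [d i] for
    [i < n]. *)
Definition pos_part_sum n u : R := \sum_(i < n) Num.max 0 (d i u).
Local Notation S := pos_part_sum.

Let S_ge0 n u : 0 <= S n u.
Proof. by apply: sumr_ge0 => i _; rewrite le_max lexx. Qed.

Let S0 n : S n 0 = 0.
Proof. by apply: big1 => i _; rewrite dual_zero maxxx. Qed.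

Let S_ub n u i : (i < n)%N -> d i u <= S n u.
Proof.
move=> lin; rewrite /S (bigD1 (Ordinal lin))//= ler_wpDr//; last first.
  by rewrite le_max lexx orbT.
by apply: sumr_ge0 => j _; rewrite le_max lexx.
Qed.

Let SZ n t u : 0 <= t -> S n (t *: u) = t * S n u.
Proof.
move=> t0; rewrite /S mulr_sumr; apply: eq_bigr => i _.
by rewrite dual_scale maxr_pMr// mulr0.
Qed.

Let S_le n u c : 0 <= c -> (forall i, (i < n)%N -> `|d i u : R| <= c) -> S n u <= n%:R * c.
Proof.
move=> c0 h; apply: (@le_trans _ _ (\sum_(i < n) c)).
  apply: ler_sum => i _; rewrite ge_max c0/=.
  by rewrite (le_trans (ler_norm _))// h.
by rewrite sumr_const card_ord mulr_natl.
Qed.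

(* A weak-* lower semicontinuous substitute for the distance from a to the
   zonotope spanned by d 0, ..., d n.-1. *)
Definition zonotope_dist n a : R := sup [set (a u - S n u : R) | u in [set u : X | `|u| <= 1]].
Local Notation pn := zonotope_dist.

Let pn_ub n a u : `|u| <= 1 -> a u - S n u <= pn n a.
Proof.
move=> u1; apply: ub_le_sup; last by exists u.
exists `|a| => _ [w /= w1 <-]; rewrite lerBlDr (le_trans (dual_ub _ _))//.
by rewrite ler_wpDr// ler_piMr.
Qed.

Let pn_le n a c : (forall u, `|u| <= 1 -> a u - S n u <= c) -> pn n a <= c.
Proof.
move=> h; apply: ge_sup; first by exists (a 0 - S n 0), 0; rewrite //= normr0.
by move=> _ [u /= u1 <-]; exact: h.
Qed.

Let pn_ge0 n a : 0 <= pn n a.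
Proof. by have := @pn_ub n a 0; rewrite normr0 ler01 dual_zero S0 subr0; apply. Qed.

Let pn_le_norm n a : pn n a <= `|a|.
Proof.
apply: pn_le => u u1; rewrite lerBlDr (le_trans (dual_ub _ _))//.
by rewrite ler_wpDr// ler_piMr.
Qed.

Let pn_ubZ n a u : a u <= S n u + pn n a * `|u|.
Proof.
have [->|u0] := eqVneq u 0; first by rewrite dual_zero S0 normr0 mulr0 addr0.
have nu : 0 < `|u| by rewrite normr_gt0.
have := @pn_ub n a (`|u|^-1 *: u); rewrite normrZ normfV normr_id mulVf ?gt_eqF//.
move=> /(_ (lexx _)); rewrite dual_scale SZ ?invr_ge0// -mulrBr ler_pdivrMl//.
by rewrite lerBlDl mulrC.
Qed.

Let norm_le_pn0 a : `|a| <= pn 0%N a.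
Proof.
apply: dual_norm_le => // u; have := pn_ubZ 0 a u.
by rewrite /S big_ord0 add0r.
Qed.

Let pn_close n a i : (i < n)%N -> pn n a <= `|a - d i|.
Proof.
move=> lin; apply: pn_le => u u1; apply: (@le_trans _ _ ((a - d i) u)).
  by rewrite dualBE lerD2l lerN2 S_ub.
by rewrite (le_trans (dual_ub _ _))// ler_piMr.
Qed.

Let pn_mid n a b : pn n (2^-1 *: (a + b)) <= (pn n a + pn n b) / 2.
Proof.
apply: pn_le => u u1; rewrite dualZE dualDE.
have := pn_ub n a u1; have := pn_ub n b u1.
by move: (a u : R) (b u : R) => ? ? ? ?; lra.
Qed.

(** Terms of a locally uniformly rotund function. Since [d] is dense, the distances of a fixed [a]
    to the growing zonotopes tend to 0, and this is what upgrades termwise convergence to norm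
    convergence. For [n = 0] the distance is the norm, which makes [lur_fun] coercive. *)
Definition lur_term a n : R := pn n a ^+ 2 + (a (v n) : R) ^+ 2.
Definition lur_fun a : R := wsum (lur_term a).
Local Notation T := lur_term.
Local Notation N := lur_fun.

Let T_ge0 a n : 0 <= T a n.
Proof. by rewrite addr_ge0// sqr_ge0. Qed.

Let v_le a n : `|a (v n) : R| <= `|a|.
Proof. by rewrite (le_trans (dual_norm_ub _ _))// ler_piMr// unit_seq_le1. Qed.

Let T_bd a n : `|T a n| <= 2 * `|a| ^+ 2.
Proof.
rewrite ger0_norm// mulr_natl mulr2n lerD//.
  by rewrite lerXn2r ?nnegrE.
by rewrite -real_normK ?num_real// lerXn2r ?nnegrE.
Qed.

Let T_bdM a n M : `|a| <= M -> `|T a n| <= 2 * M ^+ 2.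
Proof.
move=> aM; rewrite (le_trans (T_bd _ _))// ler_wpM2l//.
by rewrite lerXn2r ?nnegrE// (le_trans _ aM).
Qed.

Let N_ge a : `|a| ^+ 2 / 2 <= N a.
Proof.
apply: le_trans (le_wsum_term 0 (T_bd a) (T_ge0 a)); rewrite expr1 ler_wpM2r//.
by rewrite ler_wpDr ?sqr_ge0// lerXn2r ?nnegrE.
Qed.

Let N_le a : N a <= 2 * `|a| ^+ 2.
Proof. exact: le_trans (ler_norm _) (wsum_norm_le (T_bd a)). Qed.

(* Both summands of T are squares of nonnegative convex functions; the
   parallelogram identity measures the gap at the midpoint. *)
Let N_mid a b n : ((pn n a - pn n b) ^+ 2 + ((a - b) (v n)) ^+ 2) / 2 / 2 ^+ n.+1 <=
  N a + N b - 2 * N (2^-1 *: (a + b)).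
Proof.
pose m := 2^-1 *: (a + b).
pose M := `|a| + `|b| + `|m|.
have bd c k : `|c| <= M -> `|T c k| <= 2 * M ^+ 2 by exact: T_bdM.
have aM k : `|T a k| <= 2 * M ^+ 2 by apply: bd; rewrite /M -addrA lerDl addr_ge0.
have bM k : `|T b k| <= 2 * M ^+ 2 by apply: bd; rewrite /M addrAC lerDr addr_ge0.
have mM k : `|T m k| <= 2 * M ^+ 2 by apply: bd; rewrite /M lerDr addr_ge0.
have abM k : `|T a k + T b k| <= 2 * M ^+ 2 + 2 * M ^+ 2.
  by rewrite (le_trans (ler_normD _ _))// lerD.
have mM' k : `|(- 2) * T m k| <= 2 * M ^+ 2 + 2 * M ^+ 2.
  by have := mM k; rewrite normrM normrN [`|2|]ger0_norm//; lra.
have tD k : `|T a k + T b k + (- 2) * T m k| <=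
    2 * M ^+ 2 + 2 * M ^+ 2 + (2 * M ^+ 2 + 2 * M ^+ 2).
  by rewrite (le_trans (ler_normD _ _))// lerD.
have term k : ((pn k a - pn k b) ^+ 2 + ((a - b) (v k)) ^+ 2) / 2 <=
    T a k + T b k + (- 2) * T m k.
  have := pn_mid k a b; have := pn_ge0 k (2^-1 *: (a + b)).
  rewrite /T /m dualBE dualZE dualDE.
  move: (pn k _) (pn k a) (pn k b) (a (v k) : R) (b (v k) : R) => q r s t w q0 qr.
  have : q ^+ 2 <= ((r + s) / 2) ^+ 2 by rewrite lerXn2r ?nnegrE// (le_trans q0).
  by rewrite !expr2; lra.
have -> : N a + N b - 2 * N m = wsum (fun k => T a k + T b k + (- 2) * T m k).
  by rewrite (wsumD abM mM') (wsumD aM bM) (wsumZ _ mM) mulNr.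
apply: le_trans (le_wsum_term n tD _); last first.
  by move=> k; rewrite (le_trans _ (term k))// divr_ge0// addr_ge0// sqr_ge0.
by rewrite ler_wpM2r// invr_ge0 exprn_ge0.
Qed.

(** The values of [d n] are cut into cells of width [e], and each cell receives a net for the first
    [n] functionals whose points lie in the cell itself. *)
Let finite_net n : forall (B : set X) K e, (forall u, B u -> `|u| <= K) -> 0 < e ->
  exists L : seq X, (forall u, u \in L -> B u) /\
    forall u, B u -> exists2 w, w \in L & forall i, (i < n)%N -> `|d i (u - w) : R| <= e.
Proof.
elim: n => [|n IH] B K e BK e0.
  have [[w Bw]|no] := pselect (B !=set0).
    exists [:: w]; split=> [u|u _]; first by rewrite inE => /eqP ->.
    by exists w; rewrite ?inE.
  by exists [::]; split => // u Bu; exfalso; apply: no; exists u.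
pose c := `|d n| * `|K|.
have dc u : B u -> `|d n u : R| <= c.
  move=> Bu; rewrite (le_trans (dual_norm_ub _ _))// ler_wpM2l//.
  by rewrite (le_trans (BK _ Bu))// ler_norm.
pose cell j := [set u | B u /\ j%:R <= ((d n u : R) + c) / e < j.+1%:R].
have [L hL] := choice (fun j => IH (cell j) K e (fun u h => BK u h.1) e0).
exists (flatten [seq L j | j <- iota 0 (Num.bound (2 * c / e)).+1]); split.
  by move=> u /flatten_mapP[j _ /(hL j).1[]].
move=> u Bu; have := dc u Bu; rewrite ler_norml => /andP[c1 c2].
have q0 : 0 <= ((d n u : R) + c) / e by rewrite divr_ge0 ?(ltW e0)//; lra.
pose j := Num.truncn (((d n u : R) + c) / e).
have /andP[j1 j2] : j%:R <= ((d n u : R) + c) / e < j.+1%:R by exact: truncn_itv.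
have [|w wL hw] := (hL j).2 u; first by split => //; rewrite j1 j2.
exists w.
  apply/flatten_mapP; exists j => //; rewrite mem_iota add0n /=.
  have c0 : 0 <= 2 * c / e by rewrite divr_ge0 ?(ltW e0)// mulr_ge0// mulr_ge0.
  rewrite ltnS -(ler_nat R) (le_trans j1)// (le_trans _ (ltW (archi_boundP c0)))//.
  by rewrite ler_wpM2r ?invr_ge0 ?(ltW e0)//; lra.
move=> i; rewrite ltnS leq_eqVlt => /orP[/eqP ->|]; last exact: hw.
have [_ /andP[k1 k2]] := (hL j).1 w wL.
move: j1 j2 k1 k2; rewrite !ler_pdivlMr// !ltr_pdivrMr// dual_sub.
rewrite -[j.+1]addn1 natrD mulrDl mul1r.
move: (d n u : R) (d n w : R) (j%:R * e) => p q r ? ? ? ?.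
by rewrite ler_norml; apply/andP; split; lra.
Qed.

(** When [pn n a] is small, [a] and the [b i] are close to one zonotope, so their oscillation is
    controlled by [d 0], ..., [d n.-1]; on a finite net for these, pointwise convergence is uniform.
    The constant 9 is [1 + 2 * 2] for [b i], plus [1 + 1 * 2] for [a], plus 1 on the net. *)
Let norm_cvg (I : Type) (F : set_system I) {FF : Filter F} (b : I -> dual X) a M :
  (\forall i \near F, `|b i| <= M) ->
  (forall n e, 0 < e -> \forall i \near F, `|(b i (v n) : R) - a (v n)| <= e) ->
  (forall n e, 0 < e -> \forall i \near F, `|pn n (b i) - pn n a| <= e) ->
  forall e, 0 < e -> \forall i \near F, `|b i - a| <= e.
Proof.
move=> bM bv bp e e0; pose eta := e / 9.
have eta0 : 0 < eta by rewrite divr_gt0.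
have [m am] := dd a eta0; pose n := m.+1.
have pa : pn n a <= eta by rewrite (le_trans (pn_close _ (ltnSn m)))// ltW.
(* [S n] is a sum of [n] functionals, hence the accuracy [eta / n]. *)
have dl0 : 0 < eta / n%:R by rewrite divr_gt0.
have [L [L1 hL]] := @finite_net n [set u | `|u| <= 1] 1 _ (fun u h => h) dl0.
have : \forall i \near F, forall w, w \in L -> `|(b i w : R) - a w| <= eta.
  elim: L {L1 hL} => [|w L IH]; first exact: nearW.
  apply: filterS2 IH (unit_seq_near bM bv w eta0) => i h1 h2 w'.
  by rewrite inE => /orP[/eqP ->|/h1].
have := bp n _ eta0; apply: filterS2 => i pb hb.
apply: dual_norm_le; first exact: ltW.
suff h u : `|u| <= 1 -> (b i - a) u <= e.
  move=> u; have [->|u0] := eqVneq u 0; first by rewrite dual_zero normr0 mulr0.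
  have nu : 0 < `|u| by rewrite normr_gt0.
  have := h (`|u|^-1 *: u); rewrite normrZ normfV normr_id mulVf ?gt_eqF//.
  by move=> /(_ (lexx _)); rewrite dual_scale ler_pdivrMl// mulrC.
move=> u1; have [w wL hw] := hL u u1; have w1 := L1 _ wL; rewrite /= in w1.
have uw : `|u - w| <= 2 by rewrite (le_trans (ler_normB _ _))// (natrD _ 1 1) lerD.
have Sn z : (forall i, (i < n)%N -> `|d i z : R| <= eta / n%:R) -> S n z <= eta.
  move=> hz; apply: le_trans (S_le (ltW dl0) hz) _.
  by rewrite mulrCA divff ?mulr1// pnatr_eq0.
have h1 := pn_ubZ n (b i) (u - w); have h2 := pn_ubZ n a (w - u).
have s1 := Sn _ hw; have s2 : S n (w - u) <= eta.
  by apply: Sn => j /hw; rewrite -opprB dual_opp normrN.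
have p2 : pn n (b i) <= 2 * eta.
  by move: pb; rewrite ler_norml => /andP[_]; move: pa; lra.
have m1 : pn n (b i) * `|u - w| <= 2 * eta * 2 by rewrite ler_pM.
have m2 : pn n a * `|w - u| <= eta * 2 by rewrite ler_pM// distrC.
have := hb _ wL; rewrite ler_norml => /andP[_]; move: h1 h2; rewrite dualBE !dual_sub.
have -> : e = 9 * eta by rewrite /eta; field.
move: (b i u : R) (b i w : R) (a u : R) (a w : R) => p q r t.
by move: (_ * `|u - w|) (_ * `|w - u|) m1 m2 => ? ?; lra.
Qed.

(** The conjugate of [lur_fun]: rotundity of the latter becomes Frechet smoothness of the former. *)
Definition smooth_fun y : R := sup (range (fun a => a y - N a)).
Local Notation rho := smooth_fun.

Let rho_ub a y : a y - N a <= rho y.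
Proof.
apply: ub_le_sup; last by exists a.
exists (`|y| ^+ 2) => _ [b _ <-]; have := N_ge b; have := dual_ub b y.
have := sqr_ge0 (`|b| - `|y|); move: (b y : R) (N b) `|b| `|y| => p q r t.
by rewrite !expr2; nra.
Qed.

Let rho_le y c : (forall a, a y - N a <= c) -> rho y <= c.
Proof.
move=> h; apply: ge_sup; first by exists (0 - N 0), 0.
by move=> _ [a _ <-]; exact: h.
Qed.

Let N0 : N 0 = 0.
Proof.
apply/le_anti; rewrite (le_trans (N_le 0))/= ?normr0 ?expr0n ?mulr0//.
by rewrite (le_trans _ (N_ge 0))// divr_ge0// exprn_ge0.
Qed.

Let rho_ge0 y : 0 <= rho y.
Proof. by have := rho_ub 0 y; rewrite dual0E N0 subr0. Qed.

Let norm_bd a y c : 0 <= c -> - c <= a y - N a -> `|a| <= 2 * `|y| + 2 * c + 1.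
Proof.
move=> c0 h; have := N_ge a; have := dual_ub a y; move: h.
have := normr_ge0 a; have := normr_ge0 y.
move: (a y : R) (N a) `|a| `|y| => p q r t t0 r0 h1 h2 h3.
rewrite leNgt; apply/negP => lt; move: h3; rewrite expr2 => h3; nra.
Qed.

(** The midpoint of [a] and [b] cannot do better than [rho y], so the midpoint defect of [N] is at
    most [da + db]. *)
Let gap a b y da db n : rho y - da <= a y - N a -> rho y - db <= b y - N b ->
  (pn n a - pn n b) ^+ 2 + ((a - b) (v n)) ^+ 2 <= 2 ^+ n.+2 * (da + db).
Proof.
move=> ha hb; have := N_mid a b n; have := rho_ub (2^-1 *: (a + b)) y.
rewrite dualZE dualDE => h1; rewrite ler_pdivrMr ?exprn_gt0// ler_pdivrMr//.
move=> /le_trans; apply.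
rewrite (_ : 2 ^+ n.+2 * _ = (da + db) * 2 ^+ n.+1 * 2); last by rewrite exprS; ring.
rewrite !ler_wpM2r ?exprn_ge0//; move: ha hb h1.
by move: (a y : R) (b y : R) (N a) (N b) (N _) (rho y) => ? ? ? ? ? ?; lra.
Qed.

Let sqr_small (p e : R) : 0 < e -> p ^+ 2 <= e ^+ 2 -> `|p| <= e.
Proof.
move=> e0; rewrite -(real_normK (num_real p)) ler_sqr ?nnegrE//.
exact: ltW.
Qed.

(** A maximizing sequence is bounded and, by [gap], converges on each [v n], hence pointwise; [N] is
    lower semicontinuous for this convergence. *)
Let maximizer y : exists a, a y - N a = rho y.
Proof.
have /choice[a ha] : forall k : nat, exists a, rho y - k.+1%:R^-1 <= a y - N a.
  move=> k; apply: contrapT => no.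
  have : rho y <= rho y - k.+1%:R^-1; last first.
    by rewrite lerDl leNgt oppr_lt0 invr_gt0 ltr0Sn.
  by apply: rho_le => a; rewrite leNgt; apply/negP => /ltW lt; apply: no; exists a.
pose M := 2 * `|y| + 2 * 1 + 1.
have aM k : `|a k| <= M.
  apply: norm_bd => //; apply: le_trans (ha k).
  have : (k.+1%:R^-1 : R) <= 1 by rewrite invf_le1// ler1n.
  by have := rho_ge0 y; move: (_^-1) (rho y) => ? ?; lra.
have av n : cvgn (fun k => a k (v n) : R).
  apply: cauchy_cvg; apply: cauchy_exP => e e0.
  have e2 : 0 < e / 2 by rewrite divr_gt0.
  (* Twice this bound, multiplied by the factor [2 ^+ n.+2] of [gap], is [(e / 2) ^+ 2]. *)
  have c0 : 0 < (e / 2) ^+ 2 / 2 ^+ n.+3 by rewrite divr_gt0 ?exprn_gt0.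
  have [K _ hK] : \forall k \near \oo, (k.+1%:R^-1 : R) < (e / 2) ^+ 2 / 2 ^+ n.+3.
    have /cvgrPdist_lt/(_ _ c0) := @cvg_harmonic R; apply: filterS => m.
    by rewrite sub0r normrN ger0_norm ?invr_ge0.
  exists (a K (v n)); exists K => // k /= Kk; rewrite -ball_normE /=.
  have -> : (a K (v n) : R) - a k (v n) = (a K - a k) (v n) by [].
  have := gap n (ha K) (ha k); have := hK K (leqnn K); have := hK k Kk => h1 h2 h3.
  apply: (@le_lt_trans _ _ (e / 2)); last by rewrite ltr_pdivrMr// mulr_natr mulr2n ltrDl.
  apply: sqr_small => //; apply: (@le_trans _ _ (2 ^+ n.+2 * (K.+1%:R^-1 + k.+1%:R^-1))).
    by apply: le_trans h3; rewrite lerDr sqr_ge0.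
  have : K.+1%:R^-1 + k.+1%:R^-1 <= (e / 2) ^+ 2 / 2 ^+ n.+3 + (e / 2) ^+ 2 / 2 ^+ n.+3.
    by rewrite lerD// ltW.
  have -> : (e / 2) ^+ 2 / 2 ^+ n.+3 + (e / 2) ^+ 2 / 2 ^+ n.+3 = (e / 2) ^+ 2 / 2 ^+ n.+2.
    by rewrite [2 ^+ n.+3]exprS invfM; move: (2 ^- n.+2) => ?; field.
  by rewrite ler_pdivlMr ?exprn_gt0// mulrC.
have ax n : cvgn (fun k => a k (x n) : R).
  apply/cvg_ex; exists ((1 + `|x n|) * limn (fun k => a k (v n) : R)).
  have -> : (fun k => a k (x n) : R) = (fun k => (1 + `|x n|) * a k (v n)).
    by apply/funext => k; rewrite {1}unit_seqE dual_scale.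
  by apply: cvgMl_tmp; exact: av.
have [q qM hq] := dual_ptlim dx aM ax.
exists q; apply/le_anti; rewrite rho_ub/=; apply/ler_addgt0Pl => e e0.
have e3 : 0 < e / 3 by rewrite divr_gt0.
have l1 : \forall k \near \oo, N q <= N (a k) + e / 3.
  apply: (@wsum_lsc _ _ _ _ _ (fun k => T (a k)) (2 * M ^+ 2)) => // [n||n c c0].
  - exact: T_bdM.
  - by apply: nearW => k n; exact: T_bdM.
  have M0 : 0 <= M by exact: le_trans qM.
  have cM : 0 < c / (4 * M + 1) by rewrite divr_gt0// ltr_wpDl// mulr_ge0.
  set r := c / (4 * M + 1) in cM.
  have h1 : \forall k \near \oo, pn n q <= pn n (a k) + r.
    have r2 : 0 < r / 2 by rewrite divr_gt0.
    have [u u1 hu] : exists2 u, `|u| <= 1 & pn n q - r / 2 < q u - S n u.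
      apply: contrapT => no; have : pn n q <= pn n q - r / 2; last by lra.
      apply: pn_le => u u1; rewrite leNgt; apply/negP => lt; apply: no.
      by exists u.
    have /cvgrPdist_le/(_ _ r2) := hq u; apply: filterS => k.
    rewrite ler_norml => /andP[_]; have := pn_ub n (a k) u1.
    by move: (a k u : R) (q u : R) hu => ? ?; lra.
  have /cvgrPdist_le/(_ _ cM) := hq (v n); apply: filterS2 h1 => k h1.
  rewrite ler_norml => /andP[h2 h3]; rewrite /T.
  have := v_le (a k) n; have := v_le q n; rewrite !ler_norml => /andP[] + + /andP[].
  have := pn_le_norm n q; have := pn_ge0 n q; have := pn_ge0 n (a k).
  have := pn_le_norm n (a k); have := aM k; have := qM.
  have -> : c = r * (4 * M + 1) by rewrite divfK// gt_eqF// ltr_wpDl// mulr_ge0.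
  move: h1 h2 h3; move: (pn n (a k)) (pn n q) (a k (v n) : R) (q (v n) : R) `|a k| `|q|.
  move=> p1 p2 w1 w2 n1 n2; rewrite !expr2 => *.
  have : p2 * p2 - p1 * p1 <= r * (2 * M) by nra.
  have : w2 * w2 - w1 * w1 <= r * (2 * M) by nra.
  by lra.
have l2 : \forall k \near \oo, (k.+1%:R^-1 : R) < e / 3.
  have /cvgrPdist_lt/(_ _ e3) := @cvg_harmonic R; apply: filterS => m.
  by rewrite sub0r normrN ger0_norm ?invr_ge0.
have /cvgrPdist_le/(_ _ e3) l3 := hq y.
near \oo => k.
have h1 : N q <= N (a k) + e / 3 by near: k.
have h2 : (k.+1%:R^-1 : R) < e / 3 by near: k.
have h3 : `|(q y : R) - a k y| <= e / 3 by near: k.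
move: h1 h2 h3 (ha k); rewrite ler_norml => h1 h2 /andP[h3 _].
move: h1 h2 h3; move: (k.+1%:R^-1 : R) (N q) (N _) (a k y : R) (q y : R) (rho y).
by move=> c Nq Na ay qy r h1 h2 h3 h4; lra.
Unshelve. all: by end_near.
Qed.

(** By [gap], an almost maximizing sequence converges to [a] in all the quantities that [norm_cvg]
    asks for. This strong form of uniqueness makes the derivative of [rho] norm continuous. *)
Let stable y a : a y - N a = rho y -> forall e, 0 < e ->
  exists2 r, 0 < r & forall b, rho y - r <= b y - N b -> `|b - a| <= e.
Proof.
move=> ha e e0; apply: contrapT => no.
have /choice[b hb] : forall k : nat, exists b,
    rho y - k.+1%:R^-1 <= b y - N b /\ ~ `|b - a| <= e.
  move=> k; apply: contrapT => nok; apply: no; exists k.+1%:R^-1.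
    by rewrite invr_gt0.
  by move=> b h; apply: contrapT => nb; apply: nok; exists b.
pose M := 2 * `|y| + 2 * 1 + 1.
have bM k : `|b k| <= M.
  apply: norm_bd => //; apply: le_trans (hb k).1.
  have : (k.+1%:R^-1 : R) <= 1 by rewrite invf_le1// ler1n.
  by have := rho_ge0 y; move: (_^-1) (rho y) => ? ?; lra.
have ha0 : rho y - 0 <= a y - N a by rewrite ha subr0.
have small n c : 0 < c -> \forall k \near \oo,
    (pn n (b k) - pn n a) ^+ 2 + ((b k - a) (v n)) ^+ 2 <= c ^+ 2.
  move=> c0; have c1 : 0 < c ^+ 2 / 2 ^+ n.+2 by rewrite divr_gt0 ?exprn_gt0.
  have /cvgrPdist_lt/(_ _ c1) := @cvg_harmonic R; apply: filterS => k.
  rewrite sub0r normrN ger0_norm ?invr_ge0// ltr_pdivlMr ?exprn_gt0// => h.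
  apply: le_trans (gap n (hb k).1 ha0) _; rewrite addr0 mulrC; exact: ltW.
have : \forall k \near \oo, `|b k - a| <= e.
  apply: (@norm_cvg _ _ _ b a M) => // [|n c c0|n c c0].
  - exact: nearW.
  - have := small n c c0; apply: filterS => k h; apply: sqr_small => //.
    by apply: le_trans h; rewrite lerDr sqr_ge0.
  - have := small n c c0; apply: filterS => k h; apply: sqr_small => //.
    by apply: le_trans h; rewrite lerDl sqr_ge0.
by move=> [K _ /(_ K (leqnn K))]; exact: (hb K).2.
Qed.

(** [J y] is the maximizer defining [rho y], hence a subgradient of [rho] at [y]; the subgradient
    inequality together with the norm continuity of [J] stands for Frechet differentiability. The
    quadratic bounds come from comparing [lur_fun] with the squared norm. *)
Lemma smooth_convex_function : exists (rho : X -> R) (J : X -> dual X),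
  [/\ forall y z, rho y + J y (z - y) <= rho z, forall y, `|J y| <= 2 * `|y|,
      forall y, `|y| ^+ 2 / 8 <= rho y, rho 0 = 0 &
      forall y e, 0 < e -> exists2 r, 0 < r &
        forall z, `|z - y| <= r -> `|J z - J y| <= e].
Proof.
have [J hJ] := choice maximizer.
have sub y z : rho y + J y (z - y) <= rho z.
  by rewrite dual_sub -hJ; have := rho_ub (J y) z; move: (J y z : R) (J y y : R) => ? ?; lra.
have J2 y : `|J y| <= 2 * `|y|.
  have := hJ y; have := rho_ge0 y; have := N_ge (J y); have := dual_ub (J y) y.
  have := normr_ge0 (J y); have := normr_ge0 y.
  move: (J y y : R) (N _) (rho y) `|J y| `|y| => p q r s t t0 s0 h1 + h2 h3.
  rewrite expr2 => h4; rewrite leNgt; apply/negP => lt; nra.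
exists rho, J; split => //.
(* Testing with [|y| / 4] times a norming functional gives [|y|^2 / 4 - 2 * (|y| / 4)^2], that is
   [|y|^2 / 8]. *)
- move=> y; have [w w1 wy] := norming_dual y dx.
  have := rho_ub ((`|y| / 4) *: w) y; apply: le_trans; rewrite dualZE wy.
  have := N_le ((`|y| / 4) *: w); rewrite normrZ ger0_norm ?divr_ge0//.
  have := normr_ge0 w; have := normr_ge0 y.
  move: `|w| `|y| w1 (N _) => s t s1 q t0 s0.
  have h : t / 4 * s <= t / 4 by rewrite ler_piMr// divr_ge0.
  have h0 : 0 <= t / 4 * s by rewrite mulr_ge0// divr_ge0.
  by move: (t / 4 * s) h h0 => w' h h0; rewrite !expr2; nra.
- apply/le_anti; rewrite rho_ge0 andbT; apply: rho_le => a; rewrite dual_zero sub0r oppr_le0.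
  by rewrite (le_trans _ (N_ge a))// divr_ge0// exprn_ge0.
- move=> y e e0; have [r r0 hr] := stable (hJ y) e0.
  (* [c] bounds [|J y| + |J z|] as soon as [|z - y| <= 1]. *)
  pose c := 4 * `|y| + 2.
  have c0 : 0 < c by rewrite ltr_wpDl// mulr_ge0.
  exists (Num.min 1 (r / c)); first by rewrite lt_min ltr01 divr_gt0.
  move=> z; rewrite le_min => /andP[z1]; rewrite ler_pdivlMr// => zr.
  apply: hr; have := sub y z; rewrite -(hJ z).
  have h1 := dual_norm_ub (J y) (z - y); have h2 := dual_norm_ub (J z) (z - y).
  have := J2 y; have := J2 z; have zy : `|z| <= `|y| + 1.
    by rewrite -[z](subrK y) (le_trans (ler_normD _ _))// addrC lerD2l.
  move: h1 h2; rewrite !ler_norml !(dual_sub (J z)) => /andP[h1 _] /andP[_ h2].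
  have := normr_ge0 (z - y); have := normr_ge0 y; move: zr zy h1 h2; rewrite /c.
  move: (J y (z - y) : R) (J z z : R) (J z y : R) (N _) (rho y) => p q s t w.
  move: `|z - y| `|y| `|z| `|J y| `|J z| => m k n ny nz *.
  have : ny * m <= 2 * k * m by rewrite ler_wpM2r.
  have : nz * m <= 2 * n * m by rewrite ler_wpM2r.
  by nra.
Qed.

End SmoothConvex.

(** * The smooth variational principle *)

Section VariationalPrinciple.
Context {R : realType} {X : completeNormedModType R}.
Variables (rho : X -> R) (J : X -> dual X).
Hypotheses (rho_sub : forall y z, rho y + J y (z - y) <= rho z)
  (J_le : forall y, `|J y| <= 2 * `|y|) (rho_ge : forall y, `|y| ^+ 2 / 8 <= rho y)
  (rho0 : rho 0 = 0)
  (J_cont : forall y e, 0 < e -> exists2 r, 0 < r &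
     forall z, `|z - y| <= r -> `|J z - J y| <= e).

Let rho_ge0 y : 0 <= rho y.
Proof. by rewrite (le_trans _ (rho_ge y))// divr_ge0// exprn_ge0. Qed.

Lemma smooth_le y B : `|y| <= B -> rho y <= 2 * B ^+ 2.
Proof.
move=> yB; have := rho_sub y 0; rewrite rho0 sub0r dual_opp subr_le0 => /le_trans; apply.
rewrite (le_trans (dual_ub _ _))//; have := J_le y; have := normr_ge0 y.
by move: `|J y| `|y| yB => s t tB t0 st; rewrite expr2; nra.
Qed.

Lemma smooth_lip y z : rho z - rho y <= 2 * `|z| * `|z - y|.
Proof.
have := rho_sub z y; rewrite -opprB dual_opp => h.
have : J z (z - y) <= 2 * `|z| * `|z - y|.
  by rewrite (le_trans (dual_ub _ _))// ler_wpM2r.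
by move: (J z _ : R) (rho z) (rho y) h => ? ? ?; lra.
Qed.

Variables (f : X -> R) (S : set X) (B K m eta : R).
Hypotheses (Sclosed : closed S) (S_neq0 : S !=set0) (SB : forall y, S y -> `|y| <= B)
  (f_lip : forall y z, S y -> S z -> `|f y - f z| <= K * `|y - z|)
  (fm : forall y, S y -> m <= f y) (eta0 : 0 < eta).

Let M : R := 2 * (2 * B) ^+ 2.

Let B0 : 0 <= B.
Proof. by have [y Sy] := S_neq0; rewrite (le_trans _ (SB Sy)). Qed.

Let dist y z : S y -> S z -> `|y - z| <= 2 * B.
Proof.
move=> /SB y1 /SB z1; rewrite (le_trans (ler_normB _ _))//.
by rewrite mulr_natl mulr2n lerD.
Qed.

Let rhoM y z : S y -> S z -> `|rho (y - z)| <= M.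
Proof. by move=> Sy Sz; rewrite ger0_norm// smooth_le// dist. Qed.

Let M0 : 0 <= M. Proof. by rewrite mulr_ge0// sqr_ge0. Qed.

(** The first [k] perturbations, padded with zeros so that every stage is a [wsum] with the same
    weights. *)
Let pert (c : nat -> X) k y j : R := if (j < k)%N then rho (y - c j) else 0.

Let pertM c k y : (forall j, (j < k)%N -> S (c j)) -> S y -> forall j, `|pert c k y j| <= M.
Proof.
by move=> Sc Sy j; rewrite /pert; case: ifPn => [/Sc|_]; [exact: rhoM|rewrite normr0].
Qed.

Let pert_ge0 c k y j : 0 <= pert c k y j.
Proof. by rewrite /pert; case: ifP. Qed.

Let F c k y := f y + eta * wsum (pert c k y).

(** Comparing stages [k] and [k.+1] gives [eta * rho (c k.+1 - c k) / 2 ^+ k.+1 <= 2 * eps k]. The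
    tolerance is chosen so that this reads [rho (c k.+1 - c k) <= (2 ^- k) ^+ 2 / 8], which [rho_ge]
    converts into a step of length at most [2 ^- k]. *)
Let eps k : R := eta / (32 * 8 ^+ k).

Let eps0 k : 0 < eps k.
Proof. by rewrite divr_gt0// mulr_gt0// exprn_gt0. Qed.

(** A centre depends on all the earlier ones, so the choice is made for a list, and the sequence is
    rebuilt from its initial segments. *)
Let next (l : seq X) : exists c,
  (forall j, (j < size l)%N -> S (nth 0 l j)) ->
  S c /\ forall y, S y -> F (nth 0 l) (size l) c <= F (nth 0 l) (size l) y + eps (size l).
Proof.
have [Sl|] := pselect (forall j, (j < size l)%N -> S (nth 0 l j)); last by exists 0.
pose G := F (nth 0 l) (size l).
have Gm y : S y -> m <= G y.
  move=> Sy; rewrite (le_trans (fm Sy))// lerDl mulr_ge0 ?(ltW eta0)//.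
  by apply: (wsum_ge0 (pertM Sl Sy)); exact: pert_ge0.
have hi : has_inf [set G y | y in S].
  split; first by have [y Sy] := S_neq0; exists (G y), y.
  by exists m => _ [y Sy <-]; exact: Gm.
have [_ [c Sc <-] hc] := inf_adherent (eps0 (size l)) hi.
exists c => _; split => // y Sy; rewrite (le_trans (ltW hc))// lerD2r.
by apply: ge_inf; [case: hi|exists y].
Qed.

Let sequence_ex : exists c : nat -> X, (forall k, S (c k)) /\
  forall k y, S y -> F c k (c k) <= F c k y + eps k.
Proof.
have [nx hnx] := choice next.
pose L := fix L k := if k is k'.+1 then rcons (L k') (nx (L k')) else [::].
have Ls k : size (L k) = k by elim: k => //= k IH; rewrite size_rcons IH.
have Ln k j : (j < k)%N -> nth 0 (L k) j = nx (L j).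
  elim: k => // k IH; rewrite ltnS leq_eqVlt => /orP[/eqP ->|jk] /=.
    by rewrite nth_rcons Ls ltnn eqxx.
  by rewrite nth_rcons Ls jk IH.
have SL k : S (nx (L k)) /\ forall y, S y ->
    F (nth 0 (L k)) k (nx (L k)) <= F (nth 0 (L k)) k y + eps k.
  suff Sj j : (j < k)%N -> S (nth 0 (L k) j).
    by have := hnx (L k); rewrite Ls; apply.
  elim/ltn_ind: k j => k IH j jk; rewrite Ln//.
  by have := hnx (L j); rewrite Ls => /(_ (IH _ jk))[].
exists (fun k => nx (L k)); split => [k|k y Sy]; first exact: (SL k).1.
have FE z : F (fun k => nx (L k)) k z = F (nth 0 (L k)) k z.
  congr (_ + _ * wsum _); apply/funext => j; rewrite /pert.
  by case: ifPn => // jk; rewrite Ln.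
by rewrite !FE; exact: (SL k).2.
Qed.

(** Each centre almost minimizes the function perturbed around the earlier centres; the centres form
    a Cauchy sequence, and their limit is an exact minimizer for the full perturbation [g], a
    weighted sum of translates of [rho]. [p] is the derivative of [g] at [z], recorded as an upper
    estimate, the direction that turns minimality into a subgradient of [f]. *)
Lemma variational_principle : exists (z : X) (g : X -> R) (p : dual X),
  [/\ S z, forall y, S y -> 0 <= g y <= 2 * (2 * B) ^+ 2, `|p| <= 4 * B,
      forall y, S y -> f z + eta * g z <= f y + eta * g y &
      forall e, 0 < e -> exists2 r, 0 < r &
        forall y, `|y - z| <= r -> g y <= g z + p (y - z) + e * `|y - z|].
Proof.
have [c [Sc hc]] := sequence_ex.
have Sck k j : (j < k)%N -> S (c j) by [].
have step k : `|c k.+1 - c k| <= 2 ^- k.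
  have h1 := hc k.+1 (c k) (Sc k); have h2 := hc k (c k.+1) (Sc _).
  (* The new perturbation vanishes at its own centre [c k]. *)
  have e1 : F c k.+1 (c k) = F c k (c k).
    congr (_ + _ * wsum _); apply/funext => j; rewrite /pert ltnS leq_eqVlt.
    have [->|jk] := eqVneq j k; first by rewrite subrr rho0 ltnn.
    by [].
  have h3 : F c k (c k.+1) + eta * (rho (c k.+1 - c k) / 2 ^+ k.+1) <= F c k.+1 (c k.+1).
    rewrite /F -addrA lerD2l -mulrDr ler_pM2l//.
    pose dl j := pert c k.+1 (c k.+1) j - pert c k (c k.+1) j.
    have p1 := pertM (Sck k) (Sc k.+1); have p2 := pertM (Sck k.+1) (Sc k.+1).
    have dlE j : dl j = if j == k then rho (c k.+1 - c k) else 0.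
      rewrite /dl /pert ltnS leq_eqVlt; have [->|] := eqVneq j k.
        by rewrite ltnn subr0.
      by move=> _ /=; rewrite subrr.
    have dM j : `|dl j| <= M.
      by rewrite dlE; case: ifP => _; [exact: rhoM|rewrite normr0].
    have d0 j : 0 <= dl j by rewrite dlE; case: ifP.
    have -> : wsum (pert c k.+1 (c k.+1)) = wsum (pert c k (c k.+1)) + wsum dl.
      rewrite -(wsumD p1 dM); congr wsum; apply/funext => j.
      by rewrite /dl addrC subrK.
    by rewrite lerD2l; have := le_wsum_term k dM d0; rewrite {1}dlE eqxx.
  have ek : eps k.+1 <= eps k.
    rewrite ler_wpM2l ?(ltW eta0)// lef_pV2 ?posrE ?mulr_gt0 ?exprn_gt0//.
    by rewrite ler_pM2l// ler_eXn2l ?ltr1n.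
  have h4 : eta * (rho (c k.+1 - c k) / 2 ^+ k.+1) <= 2 * eps k.
    by move: h1 h2 h3 ek; rewrite e1; move: (F _ _ _) (F _ _ _) (F _ _ _) => ? ? ?; lra.
  have h5 : rho (c k.+1 - c k) <= (2 ^- k) ^+ 2 / 8.
    move: h4; rewrite /eps [2 * _]mulrCA ler_pM2l// ler_pdivrMr ?exprn_gt0//.
    move=> /le_trans; apply; rewrite exprS (_ : 8 = 2 * 2 * 2 :> R); last by rewrite -!natrM.
    rewrite !exprMn; have : 2 ^+ k != 0 :> R by rewrite expf_neq0.
    move: (2 ^+ k) => t t0; rewrite le_eqVlt; apply/orP; left; apply/eqP.
    by field.
  have h6 := rho_ge (c k.+1 - c k).
  have : `|c k.+1 - c k| ^+ 2 <= (2 ^- k) ^+ 2.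
    by have := le_trans h6 h5; rewrite ler_pM2r// invr_gt0.
  by rewrite ler_sqr ?nnegrE// invr_ge0 exprn_ge0.
have cz : cvgn c.
  have cE : c = (fun k => c 0%N + series (fun j => c j.+1 - c j) k).
    apply/funext => k; rewrite /series/= telescope_sumr//.
    by rewrite addrC subrK.
  rewrite cE; apply: is_cvgD; first exact: is_cvg_cst.
  apply: normed_cvg; apply: (@series_le_cvg _ _ (geometric 1 2^-1)) => //.
  - by move=> n /=.
  - by move=> n; rewrite /geometric/= mul1r exprn_ge0.
  - by move=> n; rewrite /geometric/= mul1r exprVn.
  - by apply: is_cvg_geometric_series; rewrite ger0_norm// invf_lt1// ltr1n.
pose z := limn c; have cz' : c @ \oo --> z by exact: cz.
have Sz : S z by apply: (closed_cvg _ Sclosed _ _ cz') => //; exact: nearW.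
pose g y := wsum (fun j => rho (y - c j)).
have gM y : S y -> forall j, `|rho (y - c j)| <= M by move=> Sy j; exact: rhoM.
have JM j y : `|J (z - c j) y : R| <= 4 * B * `|y|.
  rewrite (le_trans (dual_norm_ub _ _))// ler_wpM2r//.
  by rewrite (le_trans (J_le _))//; have := dist Sz (Sc j); lra.
have B4 : 0 <= 4 * B by rewrite mulr_ge0.
have [p pE] : exists p : dual X, forall y, p y = wsum (fun j => J (z - c j) y : R).
  apply: (@dual_of _ _ _ (4 * B)) => [x y|a y|y].
  - rewrite -(@wsumD _ _ _ (4 * B * `|x| + 4 * B * `|y|)).
    + by congr wsum; apply/funext => j; rewrite dual_add.
    + by move=> j; rewrite (le_trans (JM _ _))// lerDl mulr_ge0.
    + by move=> j; rewrite (le_trans (JM _ _))// lerDr mulr_ge0.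
  - rewrite -(wsumZ _ (fun j => JM j y)); congr wsum; apply/funext => j.
    by rewrite dual_scale.
  - by rewrite (le_trans (ler_norm _))// wsum_norm_le.
exists z, g, p; split => //.
- move=> y Sy; rewrite (wsum_ge0 (gM _ Sy))//=.
  by rewrite (le_trans (ler_norm _))// wsum_norm_le//; exact: gM.
- apply: dual_norm_le => // y; rewrite pE (le_trans (ler_norm _))// wsum_norm_le//.
(* The limit is taken in [F c k (c k) <= F c k y + eps k]: lower semicontinuity serves on the left,
   and on the right the truncated perturbation is at most [g y]. *)
- move=> y Sy; apply/ler_addgt0Pl => e e0.
  have e3 : 0 < e / 3 by rewrite divr_gt0.
  have ee3 : 0 < e / 3 / eta by rewrite divr_gt0.
  have l1 : \forall k \near \oo, g z <= wsum (pert c k (c k)) + e / 3 / eta.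
    apply: (wsum_lsc (gM _ Sz)) => //.
      by apply: nearW => k j; exact: (pertM (Sck k) (Sc k)).
    move=> j r r0; have q0 : 0 < 4 * B + 1 by rewrite ltr_wpDl.
    have /cvgrPdist_le/(_ _ (divr_gt0 r0 q0)) h := cz'.
    near=> k; have jk : (j < k)%N by near: k; exact: nbhs_infty_gt.
    rewrite /pert jk -lerBlDl (le_trans (smooth_lip _ _))//.
    have -> : z - c j - (c k - c j) = z - c k by rewrite opprB addrA subrK.
    have : `|z - c k| <= r / (4 * B + 1) by near: k.
    rewrite ler_pdivlMr// => hk; apply: le_trans hk; rewrite mulrC ler_wpM2l//.
    by have := dist Sz (Sc j); lra.
  have l2 : \forall k \near \oo, f z <= f (c k) + e / 3.
    have K1 : 0 < `|K| + 1 by rewrite ltr_wpDl.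
    have /cvgrPdist_le/(_ _ (divr_gt0 e3 K1)) := cz'; apply: filterS => k.
    rewrite ler_pdivlMr// => h; have := f_lip Sz (Sc k); rewrite ler_norml => /andP[_].
    rewrite -lerBlDl => /le_trans; apply; apply: le_trans h; rewrite mulrC ler_wpM2l//.
    by rewrite (le_trans (ler_norm _))// lerDl.
  have l3 : \forall k \near \oo, eps k <= e / 3.
    have c0 : 0 < e / 3 / eta * 32 by rewrite mulr_gt0.
    have /cvgrPdist_lt/(_ _ c0) : (fun n => 1 * 8^-1 ^+ n) @ \oo --> (0 : R).
      by apply: (@cvg_geometric R 1 8^-1); rewrite ger0_norm ?invr_ge0// invf_lt1// ltr1n.
    apply: filterS => k; rewrite mul1r sub0r normrN exprVn ger0_norm ?invr_ge0 ?exprn_ge0//.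
    move=> h; rewrite /eps invfM mulrA -ler_pdivlMl ?divr_gt0//.
    apply: le_trans (ltW h) _; rewrite le_eqVlt; apply/orP; left; apply/eqP.
    by field; rewrite gt_eqF.
  near \oo => k.
  have h1 : g z <= wsum (pert c k (c k)) + e / 3 / eta by near: k.
  have h2 : f z <= f (c k) + e / 3 by near: k.
  have h3 : eps k <= e / 3 by near: k.
  have h4 := hc k y Sy.
  have h5 : wsum (pert c k y) <= g y.
    apply: (le_wsum (pertM (Sck k) Sy) (gM _ Sy)) => j; rewrite /pert.
    by case: ifP.
  have h1' : eta * g z <= eta * wsum (pert c k (c k)) + e / 3.
    have : eta * g z <= eta * (wsum (pert c k (c k)) + e / 3 / eta) by rewrite ler_pM2l.
    by rewrite mulrDr (mulrC eta (_ / eta)) divfK// gt_eqF.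
  have h5' : eta * wsum (pert c k y) <= eta * g y by rewrite ler_pM2l.
  move: h1' h2 h3 h4 h5'; rewrite /F.
  move: (wsum (pert c k (c k))) (wsum (pert c k y)) (eps k) (g z) (g y) (f (c k)) (f z) (f y).
  by move=> u1 u2 u3 u4 u5 u6 u7 u8 h6 h7 h8 h9 h10; lra.
- move=> e e0.
  (* Each term tends to 0 by continuity of [J]; near [z] the terms are dominated by
     [2 * (2 * B + 1) + 2 * (2 * B)], which is [8 * B + 2]. *)
  have cv : (fun y => wsum (fun j => `|J (y - c j) - J (z - c j)|)) @ z --> wsum (fun=> 0 : R).
    apply: (@wsum_cvg _ _ _ _ _ _ (8 * B + 2)) => [j||j].
    + by rewrite normr0; lra.
    + apply/nbhs_ballP; exists 1 => //= y; rewrite -ball_normE/= => zy j.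
      rewrite ger0_norm// (le_trans (ler_normB _ _))//.
      have yc : `|y - c j| <= 2 * B + 1.
        have -> : y - c j = (z - c j) - (z - y) by rewrite opprB [RHS]addrC addrA subrK.
        by rewrite (le_trans (ler_normB _ _))// lerD// ?dist// ltW.
      have := J_le (y - c j); have := J_le (z - c j); have := dist Sz (Sc j).
      by move: `|J _| `|J _| `|z - c j| `|y - c j| yc => *; lra.
    + apply/cvgrPdist_le => r r0; have [q q0 hq] := J_cont (z - c j) r0.
      apply/nbhs_ballP; exists q => //= y; rewrite -ball_normE/= => zy.
      rewrite sub0r normrN normr_id; apply: hq.
      by rewrite opprB addrA subrK distrC ltW.
  move/cvgrPdist_le: cv => /(_ _ e0); rewrite wsum_cst.
  move=> /nbhs_ballP[r /= r0 hr].
  exists (Num.min r 1 / 2); first by rewrite divr_gt0// lt_min r0 ltr01.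
  move=> y yr; have yr' : `|z - y| < Num.min r 1.
    by rewrite distrC (le_lt_trans yr)// ltr_pdivrMr// mulr_natr mulr2n ltrDl lt_min r0 ltr01.
  move: (yr'); rewrite lt_min => /andP[zyr zy1].
  have := hr y; rewrite -ball_normE/= => /(_ zyr).
  rewrite sub0r normrN => hw.
  have yc j : `|y - c j| <= 2 * B + 1.
    have -> : y - c j = (z - c j) - (z - y) by rewrite opprB [RHS]addrC addrA subrK.
    by rewrite (le_trans (ler_normB _ _))// lerD// ?dist// ltW.
  have bJ j : `| `|J (y - c j) - J (z - c j)| | <= 8 * B + 2.
    rewrite ger0_norm// (le_trans (ler_normB _ _))//.
    have := J_le (y - c j); have := J_le (z - c j); have := dist Sz (Sc j); have := yc j.
    by move: `|J _| `|J _| `|z - c j| `|y - c j| => *; lra.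
  (* A crude common bound whose purpose is to license the rules for [wsum]. *)
  pose W := M + 2 * (2 * B + 1) ^+ 2 + (4 * B) * `|y - z| + `|y - z| * (8 * B + 2).
  have W1 : 0 <= 2 * (2 * B + 1) ^+ 2 by rewrite mulr_ge0// sqr_ge0.
  have W2 : 0 <= (4 * B) * `|y - z| by rewrite mulr_ge0.
  have W3 : 0 <= `|y - z| * (8 * B + 2) by rewrite mulr_ge0//; lra.
  have m1 j : `|rho (y - c j)| <= W.
    by rewrite ger0_norm// (le_trans (smooth_le (yc j)))// /W; move: M0; lra.
  have m2 j : `|rho (z - c j)| <= W.
    by rewrite (le_trans (gM _ Sz _))// /W; lra.
  have m3 j : `|J (z - c j) (y - z) : R| <= W.
    by rewrite (le_trans (JM _ _))// /W; move: M0; lra.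
  have m4 j : `| `|y - z| * `|J (y - c j) - J (z - c j)| | <= W.
    rewrite normrM normr_id (le_trans (ler_wpM2l _ (bJ j)))// /W; move: M0; lra.
  have m23 j : `|rho (z - c j) + J (z - c j) (y - z)| <= W + W.
    by rewrite (le_trans (ler_normD _ _))// lerD.
  have WW : W <= W + W by rewrite lerDl (le_trans _ (m2 0%N)).
  have m4' j : `| `|y - z| * `|J (y - c j) - J (z - c j)| | <= W + W.
    exact: le_trans (m4 j) WW.
  have m234 j : `|rho (z - c j) + J (z - c j) (y - z) +
      `|y - z| * `|J (y - c j) - J (z - c j)| | <= W + W + (W + W).
    by rewrite (le_trans (ler_normD _ _))// lerD.
  have : g y <= wsum (fun j => rho (z - c j) + J (z - c j) (y - z) +
      `|y - z| * `|J (y - c j) - J (z - c j)|).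
    apply: (le_wsum _ m234) => j.
      by rewrite (le_trans (m1 j))// (le_trans WW)// lerDl (le_trans _ WW)// (le_trans _ (m2 0%N)).
    (* The subgradient inequality based at the moved point bounds the convex [rho] from above. *)
    have := rho_sub (y - c j) (z - c j).
    have -> : z - c j - (y - c j) = - (y - z) by rewrite !opprB addrA subrK.
    have := dual_ub (J (y - c j) - J (z - c j)) (y - z).
    rewrite dual_opp dualBE [`|_ - _| * _]mulrC.
    by move: (J _ _ : R) (J _ _ : R) (rho _) (rho _) => *; lra.
  rewrite (wsumD m23 m4') (wsumD m2 m3) (wsumZ _ bJ) -pE => /le_trans; apply.
  rewrite lerD2l mulrC ler_wpM2r//; exact: le_trans (ler_norm _) hw.
Unshelve. all: by end_near.
Qed.

End VariationalPrinciple.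

(** * Frechet subgradients and fuzzy calculus *)

(** The real-valued form of [frechet_subgradient], with the quotient multiplied out so that the
    point [z] itself needs no exception. *)
Definition frechet_sub {R : realType} {X : normedModType R} (f : X -> R) z (p : dual X) :=
  forall e, 0 < e -> exists2 r, 0 < r &
    forall y, `|y - z| <= r -> f z + p (y - z) <= f y + e * `|y - z|.

Lemma frechet_sub_norm_le {R : realType} {X : normedModType R} (f : X -> R) z p r K :
  0 < r -> 0 <= K -> (forall y, `|y - z| <= r -> f y - f z <= K * `|y - z|) ->
  frechet_sub f z p -> `|p| <= K.
Proof.
move=> r0 K0 fK fp; apply: dual_norm_le => // u; apply/ler_addgt0Pl => e e0.
have u1 : 0 < `|u| + 1 by rewrite ltr_wpDl.
have [q q0 hq] := fp _ (divr_gt0 e0 u1).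
pose t := Num.min q r / (`|u| + 1).
have t0 : 0 < t by rewrite divr_gt0// lt_min q0 r0.
have tu : `|t *: u| <= Num.min q r.
  rewrite normrZ (gtr0_norm t0) /t mulrAC ler_pdivrMr// ler_pM2l ?lerDl//.
  by rewrite lt_min q0 r0.
move: (tu); rewrite le_min => /andP[tq tr].
have := hq (z + t *: u); have := fK (z + t *: u); rewrite addrAC subrr add0r.
move=> /(_ tr) h1 /(_ tq); rewrite dual_scale; move: h1.
rewrite normrZ (gtr0_norm t0) => h1 h2.
have h3 : e / (`|u| + 1) * `|u| <= e.
  by rewrite mulrAC ler_pdivrMr// ler_pM2l// lerDl.
rewrite -(ler_pM2l t0) mulrDr; move: h1 h2; rewrite !(mulrCA _ t).
have h4 : t * (e / (`|u| + 1) * `|u|) <= t * e by rewrite ler_pM2l.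
by move: (t * p u) (t * _) (t * _) (t * e) h4 => a b c d'; lra.
Qed.

Section FuzzyCalculus.
Context {R : realType} {X : completeNormedModType R}.
Hypotheses (X_separable : separable X) (X_asplund : asplund X).

Section DecoupledSum.
Variables (f : X -> R) (xb : X) (r K : R).
Hypotheses (r0 : 0 < r) (K0 : 0 <= K)
  (f_lip : forall y z, `|y - xb| <= r -> `|z - xb| <= r -> `|f y - f z| <= K * `|y - z|).
Variables (E : normedModType R) (P : set E) (A : E -> X) (q : E -> R).
Hypotheses (P0 : P !=set0) (Pc : compact P)
  (Pconv : forall s v t, P s -> P v -> 0 <= t <= 1 -> P (s + t *: (v - s)))
  (Aaff : forall s v t, P s -> P v -> 0 <= t <= 1 ->
     A (s + t *: (v - s)) = A s + t *: (A v - A s))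
  (qconv : forall s v t, P s -> P v -> 0 <= t <= 1 ->
     q (s + t *: (v - s)) <= q s + t * (q v - q s))
  (Acont : continuous A) (qcont : continuous q)
  (AP : forall s, P s -> `|A s - xb| <= r / 2).

Lemma decoupled_sum_rule e :  0 < e -> exists s z p,
  [/\ P s, frechet_sub f z p, `|z - A s| <= e,
      forall v, P v -> f (A s) + q s <= f (A v) + q v + e &
      forall v, P v -> q s <= q v + p (A v - A s) + e * `|A v - A s|].
Proof.
move=> e0; have [x dx] := separable_dense_seq X_separable.
have [d dd] := asplund_dual_separable dx X_asplund.
have [rho [J [rho_sub J_le rho_ge rho0 J_cont]]] := smooth_convex_function dx dd.
have rho_ge0 y : 0 <= rho y by rewrite (le_trans _ (rho_ge y))// divr_ge0// exprn_ge0.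
have lip := smooth_lip rho_sub J_le.
pose S := [set y | `|y - xb| <= r]; pose B := `|xb| + r.
have SB y : S y -> `|y| <= B.
  by move=> Sy; rewrite -[y](subrK xb) (le_trans (ler_normD _ _))// addrC lerD2l.
have B0 : 0 <= B by rewrite addr_ge0// ltW.
pose e1 := Num.min (r / 4) (e / (2 * (K + 1))).
have K1 : 0 < K + 1 by rewrite ltr_wpDl.
have e10 : 0 < e1 by rewrite lt_min !divr_gt0// mulr_gt0.
have e1r : e1 <= r / 4 by rewrite ge_min lexx.
have e1e : (K + 1) * e1 <= e / 2.
  apply: (@le_trans _ _ ((K + 1) * (e / (2 * (K + 1))))).
    by rewrite ler_pM2l// ge_min lexx orbT.
  by rewrite le_eqVlt; apply/orP; left; apply/eqP; field; rewrite gt_eqF.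
(* Since [rho] is at least an eighth of the squared norm, [|z - A s| > e1] would make the penalty
   exceed [(K + 1) * |z - A s|], more than the Lipschitz term of [f] can compensate. *)
pose N := 8 * (K + 1) / e1.
have N0 : 0 < N by rewrite divr_gt0// mulr_gt0.
pose G := 2 * (2 * B) ^+ 2.
have G0 : 0 <= G by rewrite mulr_ge0// sqr_ge0.
(* [G] bounds the perturbation [g] and [4 * B] its derivative; both have to be small after
   multiplication by [eta]. *)
pose eta := Num.min 1 (Num.min e1 e / (G + 4 * B + 1)).
have D0 : 0 < G + 4 * B + 1 by rewrite ltr_wpDl// addr_ge0// mulr_ge0.
have eta0 : 0 < eta by rewrite lt_min ltr01 divr_gt0// lt_min e10.
have etaD : eta * (G + 4 * B + 1) <= Num.min e1 e.
  by rewrite -ler_pdivlMr// ge_min lexx orbT.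
have etaG : eta * G < e1.
  have : eta * (G + 4 * B + 1) <= e1 by rewrite (le_trans etaD)// ge_min lexx.
  by have := mulr_ge0 (ltW eta0) B0; lra.
have etaB : eta * (4 * B) <= e.
  have : eta * (G + 4 * B + 1) <= e by rewrite (le_trans etaD)// ge_min lexx orbT.
  by have := mulr_ge0 (ltW eta0) G0; lra.
have rho_cont : continuous rho.
  move=> y; apply/cvgrPdist_le => c c0.
  have c1 : 0 < 2 * (`|y| + 1) by rewrite mulr_gt0// ltr_wpDl.
  apply/nbhs_ballP; exists (Num.min 1 (c / (2 * (`|y| + 1)))) => /=.
    by rewrite lt_min ltr01 divr_gt0.
  move=> z; rewrite -ball_normE/= lt_min => /andP[yz1]; rewrite ltr_pdivlMr// => yzc.
  have zy : `|z| <= `|y| + 1.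
    rewrite -[z](subrK y) (le_trans (ler_normD _ _))// addrC lerD2l distrC.
    exact: ltW.
  have := lip y z; have := lip z y; rewrite (distrC z y).
  have h1 : 2 * `|z| * `|y - z| <= 2 * (`|y| + 1) * `|y - z|.
    by rewrite ler_wpM2r// ler_wpM2l.
  have h2 : 2 * `|y| * `|y - z| <= 2 * (`|y| + 1) * `|y - z|.
    by rewrite ler_wpM2r// ler_wpM2l// lerDl.
  rewrite [`|y - z| * _]mulrC in yzc.
  by move=> h3 h4; rewrite ler_norml; apply/andP; split; lra.
have hmin y : exists s, P s /\ forall v, P v -> q s + N * rho (y - A s) <= q v + N * rho (y - A v).
  have cont : {within P, continuous (fun s => q s + N * rho (y - A s))}.
    apply: continuous_subspaceT => s; apply: cvgD; first exact: qcont.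
    apply: cvgMl_tmp; apply: continuous_comp; last exact: rho_cont.
    by apply: cvgB; [exact: cvg_cst|exact: Acont].
  have [s] := compact_EVT_min P0 Pc cont.
  by rewrite inE => Ps hs; exists s; split => // v Pv; apply: hs; rewrite inE.
have [sm hsm] := choice hmin.
(* The marginal function of the penalized problem. It is Lipschitz on [S], so the variational
   principle applies to [f + h]. *)
pose h y := q (sm y) + N * rho (y - A (sm y)).
have Ssub s : P s -> S (A s) by move=> /AP h1; rewrite /S/= (le_trans h1)//; lra.
have dS y z : S y -> S z -> `|y - z| <= 2 * B.
  move=> /SB y1 /SB z1; rewrite (le_trans (ler_normB _ _))//.
  by rewrite mulr_natl mulr2n lerD.
have h_le y z : S y -> S z -> h y - h z <= N * (2 * (2 * B)) * `|y - z|.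
  move=> Sy Sz; have := (hsm y).2 _ (hsm z).1; rewrite -/(h y) /h.
  have := lip (z - A (sm z)) (y - A (sm z)).
  have -> : y - A (sm z) - (z - A (sm z)) = y - z by rewrite opprB addrA subrK.
  move=> h1 h2.
  have h3 : rho (y - A (sm z)) - rho (z - A (sm z)) <= 2 * (2 * B) * `|y - z|.
    rewrite (le_trans h1)// ler_wpM2r// ler_wpM2l// dS//.
    by apply: Ssub; exact: (hsm z).1.
  have h4 : N * (rho (y - A (sm z)) - rho (z - A (sm z))) <= N * (2 * (2 * B) * `|y - z|).
    by rewrite ler_pM2l.
  rewrite -mulrA; rewrite mulrBr in h4.
  by move: (N * _) (N * _) (N * _) (N * _) h2 h4 => *; lra.
have f_lip' y z : S y -> S z ->
    `|(f y + h y) - (f z + h z)| <= (K + N * (2 * (2 * B))) * `|y - z|.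
  move=> Sy Sz; have := h_le _ _ Sy Sz; have := h_le _ _ Sz Sy; rewrite (distrC z y).
  have := f_lip Sy Sz; rewrite !ler_norml (mulrDl K).
  by move: (h y) (h z) => hy hz /andP[? ?] ? ?; apply/andP; split; lra.
have Sxb : S xb by rewrite /S/= subrr normr0 ltW.
have Scl : closed S.
  have -> : S = (fun y => `|y - xb|) @^-1` [set t | t <= r] by [].
  apply: closed_comp; last exact: closed_le.
  move=> y _; apply: cvg_norm; apply: cvgB; [exact: cvg_id|exact: cvg_cst].
have low y : S y -> f xb + h xb - (K + N * (2 * (2 * B))) * r <= f y + h y.
  move=> Sy; have := f_lip' _ _ Sy Sxb; rewrite ler_norml => /andP[+ _].
  have : (K + N * (2 * (2 * B))) * `|y - xb| <= (K + N * (2 * (2 * B))) * r.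
    by rewrite ler_wpM2l// addr_ge0// mulr_ge0 ?(ltW N0)// !mulr_ge0.
  by move: (_ * `|_|) (_ * r) => *; lra.
have [z [g [p0 [Sz gM p0M zmin gfre]]]] := variational_principle rho_sub J_le rho_ge rho0
  J_cont Scl (ex_intro _ xb Sxb) SB f_lip' low eta0.
pose s := sm z; have Ps : P s by exact: (hsm z).1.
have key y v : S y -> P v ->
    f z + (q s + N * rho (z - A s)) + eta * g z <= f y + (q v + N * rho (y - A v)) + eta * g y.
  move=> Sy Pv; have := zmin y Sy; have := (hsm y).2 v Pv.
  by rewrite -/(h y) -/(h z); move: (eta * _) (eta * _) (N * _) => *; lra.
have keyA v : P v -> f z + (q s + N * rho (z - A s)) <= f (A v) + q v + eta * G.
  move=> Pv; have := key (A v) v (Ssub _ Pv) Pv.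
  have /andP[g1 _] := gM z Sz; have /andP[_ g2] := gM _ (Ssub _ Pv).
  have := mulr_ge0 (ltW eta0) g1; have : eta * g (A v) <= eta * G by rewrite ler_pM2l.
  rewrite subrr rho0 mulr0 addr0.
  by move: (eta * _) (eta * _) (eta * _) (N * _) => *; lra.
have fK : f (A s) - f z <= K * `|z - A s|.
  by have := f_lip (Ssub _ Ps) Sz; rewrite distrC (distrC _ z) ler_norml => /andP[+ _]; lra.
have zs : `|z - A s| <= e1.
  rewrite leNgt; apply/negP => lt; have u0 := normr_ge0 (z - A s).
  have h1 : (K + 1) * `|z - A s| <= N * rho (z - A s).
    apply: (@le_trans _ _ (N * (`|z - A s| ^+ 2 / 8))); last by rewrite ler_pM2l.
    have -> : N * (`|z - A s| ^+ 2 / 8) = (K + 1) * `|z - A s| * (`|z - A s| / e1).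
      by rewrite /N; field; rewrite gt_eqF.
    by rewrite ler_peMr ?mulr_ge0 ?(ltW K1)// ler_pdivlMr// mul1r ltW.
  have := keyA s Ps; move: h1 fK etaG lt; rewrite mulrDl mul1r.
  by move: `|z - A s| (rho (z - A s)) => *; lra.
pose p := - (N *: J (z - A s)) - eta *: p0.
exists s, z, p; split => //.
- move=> c c0; pose c' := c / (N + 1).
  have N1 : 0 < N + 1 by rewrite addr_gt0.
  have c'0 : 0 < c' by rewrite divr_gt0.
  have [q1 q10 hq1] := J_cont (z - A s) c' c'0.
  have [q2 q20 hq2] := gfre c' c'0.
  pose q3 := r / 4.
  have q30 : 0 < q3 by rewrite divr_gt0.
  exists (Num.min q1 (Num.min q2 q3)); first by rewrite !lt_min q10 q20.
  move=> y; rewrite !le_min => /and3P[y1 y2 y3].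
  have Sy : S y.
    rewrite /S/= -[y](subrK z) -addrA (le_trans (ler_normD _ _))//.
    have : `|z - xb| <= e1 + r / 2.
      rewrite -[z](subrK (A s)) -addrA (le_trans (ler_normD _ _))// lerD//.
      exact: AP.
    by move: y3 e1r; rewrite /q3; move: `|_| `|_| => *; lra.
  have h1 := key y s Sy Ps.
  have h2 : rho (y - A s) <= rho (z - A s) + J (z - A s) (y - z) + c' * `|y - z|.
    have := rho_sub (y - A s) (z - A s).
    have -> : z - A s - (y - A s) = - (y - z) by rewrite !opprB addrA subrK.
    have := dual_ub (J (y - A s) - J (z - A s)) (y - z).
    have : `|J (y - A s) - J (z - A s)| * `|y - z| <= c' * `|y - z|.
      rewrite ler_wpM2r// hq1//.
      by have -> : y - A s - (z - A s) = y - z by rewrite opprB addrA subrK.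
    rewrite dual_opp dualBE.
    by move: (_ * `|_|) (_ * `|_|) (J _ _ : R) (J _ _ : R) => *; lra.
  have h3 := hq2 y y2.
  have h2' : N * rho (y - A s) <= N * (rho (z - A s) + J (z - A s) (y - z) + c' * `|y - z|).
    by rewrite ler_pM2l.
  have h3' : eta * g y <= eta * g z + eta * p0 (y - z) + c' * `|y - z|.
    have : eta * g y <= eta * (g z + p0 (y - z) + c' * `|y - z|) by rewrite ler_pM2l.
    have cyz : 0 <= c' * `|y - z| by exact: mulr_ge0 (ltW c'0) (normr_ge0 _).
    rewrite !mulrDr => /le_trans; apply; rewrite lerD2l ler_piMl//.
    by rewrite ge_min lexx.
  have -> : c * `|y - z| = N * (c' * `|y - z|) + c' * `|y - z|.
    by rewrite /c'; field; rewrite gt_eqF.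
  rewrite /p dualBE dualNE !dualZE; rewrite !mulrDr in h2'; move: h1 h2' h3'.
  move: (N * rho _) (N * rho _) (N * (c' * _)) (N * J _ _ : R) (eta * g _) (eta * g _).
  by move: (c' * _) (eta * p0 _ : R) (f z) (f y) => *; lra.
- rewrite (le_trans zs)//; move: e1e; rewrite mulrDl mul1r.
  by have := mulr_ge0 K0 (ltW e10); move: (K * _) => *; lra.
- move=> v Pv; have := keyA v Pv; have := mulr_ge0 (ltW N0) (rho_ge0 (z - A s)).
  have : K * `|z - A s| <= K * e1 by rewrite ler_wpM2l.
  move: fK etaG e1e; rewrite mulrDl mul1r.
  by move: (K * _) (K * _) (N * _) (eta * _) => *; lra.
- move=> v Pv; pose w := A v - A s.
  have pw : p w = - (N * J (z - A s) w) - eta * p0 w by rewrite /p dualBE dualNE !dualZE.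
  have p0w : eta * p0 w <= e * `|w|.
    apply: (@le_trans _ _ (eta * (4 * B * `|w|))).
      rewrite ler_pM2l// (le_trans (dual_ub _ _))// ler_wpM2r//.
    by rewrite mulrA ler_wpM2r.
  suff : N * J (z - A s) w <= q v - q s.
    move: p0w; rewrite -[A v - A s]/w pw.
    by move: (N * J _ _ : R) (eta * p0 w : R) (e * `|w|) => u1 u2 u3 u4 u5; lra.
  (* Optimality of [s] on the segment towards [v]: convexity of [q] bounds its increment, and
     division by the step [t] leaves the derivative of [rho] at a point close to [z - A s]. *)
  apply/ler_addgt0Pl => c c0.
  have w1 : 0 < N * (`|w| + 1) by rewrite mulr_gt0// ltr_wpDl.
  have [t1 t10 ht1] := J_cont (z - A s) _ (divr_gt0 c0 w1).
  have w2 : 0 < `|w| + 1 by rewrite ltr_wpDl.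
  pose t := Num.min 1 (t1 / (`|w| + 1)).
  have t0 : 0 < t by rewrite lt_min ltr01 divr_gt0.
  have tl1 : t <= 1 by rewrite ge_min lexx.
  have t01 : 0 <= t <= 1 by rewrite (ltW t0).
  have tw : `|t *: w| <= t1.
    rewrite normrZ (gtr0_norm t0); apply: (@le_trans _ _ (t * (`|w| + 1))).
      by rewrite ler_pM2l// lerDl.
    by rewrite -ler_pdivlMr// ge_min lexx orbT.
  have := (hsm z).2 _ (Pconv Ps Pv t01); rewrite -/s (Aaff Ps Pv t01) -/w opprD addrA.
  have := qconv Ps Pv t01; have := rho_sub (z - A s - t *: w) (z - A s).
  have -> : z - A s - (z - A s - t *: w) = t *: w by rewrite opprB addrC subrK.
  rewrite dual_scale => h1 h2 h3.
  have h4 := ht1 (z - A s - t *: w); rewrite addrAC subrr add0r normrN in h4.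
  have h5 := dual_ub (J (z - A s) - J (z - A s - t *: w)) w.
  have h6 : `|J (z - A s) - J (z - A s - t *: w)| * `|w| <= c / N.
    apply: (@le_trans _ _ (c / (N * (`|w| + 1)) * `|w|)).
      by rewrite ler_wpM2r// distrC h4.
    rewrite invfM mulrA mulrAC -mulrA ler_piMr ?(ltW (divr_gt0 c0 N0))//.
    by rewrite ler_pdivrMr// mul1r lerDl.
  rewrite dualBE in h5.
  have h7 : N * J (z - A s) w <= N * J (z - A s - t *: w) w + c.
    have : J (z - A s) w <= J (z - A s - t *: w) w + c / N.
      by move: h5 h6; move: (_ * `|_|) (J _ _ : R) (J _ _ : R) (c / N) => *; lra.
    by rewrite -(ler_pM2l N0) mulrDr (mulrC N (c / N)) divfK// gt_eqF.
  have h8 : t * (N * J (z - A s - t *: w) w) <= t * (q v - q s).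
    have : N * (rho (z - A s - t *: w) + t * J (z - A s - t *: w) w) <= N * rho (z - A s).
      by rewrite ler_pM2l.
    rewrite mulrDr [N * (t * _)]mulrCA; move: h2 h3.
    move: (N * rho (z - A s)) (N * rho (z - A s - t *: w)) (q s) (q (s + t *: (v - s))).
    move: (t * (N * (J (z - A s - t *: w) w : R))) (t * (q v - q s)) => *; lra.
  rewrite ler_pM2l// in h8.
  by move: h7 h8; move: (N * _) (N * _) (q v) (q s) => *; lra.
Qed.

End DecoupledSum.

(** The decoupled rule is applied on the unit interval to [f (a + s *: (b - a)) - s * c]. Since
    [c < f b - f a], the end [s = 1] is not an approximate minimizer, so the optimality condition
    tested at 1 can be divided by [1 - s]. *)
Lemma mean_value_frechet (f : X -> R) xb r K a b c e : 0 < r -> 0 <= K ->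
  (forall y z, `|y - xb| <= r -> `|z - xb| <= r -> `|f y - f z| <= K * `|y - z|) ->
  `|a - xb| <= r / 2 -> `|b - xb| <= r / 2 -> c < f b - f a -> 0 < e ->
  exists z p, [/\ frechet_sub f z p, `|z - xb| <= r & c <= p (b - a) + e * `|b - a|].
Proof.
move=> r0 K0 f_lip axb bxb cf e0.
pose P : set R^o := [set` `[0, 1]%R].
pose A (s : R^o) : X := a + s *: (b - a).
pose q (s : R^o) : R := - s * c.
have P01 s : P s -> 0 <= s <= 1 by rewrite /P/= in_itv.
pose e1 := Num.min (Num.min e (r / 2)) ((f b - f a - c) / 2).
have e10 : 0 < e1 by rewrite !lt_min e0 !divr_gt0// subr_gt0.
have e1e : e1 <= e by rewrite /e1 !ge_min lexx.
have e1r : e1 <= r / 2 by rewrite /e1 !ge_min lexx orbT.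
have e1c : e1 <= (f b - f a - c) / 2 by rewrite /e1 !ge_min lexx orbT.
have AP s : P s -> `|A s - xb| <= r / 2.
  move=> /P01/andP[s0 s1]; rewrite /A.
  have -> : a + s *: (b - a) - xb = (1 - s) *: (a - xb) + s *: (b - xb).
    rewrite scalerBl scale1r -[RHS]addrA (addrC (- _)) -scalerBr.
    by rewrite opprB addrA subrK addrAC.
  rewrite (le_trans (ler_normD _ _))// !normrZ (ger0_norm s0) ger0_norm ?subr_ge0//.
  by move: axb bxb; move: `|_| `|_| => u v *; nra.
have P0 : P 0 by rewrite /P/= in_itv/= lexx ler01.
have P1 : P 1 by rewrite /P/= in_itv/= lexx ler01.
have [||||||s [z [p [Ps fp zs smin hp]]]] :=
    @decoupled_sum_rule f xb r K r0 K0 f_lip R^o P A q (ex_intro _ 0 P0) _ _ _ _ _ _ AP e1 e10.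
- exact: segment_compact.
- move=> s v t /P01/andP[s0 s1] /P01/andP[v0 v1] /andP[t0 t1]; rewrite /P/= in_itv/=.
  by rewrite /GRing.scale/=; apply/andP; split; nra.
- move=> s v t _ _ _; rewrite /A opprD addrACA subrr add0r -scalerBl -addrA; congr (_ + _).
  by rewrite scalerA -scalerDl.
- by move=> s v t _ _ _; rewrite /q /GRing.scale/=; lra.
- move=> s; apply: cvgD; first exact: cvg_cst.
  by apply: cvgZr_tmp; exact: cvg_id.
- by move=> s; apply: cvgMr_tmp; apply: cvgN; exact: cvg_id.
have /andP[s0 s1] := P01 _ Ps.
exists z, p; split => //.
  rewrite -[z](subrK (A s)) -addrA (le_trans (ler_normD _ _))// [leRHS]splitr lerD ?AP//.
  exact: le_trans e1r.
have A0 : A 0 = a by rewrite /A scale0r addr0.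
have A1 : A 1 = b by rewrite /A scale1r addrC subrK.
have sn1 : s < 1.
  rewrite lt_neqAle s1 andbT; apply/eqP => sE; have := smin 0 P0.
  by rewrite sE A1 A0 /q; move: cf e1c; lra.
have := hp 1 P1; rewrite A1.
have -> : b - A s = (1 - s) *: (b - a).
  by rewrite /A opprD addrA scalerBl scale1r.
rewrite dual_scale normrZ (ger0_norm (ltW _)) ?subr_gt0//.
have s1' : 0 < 1 - s by rewrite subr_gt0.
have := normr_ge0 (b - a); rewrite /q; move: `|b - a| (p (b - a) : R) => u v u0 h.
rewrite -(ler_pM2l s1'); move: h.
have : (1 - s) * (e1 * u) <= (1 - s) * (e * u) by rewrite ler_pM2l// ler_wpM2r.
rewrite mulrDr (mulrCA e1); move: ((1 - s) * (e1 * u)) => *; lra.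
Qed.

(* Decoupling on the cube spanned by h 0, ..., h n.-1, with the penalty W that keeps
   the minimizer away from the boundary. *)
Lemma dini_frechet_approx (f : X -> R) xb r K (y : dual X) : 0 < r -> 0 <= K ->
  (forall y z, `|y - xb| <= r -> `|z - xb| <= r -> `|f y - f z| <= K * `|y - z|) ->
  (forall h e, 0 < e -> \forall t \near 0^'+, t * (y h - e) <= f (xb + t *: h) - f xb) ->
  forall (h : nat -> X) n e, 0 < e ->
  exists z p, [/\ frechet_sub f z p, `|z - xb| <= e &
    forall i, (i < n)%N -> `|(p (h i) : R) - y (h i)| <= e].
Proof.
move=> r0 K0 f_lip hy h n e e0.
pose L (s : 'rV[R]_n) : X := \sum_(i < n) s ord0 i *: h i.
pose W (s : 'rV[R]_n) : R := \sum_(i < n) `|s ord0 i|.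
pose H : R := \sum_(i < n) `|h i|.
pose P := [set s : 'rV[R]_n | forall i, [set` `[(-1 : R), 1]] (s ord0 i)].
have PE s : P s <-> forall i, `|s ord0 i| <= 1.
  by split=> hs i; have := hs i; rewrite /= in_itv/= ler_norml.
have H0 : 0 <= H by apply: sumr_ge0.
have Hi (i : 'I_n) : `|h i| <= H.
  by rewrite /H (bigD1 i)//= lerDl; apply: sumr_ge0.
have W0 s : 0 <= W s by apply: sumr_ge0.
have coord_cvg (i : 'I_n) (s : 'rV[R]_n) : (fun s : 'rV[R]_n => s ord0 i) @ s --> s ord0 i.
  exact: coord_continuous.
have Lcont : continuous L.
  apply: continuous_big => [|i _ s]; first exact: add_continuous.
  exact: cvgZr_tmp (coord_cvg i s).
have Wcont : continuous W.
  apply: continuous_big => [|i _ s]; first exact: add_continuous.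
  exact: cvg_norm (coord_cvg i s).
have LP s : P s -> `|L s| <= H.
  move=> /PE hs; apply: le_trans (ler_norm_sum _ _ _) _; apply: ler_sum => i _.
  by rewrite normrZ ler_piMl.
have Laff (s v : 'rV[R]_n) t : L (s + t *: (v - s)) = L s + t *: (L v - L s).
  rewrite /L -sumrB scaler_sumr -big_split/=; apply: eq_bigr => i _.
  by rewrite !mxE scalerDl -scalerBl scalerA.
pose k := e / 8; have k0 : 0 < k by rewrite divr_gt0.
have k20 : 0 < k / 2 by rewrite divr_gt0.
have Pc : compact P by apply: (@rV_compact _ _ (fun=> [set` `[(-1 : R), 1]])) => i; exact: segment_compact.
(* Compactness of the cube makes the Dini inequality uniform in the direction, at the price of the
   error [k]. *)
have near_t : \forall t \near (0 : R)^'+, P `<=` (fun s => t * (y (L s) - k) <= f (xb + t *: L s) - f xb).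
  move/compact_near_coveringP : Pc; apply => s Ps.
  have C0 : 0 < K + `|y| + 1 by rewrite ltr_wpDl// addr_ge0.
  pose c := Num.min 1 (k / 2 / (K + `|y| + 1)).
  have c0 : 0 < c by rewrite lt_min ltr01 divr_gt0.
  have H2 : 0 < H + 2 by rewrite ltr_wpDl.
  have /cvgrPdist_le/(_ _ c0) h1 := Lcont s.
  have h2 := hy (L s) _ k20.
  have h3 : \forall t \near 0^'+, 0 < t <= r / (H + 2).
    near=> t; apply/andP; split => //.
    by near: t; apply: nbhs_right_le; rewrite divr_gt0.
  exists ([set s' : 'rV[R]_n | `|L s - L s'| <= c],
    [set t : R | t * (y (L s) - k / 2) <= f (xb + t *: L s) - f xb /\ 0 < t <= r / (H + 2)]).
    by split => //=; exact: filterI.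
  move=> [s' t] /= [hs' [ht /andP[t0 tr]]].
  have tL (u : X) : `|u| <= H + 1 -> `|xb + t *: u - xb| <= r.
    move=> uH; rewrite addrAC subrr add0r normrZ (gtr0_norm t0).
    apply: (@le_trans _ _ (t * (H + 2))); last by rewrite -ler_pdivlMr.
    by rewrite ler_pM2l//; lra.
  have Ls : `|L s| <= H := LP _ Ps.
  have c1 : c <= 1 by rewrite ge_min lexx.
  have Ls' : `|L s'| <= H + 1.
    have -> : L s' = L s - (L s - L s') by rewrite opprB addrC subrK.
    by rewrite (le_trans (ler_normB _ _))// lerD// (le_trans hs').
  have := f_lip (xb + t *: L s) (xb + t *: L s') (tL _ _) (tL _ Ls').
  have Ls1 : `|L s| <= H + 1 by rewrite (le_trans Ls)// lerDl.
  move=> /(_ Ls1); rewrite opprD addrACA subrr add0r -scalerBr normrZ (gtr0_norm t0).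
  rewrite ler_norml => /andP[_ hf].
  have hyL := dual_ub y (L s' - L s); rewrite distrC dual_sub in hyL.
  have hc : (K + `|y| + 1) * `|L s - L s'| <= k / 2.
    by rewrite mulrC -ler_pdivlMr// (le_trans hs')// ge_min lexx orbT.
  have d0 := normr_ge0 (L s - L s').
  have h5 : t * ((K + `|y|) * `|L s - L s'|) <= t * (k / 2).
    by rewrite ler_pM2l//; move: hc; rewrite !mulrDl mul1r; lra.
  have h6 : t * y (L s') <= t * (y (L s) + `|y| * `|L s - L s'|).
    by rewrite ler_pM2l//; move: hyL; move: (_ * `|_|) (y _ : R) (y _ : R) => *; lra.
  move: ht hf h5 h6; rewrite !mulrDl !mulrDr !mulrN [K * (t * _)]mulrCA.
  have -> : t * k = t * (k / 2) + t * (k / 2) by field.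
  move: (t * (k / 2)) (t * y _ : R) (t * y _ : R) (t * (_ * _)) (t * (_ * _)) (f _) (f _) (f _).
  by move=> *; lra.
have [t [t0 tr te ht]] : exists t, [/\ 0 < t, t * (H + 1) <= r / 2, t * (H + 1) <= e / 2 &
    forall s, P s -> t * (y (L s) - k) <= f (xb + t *: L s) - f xb].
  have H1 : 0 < H + 1 by rewrite ltr_wpDl.
  near (0 : R)^'+ => t; exists t; split.
  - by near: t; exact: nbhs_right_gt.
  - by rewrite -ler_pdivlMr//; near: t; apply: nbhs_right_le; rewrite !divr_gt0.
  - by rewrite -ler_pdivlMr//; near: t; apply: nbhs_right_le; rewrite !divr_gt0.
  - by near: t.
(* [q] cancels the linear part [t * y], and the penalty [2 * k * W] outweighs the error [k] well
   before [W] reaches 1. *)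
pose A s := xb + t *: L s; pose q s := t * (2 * k * W s - y (L s)).
have AP s : P s -> `|A s - xb| <= r / 2.
  move=> /LP Ls; rewrite /A addrAC subrr add0r normrZ (gtr0_norm t0) (le_trans _ tr)//.
  by rewrite ler_pM2l// (le_trans Ls)// lerDl.
have P0 : P 0 by apply/PE => i; rewrite mxE normr0.
pose e1 := Num.min (e / 2) (Num.min (k / (H + 1)) (t * k / 2)).
have H1 : 0 < H + 1 by rewrite ltr_wpDl.
have e10 : 0 < e1 by rewrite !lt_min !divr_gt0// mulr_gt0.
have e1e : e1 <= e / 2 by rewrite /e1 !ge_min lexx.
have e1k : e1 * (H + 1) <= k by rewrite -ler_pdivlMr// /e1 !ge_min lexx orbT.
have e1t : e1 <= t * k / 2 by rewrite /e1 !ge_min lexx !orbT.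
have Acont : continuous A.
  move=> s; have FF : Filter (nbhs s) by exact: nbhs_filter.
  have h1 : (fun s => t *: L s) @ s --> t *: L s by exact: cvgZl_tmp (Lcont s).
  apply/cvgrPdist_le => c c0; move/cvgrPdist_le/(_ _ c0): h1; apply: filterS => u.
  by rewrite /A opprD addrACA subrr add0r.
have qcont : continuous q.
  move=> s; have h1 : (fun s => 2 * k * W s) @ s --> 2 * k * W s.
    have Ws : W @ s --> W s := Wcont s.
    by have := cvgMl_tmp Ws; apply.
  have h2 : (fun s => y (L s) : R) @ s --> (y (L s) : R).
    by apply: continuous_comp; [exact: Lcont|exact: dual_continuous].
  have h3 : (fun s => 2 * k * W s - y (L s) : R) @ s --> (2 * k * W s - y (L s) : R).
    exact: cvgB h1 h2.
  by have := cvgMl_tmp h3; apply.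
have Wsub (s v : 'rV[R]_n) c : 0 <= c <= 1 -> W (s + c *: (v - s)) <= W s + c * (W v - W s).
  move=> /andP[c0 c1]; rewrite /W -sumrB mulr_sumr -big_split/=; apply: ler_sum => i _.
  rewrite !mxE; have -> : s ord0 i + c * (v ord0 i - s ord0 i) =
    (1 - c) * s ord0 i + c * v ord0 i by ring.
  rewrite (le_trans (ler_normD _ _))// !normrM (ger0_norm c0) ger0_norm ?subr_ge0//.
  by move: `|_| `|_| => *; lra.
have [||||s [z [p [Ps fp zs smin hp]]]] :=
    @decoupled_sum_rule f xb r K r0 K0 f_lip _ P A q (ex_intro _ 0 P0) Pc _ _ _ _ qcont AP e1 e10.
- move=> s v c /PE hs /PE hv /andP[c0 c1]; apply/PE => i; rewrite !mxE.
  have := hs i; have := hv i; rewrite !ler_norml => /andP[? ?] /andP[? ?].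
  by apply/andP; split; nra.
- by move=> s v c _ _ _; rewrite /A Laff scalerDr -addrA; congr (_ + (_ + _));
    rewrite opprD addrACA subrr add0r -scalerBr !scalerA mulrC.
- move=> s v c _ _ c01; rewrite /q Laff dual_add dual_scale dual_sub.
  have := Wsub s v c c01; move: (W _) (W s) (W v) (y _ : R) (y _ : R) => w ws wv y1 y2 hw.
  have : t * (2 * k) * w <= t * (2 * k) * (ws + c * (wv - ws)).
    by rewrite ler_pM2l// mulr_gt0// mulr_gt0.
  by lra.
- exact: Acont.
have Ws : W s < 1.
  have := smin 0 P0; have := ht s Ps; rewrite /A /q.
  have -> : L 0 = 0 by apply: big1 => i _; rewrite mxE scale0r.
  have -> : W 0 = 0 by apply: big1 => i _; rewrite mxE normr0.
  rewrite scaler0 addr0 dual_zero mulr0 subrr mulr0 addr0.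
  have tk0 : 0 < t * k by rewrite mulr_gt0.
  rewrite !mulrBr; move: (f _) (f xb) (t * y _ : R) e1t => a b c + h1 h2 => h3.
  rewrite -(ltr_pM2l tk0) mulr1.
  have -> : t * k * W s = t * (2 * k * W s) / 2 by field.
  by lra.
exists z, p; split => //.
  rewrite -[z](subrK (A s)) -addrA (le_trans (ler_normD _ _))// [leRHS]splitr lerD//.
    exact: le_trans e1e.
  rewrite /A addrAC subrr add0r normrZ (gtr0_norm t0) (le_trans _ te)//.
  by rewrite ler_pM2l// (le_trans (LP _ Ps))// lerDl.
move=> i lin; pose i0 := Ordinal lin.
have W1 : 0 < 1 - W s by rewrite subr_gt0.
(* A move of length [1 - W s] along one coordinate stays in the cube; the two signs of [c] give the
   two inequalities. *)
have half c : `|c| = 1 - W s -> c * (y (h i) : R) - c * p (h i) <= (1 - W s) * e.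
  move=> cE; pose v : 'rV[R]_n := s + c *: delta_mx ord0 i0.
  have vE j : v ord0 j = s ord0 j + (if j == i0 then c else 0).
    by rewrite !mxE eqxx/=; case: (j == i0); rewrite ?mulr1 ?mulr0.
  have Wv : W v <= W s + `|c|.
    rewrite /W (bigD1 i0)//= [X in _ <= X + _](bigD1 i0)//= vE eqxx.
    have -> : \sum_(j < n | j != i0) `|v ord0 j| = \sum_(j < n | j != i0) `|s ord0 j|.
      by apply: eq_bigr => j /negbTE ji; rewrite vE ji addr0.
    by have := ler_normD (s ord0 i0) c; move: (\sum_(_ < _ | _) _) => ? ?; lra.
  have Wi (u : 'rV[R]_n) j : `|u ord0 j| <= W u.
    by rewrite /W (bigD1 j)//= lerDl; apply: sumr_ge0.
  have Pv : P v by apply/PE => j; rewrite (le_trans (Wi _ _))// (le_trans Wv)// cE addrC subrK.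
  have Lv : L v = L s + c *: h i.
    rewrite /L (bigD1 i0)//= [in RHS](bigD1 i0)//= vE eqxx scalerDl -!addrA; congr (_ + _).
    rewrite addrC; congr (_ + _); apply: eq_bigr => j /negbTE ji.
    by rewrite vE ji addr0.
  have := hp v Pv; have -> : A v - A s = (t * c) *: h i.
    by rewrite /A Lv scalerDr addrA [X in X - _]addrC -addrA subrr addr0 scalerA.
  rewrite dual_scale normrZ normrM (gtr0_norm t0) cE /q Lv dual_add dual_scale.
  have hH : e1 * `|h i| <= k.
    by apply: le_trans e1k; rewrite ler_pM2l// (le_trans (Hi i0))// lerDl.
  have h1 : t * (1 - W s) * (e1 * `|h i|) <= t * (1 - W s) * k.
    by rewrite ler_wpM2l// mulr_ge0// ltW.
  have h2 : t * (2 * k) * W v <= t * (2 * k) * (W s + (1 - W s)).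
    by rewrite -cE ler_pM2l// mulr_gt0// mulr_gt0.
  rewrite [e1 * _]mulrCA => h3; rewrite -(ler_pM2l t0).
  have -> : t * ((1 - W s) * e) = t * (1 - W s) * (8 * k) by rewrite /k; field.
  have tk : 0 <= t * (1 - W s) * k by rewrite !mulr_ge0// ltW.
  move: h1 h2 h3 tk; move: (e1 * `|_|) (W v) (y _ : R) (y _ : R) (p _ : R) (W s) => *.
  by lra.
rewrite ler_norml; apply/andP; split.
  have := half (1 - W s); rewrite (gtr0_norm W1) => /(_ erefl).
  by rewrite -mulrBr ler_pM2l//; move: (y _ : R) (p _ : R) => *; lra.
have := half (- (1 - W s)); rewrite normrN (gtr0_norm W1) => /(_ erefl).
rewrite !mulNr -opprD -mulrBr -mulrN ler_pM2l//.
by move: (y _ : R) (p _ : R) => *; lra.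
Unshelve. all: by end_near.
Qed.

End FuzzyCalculus.

(** * From the extended-real definitions to real difference quotients *)

Lemma wdual_cvgP {R : realType} {X : normedModType R} (F : set_system (dual X)) (xs : dual X) :
  Filter F -> (F --> (xs : wdual X)) <-> forall x, (fun p : dual X => p x : R) @ F --> (xs x : R).
Proof.
move=> FF; pose ev := fun f : dual X => (f : {ptws X -> R^o}).
split=> [cF x|cF].
  have cev : ev @ F --> (ev xs : {ptws X -> R^o}).
    by apply: cvg_trans (@initial_continuous _ _ ev xs); exact: cvg_app.
  have /pointwise_cvgP/(_ x) := cev; exact.
have cev : ev @ F --> (ev xs : {ptws X -> R^o}).
  by apply/pointwise_cvgP => x; exact: cF.
move=> A; rewrite nbhsE => -[B [[C Cop <-] /= Cxs] sBA].
apply: (filterS sBA); apply: (cev C).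
by apply: open_nbhs_nbhs.
Qed.

Lemma limf_einf_ge0P {R : realType} {T : topologicalType} (g : T -> \bar R) (F : set_system T) :
  Filter F -> (0 <= limf_einf g F)%E <->
  (forall e : R, 0 < e -> F [set y | ((- e)%:E <= g y)%E]).
Proof.
move=> FF; rewrite limf_einfE; split=> [h e e0|h].
  have : ((- e)%:E < ereal_sup [set ereal_inf (g @` V) | V in F])%E.
    by apply: lt_le_trans h; rewrite lte_fin oppr_lt0.
  move=> /ereal_sup_gt[_ [V FV <-]] /ltW hV; apply: filterS FV => y Vy /=.
  by apply: le_trans hV _; apply: ereal_inf_lbound; exists y.
apply/lee_addgt0Pr => e e0; rewrite -leeBlDr// sub0e.
apply: le_trans (ereal_sup_ubound _); last by exists [set y | ((- e)%:E <= g y)%E]; [exact: h|].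
by apply: le_ereal_inf_tmp => _ [y /= hy <-].
Qed.

(** The infimum of these [c], taken in [clarke_dir], is an upper limit of quotients. Working with
    the bounds themselves avoids the extended reals and the product filter of
    [clarke_derivative]. *)
Definition clarke_le {R : realType} {X : normedModType R} (f : X -> R) xb h c :=
  exists2 d, 0 < d & forall x t, `|x - xb| < d -> 0 < t < d -> f (x + t *: h) - f x <= c * t.

Definition clarke_dir {R : realType} {X : normedModType R} (f : X -> R) xb h :=
  inf [set c | clarke_le f xb h c].

Section Bridge.
Context {R : realType} {X : normedModType R}.
Variables (phi : X -> \bar R) (xb : X) (r K : R).
Hypotheses (r0 : 0 < r) (K0 : 0 <= K)
  (phi_fin : forall x, `|x - xb| <= r -> phi x \is a fin_num).
Let f x := fine (phi x).
Hypothesis f_lip : forall x y, `|x - xb| <= r -> `|y - xb| <= r -> `|f x - f y| <= K * `|x - y|.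

Let phiE x : `|x - xb| <= r -> phi x = (f x)%:E.
Proof. by move=> /phi_fin h; rewrite /f fineK. Qed.

Lemma frechet_subgradientP z p : `|z - xb| < r -> frechet_subgradient phi z p <-> frechet_sub f z p.
Proof.
move=> zr; pose d := r - `|z - xb|; have d0 : 0 < d by rewrite subr_gt0.
have near_r y : `|y - z| <= d -> `|y - xb| <= r.
  move=> yd; rewrite -[y](subrK z) -addrA (le_trans (ler_normD _ _))//.
  by rewrite -(subrK `|z - xb| r) lerD2r.
have quotE y : `|y - z| <= d -> y != z -> forall e : R,
    ((- e)%:E <= (phi y - phi z - (p (y - z)%R)%:E) * (`|y - z|^-1)%:E)%E =
    (f z + p (y - z) <= f y + e * `|y - z|).
  move=> yd yz e; have n0 : 0 < `|y - z| by rewrite normr_gt0 subr_eq0.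
  rewrite (phiE (near_r _ yd)) (phiE (ltW zr)) -!EFinB -EFinM lee_fin.
  rewrite ler_pdivlMr// mulNr; move: (p _ : R) (f z) (f y) (e * _) => *.
  by apply/idP/idP; lra.
rewrite /frechet_subgradient limf_einf_ge0P; split=> [h e e0|h e e0].
  have /nbhs_ballP[q /= q0 hq] := h e e0.
  exists (Num.min (q / 2) d); first by rewrite lt_min d0 divr_gt0.
  move=> y; rewrite le_min => /andP[yq yd].
  have [->|yz] := eqVneq y z; first by rewrite subrr dual_zero normr0 mulr0 !addr0.
  rewrite -quotE//; apply: hq => //; rewrite -ball_normE/= distrC (le_lt_trans yq)//.
  by rewrite ltr_pdivrMr// mulr_natr mulr2n ltrDl.
have [q q0 hq] := h e e0; apply/nbhs_ballP; exists (Num.min q d) => /=.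
  by rewrite lt_min q0 d0.
move=> y; rewrite -ball_normE/= lt_min distrC => /andP[yq yd] yz.
by rewrite /= (quotE y (ltW yd) yz e) hq// ltW.
Qed.

Let near_in h : exists2 d, 0 < d & forall x t, `|x - xb| < d -> 0 < t < d ->
  `|x - xb| <= r /\ `|x + t *: h - xb| <= r.
Proof.
have h1 : 0 < `|h| + 1 by rewrite ltr_wpDl.
exists (r / (2 * (`|h| + 1))); first by rewrite divr_gt0// mulr_gt0.
move=> x t; rewrite !ltr_pdivlMr ?mulr_gt0// => xr /andP[t0 tr].
have n0 := normr_ge0 (x - xb); have n1 := normr_ge0 h; split; first by nra.
rewrite addrAC (le_trans (ler_normD _ _))// normrZ (gtr0_norm t0).
by move: `|x - xb| `|h| xr tr n0 n1 => a b *; nra.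
Qed.

Lemma clarke_le_derivative h c : clarke_le f xb h c -> (clarke_derivative phi xb h <= c%:E)%E.
Proof.
move=> [d d0 hd]; have [d' d'0 hd'] := near_in h.
rewrite /clarke_derivative limf_esupE.
apply: (@le_trans _ _ (ereal_sup ((fun p : X * R =>
   ((phi (p.1 + p.2 *: h)%R - phi p.1) * (p.2^-1)%:E)%E) @`
   [set p | `|p.1 - xb| < Num.min d d' /\ 0 < p.2 < Num.min d d']))).
  apply: ereal_inf_lbound.
  exists [set p | `|p.1 - xb| < Num.min d d' /\ 0 < p.2 < Num.min d d'] => //.
  exists ([set x | `|x - xb| < Num.min d d'], [set t | 0 < t < Num.min d d']) => //.
  split => /=.
    apply/nbhs_ballP; exists (Num.min d d') => /=; first by rewrite lt_min d0.
    by move=> y; rewrite -ball_normE/= distrC.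
  apply/nbhs_ballP; exists (Num.min d d') => /=; first by rewrite lt_min d0.
  move=> y; rewrite -ball_normE/= sub0r normrN => yd y0; rewrite y0/=.
  by rewrite gtr0_norm// in yd.
apply: ge_ereal_sup => _ [[x t] /= [xd /andP[t0 td]] <-].
move: xd td; rewrite !lt_min => /andP[x1 x2] /andP[t1 t2].
have [|h1 h2] := hd' x t x2; first by rewrite t0.
rewrite (phiE h1) (phiE h2) -EFinB -EFinM lee_fin ler_pdivrMr//.
by apply: hd => //; rewrite t0.
Qed.

Lemma clarke_derivative_lt h c : (clarke_derivative phi xb h < c%:E)%E -> clarke_le f xb h c.
Proof.
rewrite /clarke_derivative limf_esupE => /ereal_inf_lt[_ [V [[A B] /= [nA nB] sAB] <-]] hV.
have [d' d'0 hd'] := near_in h.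
have /nbhs_ballP[dA /= dA0 hA] := nA; have /nbhs_ballP[dB /= dB0 hB] := nB.
exists (Num.min d' (Num.min dA dB)); first by rewrite !lt_min d'0 dA0.
move=> x t; rewrite !lt_min => /and3P[x1 x2 _] /and4P[t0 t1 _ t2].
have [|h1 h2] := hd' x t x1; first by rewrite t0.
have : (((phi (x + t *: h)%R - phi x) * (t^-1)%:E)%E <= c%:E)%E.
  apply: le_trans (ltW hV); apply: ereal_sup_ubound; exists (x, t) => //.
  apply: sAB; split => /=; first by apply: hA; rewrite -ball_normE/= distrC.
  by apply: hB => //; rewrite -ball_normE/= sub0r normrN gtr0_norm.
by rewrite (phiE h1) (phiE h2) -EFinB -EFinM lee_fin ler_pdivrMr.
Qed.

Let clarke_le_lip h : clarke_le f xb h (K * `|h|).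
Proof.
have [d d0 hd] := near_in h; exists d => // x t xd td; have [h1 h2] := hd x t xd td.
have /andP[t0 _] := td; rewrite (le_trans (ler_norm _))// (le_trans (f_lip h2 h1))//.
by rewrite addrAC subrr add0r normrZ (gtr0_norm t0) mulrA mulrAC lexx.
Qed.

Let clarke_le_lb h c : clarke_le f xb h c -> - (K * `|h|) <= c.
Proof.
move=> [d d0 hd]; have [d' d'0 hd'] := near_in h.
pose t := Num.min d d' / 2.
have t0 : 0 < t by rewrite divr_gt0// lt_min d0.
have tm : t < Num.min d d' by rewrite ltr_pdivrMr// mulr_natr mulr2n ltrDl lt_min d0.
move: tm; rewrite lt_min => /andP[td td'].
have [||h1 h2] := hd' xb t; first by rewrite subrr normr0.
  by rewrite t0.
have := hd xb t; rewrite subrr normr0 t0 => /(_ d0 td).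
have := f_lip h2 h1; rewrite addrAC subrr add0r normrZ (gtr0_norm t0) ler_norml.
move=> /andP[lo _] hi; rewrite -(ler_pM2r t0); move: (le_trans lo hi).
by rewrite mulNr mulrCA mulrC.
Qed.

Let has_inf_clarke h : has_inf [set c | clarke_le f xb h c].
Proof.
by split; [exists (K * `|h|); exact: clarke_le_lip|exists (- (K * `|h|)) => c /clarke_le_lb].
Qed.

Lemma clarke_dir_le h c : clarke_le f xb h c -> clarke_dir f xb h <= c.
Proof. by move=> hc; apply: ge_inf => //; case: (has_inf_clarke h). Qed.

Lemma clarke_dir_lt h c : clarke_dir f xb h < c -> clarke_le f xb h c.
Proof.
rewrite -subr_gt0 => c0.
have [c' hc' lt] := inf_adherent c0 (has_inf_clarke h).
move: lt; rewrite addrC subrK => lt; have [d d0 hd] := hc'.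
exists d => // x t xd td; rewrite (le_trans (hd x t xd td))// ler_wpM2r ?ltW//.
by have /andP[] := td.
Qed.

Lemma clarke_derivativeE h : clarke_derivative phi xb h = (clarke_dir f xb h)%:E.
Proof.
apply/le_anti/andP; split.
  apply/lee_addgt0Pr => e e0; rewrite -EFinD; apply: clarke_le_derivative.
  by apply: clarke_dir_lt; rewrite ltrDl.
rewrite leNgt; apply/negP => lt.
have [c c1 c2] : exists2 c, (clarke_derivative phi xb h < c%:E)%E & c < clarke_dir f xb h.
  move: lt; case: (clarke_derivative phi xb h) => [q||] lt //.
    rewrite lte_fin in lt; exists ((q + clarke_dir f xb h) / 2); last by lra.
    by rewrite lte_fin; lra.
  by exists (clarke_dir f xb h - 1); [exact: ltNyr|lra].
have := clarke_dir_le (clarke_derivative_lt c1).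
by rewrite leNgt c2.
Qed.

(** Subadditivity rests on the moving base point: the increment along [h + k] is the one along [h]
    from [x] plus the one along [k] from [x + t *: h]. The radius [d2 / (2 * (|h| + 1))] keeps the
    latter point within [d2] of [xb]. *)
Lemma sublinear_clarke_dir : sublinear K (clarke_dir f xb).
Proof.
have sD h k : clarke_dir f xb (h + k) <= clarke_dir f xb h + clarke_dir f xb k.
  apply/ler_addgt0Pl => e e0; have e2 : 0 < e / 2 by rewrite divr_gt0.
  have [d1 d10 h1] : clarke_le f xb h (clarke_dir f xb h + e / 2).
    by apply: clarke_dir_lt; rewrite ltrDl.
  have [d2 d20 h2] : clarke_le f xb k (clarke_dir f xb k + e / 2).
    by apply: clarke_dir_lt; rewrite ltrDl.
  have -> : e + (clarke_dir f xb h + clarke_dir f xb k) =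
    (clarke_dir f xb h + e / 2) + (clarke_dir f xb k + e / 2) by field.
  apply: clarke_dir_le; have n0 : 0 < `|h| + 1 by rewrite ltr_wpDl.
  exists (Num.min d1 (d2 / (2 * (`|h| + 1)))).
    by rewrite lt_min d10 divr_gt0// mulr_gt0.
  move=> x t; rewrite !lt_min !ltr_pdivlMr ?mulr_gt0// => /andP[x1 x2] /and3P[t0 t1 t2].
  have n1 := normr_ge0 (x - xb); have n2 := normr_ge0 h.
  have := h1 x t x1; rewrite t0 t1 => /(_ isT) H'.
  rewrite scalerDr addrA mulrDl.
  have : f (x + t *: h + t *: k) - f (x + t *: h) <= (clarke_dir f xb k + e / 2) * t.
    apply: h2; last by rewrite t0/=; nra.
    rewrite addrAC (le_lt_trans (ler_normD _ _))// normrZ (gtr0_norm t0).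
    by move: `|x - xb| `|h| x2 t2 n1 n2 => *; nra.
  by move: H'; lra.
split => //; last by move=> h; apply: clarke_dir_le.
have h s h : 0 < s -> clarke_dir f xb (s *: h) <= s * clarke_dir f xb h.
  move=> s0; rewrite -ler_pdivrMl//; apply: lb_le_inf; first by case: (has_inf_clarke h).
  move=> c [d d0 hd]; rewrite ler_pdivrMl//; apply: clarke_dir_le.
  exists (Num.min d (d / s)); first by rewrite lt_min d0 divr_gt0.
  move=> x t; rewrite !lt_min => /andP[x1 _] /and3P[t0 _ t1].
  have t1' : t * s < d by rewrite -ltr_pdivlMr.
  by have := hd x (t * s) x1; rewrite t1' mulr_gt0// scalerA [s * c]mulrC -mulrA (mulrC s); apply.
move=> s k; rewrite le_eqVlt => /orP[/eqP <-|s0].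
  rewrite scale0r mul0r; apply/le_anti/andP; split.
    by apply: clarke_dir_le; exists 1 => // x t _ _; rewrite scaler0 addr0 subrr mul0r.
  apply: lb_le_inf; first by case: (has_inf_clarke 0).
  by move=> c /clarke_le_lb; rewrite normr0 mulr0 oppr0.
apply/le_anti; rewrite h//= -ler_pdivlMl//.
apply: le_trans (h _ _ _); last by rewrite invr_gt0.
by rewrite scalerA mulVf ?gt_eqF// scale1r.
Qed.

Lemma generalized_gradientE : generalized_gradient phi xb =
  [set p | forall h, p h <= clarke_dir f xb h].
Proof.
by apply/seteqP; split => p /= hp h; have := hp h; rewrite clarke_derivativeE lee_fin.
Qed.

Lemma frechet_sub_bound z p : `|z - xb| < r -> frechet_sub f z p -> `|p| <= K.
Proof.
move=> zr; have d0 : 0 < r - `|z - xb| by rewrite subr_gt0.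
apply: (frechet_sub_norm_le d0 K0) => y yz; rewrite (le_trans (ler_norm _))// f_lip//; last exact: ltW.
rewrite -[y](subrK z) -addrA (le_trans (ler_normD _ _))//.
by rewrite -(subrK `|z - xb| r) lerD2r.
Qed.

Lemma frechet_sub_quotient z p h e : frechet_sub f z p -> 0 < e ->
  forall d, 0 < d -> exists2 t, 0 < t < d & (p h - e) * t <= f (z + t *: h) - f z.
Proof.
move=> fp e0 d d0; have n0 : 0 < `|h| + 1 by rewrite ltr_wpDl.
have [q q0 hq] := fp _ (divr_gt0 e0 n0).
pose t := Num.min d (q / (`|h| + 1)) / 2.
have m0 : 0 < Num.min d (q / (`|h| + 1)) by rewrite lt_min d0 divr_gt0.
have t0 : 0 < t by rewrite divr_gt0.
have : t < Num.min d (q / (`|h| + 1)) by rewrite ltr_pdivrMr// mulr_natr mulr2n ltrDl.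
rewrite lt_min ltr_pdivlMr// => /andP[td tq].
exists t; first by rewrite t0.
have := hq (z + t *: h); rewrite addrAC subrr add0r normrZ (gtr0_norm t0) dual_scale.
have h1 : t * `|h| <= q by rewrite (le_trans _ (ltW tq))// ler_pM2l// lerDl.
move=> /(_ h1).
have : e / (`|h| + 1) * (t * `|h|) <= e * t.
  have -> : e / (`|h| + 1) * (t * `|h|) = e * t * (`|h| / (`|h| + 1)).
    by field; rewrite gt_eqF.
  by rewrite ler_piMr ?(mulr_ge0 (ltW e0) (ltW t0))// ler_pdivrMr// mul1r lerDl.
by move: (e / (`|h| + 1) * (t * `|h|)) (p h : R) (f _) (f z) => *; lra.
Qed.

(** For upper estimates a limiting subgradient acts through difference quotients at points
    arbitrarily close to [xb], which are almost as large as [xs h]. *)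
Lemma limiting_quotient xs h e d : limiting_subdifferential phi xb xs -> 0 < e -> 0 < d ->
  exists z t, [/\ `|z - xb| < d, 0 < t < d & (xs h - e) * t <= f (z + t *: h) - f z].
Proof.
move=> [u [us [ux usx hu]]] e0 d0.
have e2 : 0 < e / 2 by rewrite divr_gt0.
have m0 : 0 < Num.min d r by rewrite lt_min d0.
have /cvgrPdist_lt/(_ _ m0) h1 := ux.
have /wdual_cvgP/(_ h)/cvgrPdist_le/(_ _ e2) h2 := usx.
near \oo => k.
have : `|xb - u k| < Num.min d r by near: k.
rewrite distrC lt_min => /andP[uk1 uk2].
have h3 : `|(xs h : R) - us k h| <= e / 2 by near: k.
have /frechet_subgradientP - /(_ uk2) fk := hu k.
have [t td ht] := frechet_sub_quotient h fk e2 d0.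
exists (u k), t; split => //; apply: le_trans ht.
rewrite ler_wpM2r//; first by have /andP[/ltW] := td.
by move: h3; rewrite ler_norml => /andP[_]; move: (xs h : R) (us k h : R) => *; lra.
Unshelve. all: by end_near.
Qed.

Lemma limiting_sub_generalized : limiting_subdifferential phi xb `<=` generalized_gradient phi xb.
Proof.
rewrite generalized_gradientE => xs hxs h /=; apply/ler_addgt0Pl => e e0.
have e2 : 0 < e / 2 by rewrite divr_gt0.
have [d d0 hd] : clarke_le f xb h (clarke_dir f xb h + e / 2).
  by apply: clarke_dir_lt; rewrite ltrDl.
have [z [t [zd td ht]]] := limiting_quotient h hxs e2 d0.
have /andP[t0 _] := td.
have := le_trans ht (hd _ _ zd td); rewrite ler_pM2r//.
by move: (xs h : R) (clarke_dir _ _ _) => *; lra.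
Qed.

Variable x : nat -> X.
Hypothesis dx : dense_seq x.

(** Fitting one more [x i] at each step gives a sequence of Frechet subgradients; the bound [K] on
    their norms upgrades convergence on the dense sequence to weak-star convergence. *)
Lemma limiting_of_approx (y : dual X) :
  (forall n e, 0 < e -> exists z p, [/\ frechet_sub f z p, `|z - xb| <= e &
     forall i, (i < n)%N -> `|(p (x i) : R) - y (x i)| <= e]) ->
  limiting_subdifferential phi xb y.
Proof.
move=> hy; pose e k := Num.min (r / 2) k.+1%:R^-1.
have e0 k : 0 < e k by rewrite lt_min divr_gt0//= invr_gt0.
have /choice[zp hzp] : forall k, exists zp : X * dual X, [/\ frechet_sub f zp.1 zp.2,
    `|zp.1 - xb| <= e k & forall i, (i < k)%N -> `|(zp.2 (x i) : R) - y (x i)| <= e k].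
  by move=> k; have [z [p h]] := hy k _ (e0 k); exists (z, p).
have zr k : `|(zp k).1 - xb| < r.
  have [_ h _] := hzp k; rewrite (le_lt_trans h)// /e gt_min ltr_pdivrMr//.
  by rewrite mulr_natr mulr2n ltrDl r0.
have ek k : e k <= k.+1%:R^-1 by rewrite ge_min lexx orbT.
have bound k : `|(zp k).2| <= K by have [h _ _] := hzp k; exact: frechet_sub_bound h.
have small c : 0 < c -> \forall k \near \oo, e k <= c.
  move=> c0; have /cvgrPdist_lt/(_ _ c0) := @cvg_harmonic R; apply: filterS => k.
  by rewrite sub0r normrN ger0_norm ?invr_ge0// => h; rewrite (le_trans (ek k))// ltW.
exists (fun k => (zp k).1), (fun k => (zp k).2); split.
- apply/cvgrPdist_le => c c0; apply: filterS (small c c0) => k h.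
  by rewrite distrC; have [_ h1 _] := hzp k; exact: le_trans h.
- apply/wdual_cvgP => u; apply/cvgrPdist_le => c c0.
  have : \forall k \near \oo, `|((zp k).2 u : R) - y u| <= c.
    apply: (unit_seq_near dx (M := K)) => //; first exact: nearW.
    move=> n d d0; near=> k.
    have [_ _ /(_ n)] := hzp k.
    have nk : (n < k)%N by near: k; exact: nbhs_infty_gt.
    move=> /(_ nk); have -> : (zp k).2 (unit_seq x n) - y (unit_seq x n) =
        (1 + `|x n|)^-1 * ((zp k).2 (x n) - y (x n)) by rewrite !dual_scale mulrBr.
    rewrite normrM => h; apply: (@le_trans _ _ (1 * e k)).
      apply: ler_pM => //; rewrite ger0_norm ?invr_ge0 ?addr_ge0// invf_le1 ?ltr_pwDl//.
      by rewrite lerDl.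
    by rewrite mul1r; near: k; exact: small.
  by apply: filterS => k; rewrite distrC.
- by move=> k; apply/frechet_subgradientP => //; have [] := hzp k.
Unshelve. all: by end_near.
Qed.

End Bridge.

(** * Extreme minorants of the Clarke derivative as limiting subgradients *)

Section AsplundSubdifferentials.
Context {R : realType} {X : completeNormedModType R}.
Hypotheses (X_separable : separable X) (X_asplund : asplund X).
Variables (phi : X -> \bar R) (xb : X) (r K : R).
Hypotheses (r0 : 0 < r) (K0 : 0 <= K)
  (phi_fin : forall x, `|x - xb| <= r -> phi x \is a fin_num).
Let f x := fine (phi x).
Hypothesis f_lip : forall x y, `|x - xb| <= r -> `|y - xb| <= r -> `|f x - f y| <= K * `|x - y|.

(** Milman's theorem is applied to the Frechet subgradients at points within [rn n] of [xb]. The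
    mean value inequality shows that their support functions are never below the Clarke derivative,
    and the difference quotients show that they exceed it by nothing in the limit. *)
Lemma limiting_extreme e :
  extreme_minorant (clarke_dir f xb) e -> limiting_subdifferential phi xb e.
Proof.
move=> ex; have [x dx] := separable_dense_seq X_separable.
(* [n.+2] keeps every radius strictly below [r], where the subgradients are bounded by [K]. *)
pose rn (n : nat) := r / n.+2%:R.
have rn0 n : 0 < rn n by rewrite divr_gt0.
have rnr n : rn n < r by rewrite /rn ltr_pdivrMr// ltr_pMr// ltr1n.
have rn_le n m : (n <= m)%N -> rn m <= rn n.
  by move=> nm; rewrite ler_pM2l// lef_pV2 ?posrE// ler_nat !ltnS.
pose D n := [set p : dual X | exists2 z, `|z - xb| <= rn n & frechet_sub f z p].
have f_lipn n y z : `|y - xb| <= rn n -> `|z - xb| <= rn n -> `|f y - f z| <= K * `|y - z|.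
  by move=> h1 h2; apply: f_lip; [apply: le_trans h1 _|apply: le_trans h2 _]; exact: ltW.
apply: (limiting_of_approx r0 K0 phi_fin f_lip dx) => n e1 e10.
have [m rm] : exists m, rn m <= e1.
  have [m hm] : exists m : nat, r / e1 <= m%:R.
    by exists (Num.bound (r / e1)); apply/ltW/archi_boundP; rewrite divr_ge0 ?(ltW r0) ?(ltW e10).
  exists m; rewrite /rn ler_pdivrMr// mulrC -ler_pdivrMr// (le_trans hm)// ler_nat.
  by rewrite -addn2 leq_addr.
have [||||p [z zm fp] hp] := extreme_minorant_approx dx (M := K) (D := D) _ _ _ _ ex n m e10.
- move=> k p [z zr fp]; apply: (frechet_sub_bound K0 f_lip _ fp).
  exact: le_lt_trans zr (rnr k).
- by move=> k k' p kk' [z zr fp]; exists z => //; rewrite (le_trans zr)// rn_le.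
(* A quotient above [c + q] would produce, by the mean value inequality, a subgradient with
   [p h > c]. The factor 4 keeps both end points within [rn k / 2]. *)
- move=> h c [k hk]; apply/ler_addgt0Pl => q q0; rewrite addrC.
  apply: (clarke_dir_le r0 f_lip).
  have n0 : 0 < `|h| + 1 by rewrite ltr_wpDl.
  exists (rn k / (4 * (`|h| + 1))); first by rewrite divr_gt0// mulr_gt0.
  move=> y t; rewrite ltr_pdivlMr ?mulr_gt0// => yk /andP[t0].
  rewrite ltr_pdivlMr ?mulr_gt0// => tk.
  rewrite leNgt; apply/negP => lt.
  have n1 := normr_ge0 (y - xb); have n2 := normr_ge0 h.
  have y1 : `|y - xb| <= rn k / 2.
    by have := rn0 k; have := mulr_ge0 n1 n2; move: `|y - xb| `|h| (rn k) yk n1 n2 => a b *; lra.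
  have y2 : `|y + t *: h - xb| <= rn k / 2.
    rewrite addrAC (le_trans (ler_normD _ _))// normrZ (gtr0_norm t0).
    by have := rn0 k; have := mulr_ge0 n1 n2; move: `|y - xb| `|h| (rn k) yk tk n1 n2 => a b *; lra.
  have q2 : 0 < q / (2 * (`|h| + 1)) by rewrite divr_gt0// mulr_gt0.
  have [z [p [fp zk]]] := mean_value_frechet X_separable X_asplund (rn0 k) K0 (@f_lipn k)
    y1 y2 lt q2.
  rewrite addrAC subrr add0r dual_scale normrZ (gtr0_norm t0) [_ * (t * _)]mulrCA -mulrDr.
  rewrite [_ * t]mulrC ler_pM2l//; apply/negP; rewrite -ltNge.
  have pc : p h <= c by apply: hk; exists z.
  have : q / (2 * (`|h| + 1)) * `|h| <= q / 2.
    have -> : q / (2 * (`|h| + 1)) * `|h| = q / 2 * (`|h| / (`|h| + 1)).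
      by field; rewrite gt_eqF.
    by rewrite ler_piMr ?(ltW (divr_gt0 q0 _))// ler_pdivrMr// mul1r lerDl.
  by move: (_ * `|h|) (p h : R) pc => *; lra.
- move=> h c /(clarke_dir_lt r0 f_lip)[d d0 hd].
  have [k hk] : exists k, rn k < d.
    have [m' hm] : exists m : nat, r / d <= m%:R.
      by exists (Num.bound (r / d)); apply/ltW/archi_boundP; rewrite divr_ge0 ?(ltW r0) ?(ltW d0).
    exists m'; rewrite /rn ltr_pdivrMr// mulrC -ltr_pdivrMr// (le_lt_trans hm)// ltr_nat.
    by rewrite ltnS leqnSn.
  exists k => p [z zk fp]; apply/ler_addgt0Pl => q q0.
  have [t td ht] := frechet_sub_quotient h fp q0 d0.
  have := le_trans ht (hd z t (le_lt_trans zk hk) td).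
  have /andP[t0 _] := td; rewrite ler_pM2r//.
  by move: (p h : R) => *; lra.
by exists z, p; split => //; rewrite (le_trans zm).
Qed.

Lemma limiting_dini (y : dual X) :
  (forall h e, 0 < e -> \forall t \near 0^'+, t * (y h - e) <= f (xb + t *: h) - f xb) ->
  limiting_subdifferential phi xb y.
Proof.
move=> hy; have [x dx] := separable_dense_seq X_separable.
apply: (limiting_of_approx r0 K0 phi_fin f_lip dx) => n e e0.
exact: (dini_frechet_approx X_separable X_asplund r0 K0 f_lip hy).
Qed.

(** Every value of the Clarke derivative is attained by an extreme minorant. This is how
    measurability of the support function of the subdifferential passes to the Clarke derivative. *)
Lemma support_fun_limiting h :
  support_fun h (limiting_subdifferential phi xb) = (clarke_dir f xb h)%:E.
Proof.
have [x dx] := separable_dense_seq X_separable.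
have ss := sublinear_clarke_dir r0 f_lip.
apply/le_anti/andP; split.
  apply: ge_ereal_sup => _ [p hp <-]; rewrite lee_fin.
  have := limiting_sub_generalized r0 phi_fin f_lip hp.
  by rewrite (generalized_gradientE r0 phi_fin f_lip); apply.
have [e ex eh] := hahn_banach_extreme h dx ss.
by apply: ereal_sup_ubound; exists e; [exact: limiting_extreme|rewrite eh].
Qed.

End AsplundSubdifferentials.

(** * Semi-inner products: greedy sequences, minimization and projection *)

Section PreHilbert.
Context {R : realType} {V : lmodType R}.
Variables (S : set V) (ip : V -> V -> R).
Hypotheses (S0 : S 0) (SD : forall u v, S u -> S v -> S (u + v))
  (SZ : forall a u, S u -> S (a *: u))
  (ipC : forall u v, ip u v = ip v u)
  (ipDl : forall u v w, S u -> S v -> S w -> ip (u + v) w = ip u w + ip v w)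
  (ipZl : forall a u v, S u -> S v -> ip (a *: u) v = a * ip u v)
  (ip_ge0 : forall u, S u -> 0 <= ip u u).

Local Notation N u := (ip u u).

Let SN u : S u -> S (- u). Proof. by rewrite -scaleN1r; exact: SZ. Qed.
Let SB u v : S u -> S v -> S (u - v). Proof. by move=> Su /SN; exact: SD. Qed.

Let ipNl u v : S u -> S v -> ip (- u) v = - ip u v.
Proof. by move=> Su Sv; rewrite -scaleN1r ipZl// mulN1r. Qed.

Let ip0l v : S v -> ip 0 v = 0.
Proof. by move=> Sv; rewrite -(scale0r (0 : V)) ipZl// mul0r. Qed.

Let ipDr u v w : S u -> S v -> S w -> ip w (u + v) = ip w u + ip w v.
Proof. by move=> Su Sv Sw; rewrite ipC ipDl// !(ipC w). Qed.

Let ipZr a u v : S u -> S v -> ip v (a *: u) = a * ip v u.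
Proof. by move=> Su Sv; rewrite ipC ipZl// ipC. Qed.

Let ipBl u v w : S u -> S v -> S w -> ip (u - v) w = ip u w - ip v w.
Proof. by move=> Su Sv Sw; rewrite ipDl ?ipNl//; exact: SN. Qed.

Let ipBr u v w : S u -> S v -> S w -> ip w (u - v) = ip w u - ip w v.
Proof. by move=> Su Sv Sw; rewrite ipC ipBl// !(ipC w). Qed.

Let ND u v : S u -> S v -> N (u + v) = N u + 2 * ip u v + N v.
Proof.
move=> Su Sv; have Suv := SD Su Sv.
by rewrite ipDl// !ipDr// (ipC v u); ring.
Qed.

Let NB u v : S u -> S v -> N (u - v) = N u - 2 * ip u v + N v.
Proof.
move=> Su Sv; have Suv := SB Su Sv.
by rewrite ipBl// !ipBr// (ipC v u); ring.
Qed.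

Lemma parallelogram u v : S u -> S v -> N (u + v) + N (u - v) = 2 * N u + 2 * N v.
Proof. by move=> Su Sv; rewrite ND// NB//; ring. Qed.

Lemma cauchy_schwarz u v : S u -> S v -> ip u v ^+ 2 <= N u * N v.
Proof.
move=> Su Sv.
have h t : 0 <= N u - 2 * t * ip u v + t ^+ 2 * N v.
  have := ip_ge0 (SB Su (SZ t Sv)); rewrite NB ?ipZr ?ipZl//; try exact: SZ.
  by move: (ip u u) (ip u v) (ip v v) => a b c; rewrite expr2; lra.
have Nu := ip_ge0 Su; have Nv := ip_ge0 Sv.
have [Nv0|Nv0] := eqVneq (N v) 0.
  rewrite Nv0 mulr0; have [->|i0] := eqVneq (ip u v) 0; first by rewrite expr0n.
  (* The quadratic is now affine in [t], and this [t] would make it equal to -1. *)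
  have := h ((N u + 1) / (2 * ip u v)); rewrite Nv0 mulr0 addr0.
  have -> : 2 * ((N u + 1) / (2 * ip u v)) * ip u v = N u + 1 by field.
  by move: (N u) => ?; lra.
have := h (ip u v / N v).
have -> : N u - 2 * (ip u v / N v) * ip u v + (ip u v / N v) ^+ 2 * N v =
  (N u * N v - ip u v ^+ 2) / N v by field.
by rewrite pmulr_lge0 ?invr_gt0 ?lt_neqAle ?Nv ?andbT 1?eq_sym// subr_ge0.
Qed.

Definition norm_cvg (F : nat -> V) f :=
  forall e, 0 < e -> \forall k \near \oo, N (F k - f) <= e.

(** Limits of Cauchy sequences of [A] are sought in a possibly different set [C], because a
    countable approximating family is not complete itself. The form may vanish on nonzero vectors,
    so limits are not unique. *)
Definition norm_complete (A C : set V) := forall F : nat -> V, (forall k, A (F k)) ->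
  (forall e, 0 < e -> exists K, forall j k, (K <= j)%N -> (K <= k)%N -> N (F j - F k) <= e) ->
  exists2 f, C f & norm_cvg F f.

Let harmonic_small (e : R) : 0 < e -> exists K, forall k, (K <= k)%N -> k.+1%:R^-1 <= e.
Proof.
move=> e0; have /cvgrPdist_lt/(_ _ e0)[K _ hK] := @cvg_harmonic R.
exists K => k Kk; have := hK k Kk; rewrite sub0r normrN ger0_norm ?invr_ge0//.
exact: ltW.
Qed.

Let ip_lim F f u w c : S u -> S f -> S w -> (forall k, S (F k)) -> norm_cvg F f ->
  (forall e, 0 < e -> \forall k \near \oo, ip (u - F k) w <= c + e) -> ip (u - f) w <= c.
Proof.
move=> Su Sf Sw SF Ff h; apply/ler_addgt0Pr => e e0.
have e2 : 0 < e / 2 by rewrite divr_gt0.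
have Nw1 : 0 < N w + 1 by rewrite ltr_wpDl// ip_ge0.
have d0 : 0 < (e / 2) ^+ 2 / (N w + 1) by rewrite divr_gt0// exprn_gt0.
have h1 := h _ e2; have h2 := Ff _ d0.
near \oo => k.
have k1 : ip (u - F k) w <= c + e / 2 by near: k.
have k2 : N (F k - f) <= (e / 2) ^+ 2 / (N w + 1) by near: k.
have k3 := cauchy_schwarz (SB (SF k) Sf) Sw.
have k4 : `|ip (F k - f) w| <= e / 2.
  rewrite -ler_sqr ?nnegrE ?(ltW e2)// real_normK ?num_real// (le_trans k3)//.
  apply: (@le_trans _ _ ((e / 2) ^+ 2 / (N w + 1) * (N w + 1))); last by rewrite divfK// gt_eqF.
  by apply: ler_pM => //; rewrite ?ip_ge0//; [exact: SB|rewrite lerDl].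
move: k1 k4; rewrite !ipBl// ler_norml => k1 /andP[_].
by move: k1; move: (ip u w) (ip (F k) w) (ip f w) => *; lra.
Unshelve. all: by end_near.
Qed.

Section Greedy.
Variables (C : set V) (B : R).
Hypotheses (CS : C `<=` S) (C0 : C !=set0) (CB : forall u, C u -> N u <= B)
  (Ccomplete : norm_complete C C).

Let Ndist u v : C u -> C v -> N (u - v) <= 4 * B.
Proof.
move=> Cu Cv; have := parallelogram (CS Cu) (CS Cv).
have := ip_ge0 (SD (CS Cu) (CS Cv)); have := CB Cu; have := CB Cv.
by move: (ip _ _) (ip _ _) (ip _ _) (ip _ _) => *; lra.
Qed.

(** Admissible next terms: the increment has to be orthogonal to all earlier differences, which
    gives Pythagoras' identity along the sequence. *)
Let slice (L : seq V) h := C h /\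
  forall a b, a \in L -> b \in L -> ip (h - last 0 L) (a - b) = 0.

(** The supremum of the distances need not be attained; reaching half of it, in squared norm, is
    enough. *)
Let next (L : seq V) : exists g, (forall a, a \in L -> C a) -> last 0 L \in L ->
  slice L g /\ forall h, slice L h -> N (h - last 0 L) <= 2 * N (g - last 0 L).
Proof.
have [CL|] := pselect (forall a, a \in L -> C a); last by exists 0.
have [lL|] := boolP (last 0 L \in L); last by exists 0.
set z := last 0 L in lL *; have Cz := CL _ lL.
have zM : slice L z.
  split => // a b aL bL; rewrite -/z subrr ip0l//.
  by apply: SB; apply: CS; exact: CL.
pose E := [set N (h - z) | h in slice L].
have hE : has_sup E.
  split; first by exists (N (z - z)), z.
  by exists (4 * B) => _ [h [Ch _] <-]; exact: Ndist.
have [s0|s0] := ltP 0 (sup E).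
  have s2 : 0 < sup E / 2 by rewrite divr_gt0.
  have [_ [g gM <-] hg] := sup_adherent s2 hE.
  exists g => _ _; split => // h hM.
  have : N (h - z) <= sup E by apply: ub_le_sup; [case: hE|exists h].
  by move: hg; move: (sup E) (ip (g - z) _) (ip (h - z) _) => *; lra.
exists z => _ _; split => // h hM.
have : N (h - z) <= sup E by apply: ub_le_sup; [case: hE|exists h].
move=> /le_trans -/(_ _ s0) /le_trans; apply.
by rewrite mulr_ge0// ip_ge0// subrr.
Qed.

Let greedy_seq : exists g : nat -> V, [/\ forall k, C (g k),
  forall k i j, (i <= k)%N -> (j <= k)%N -> ip (g k.+1 - g k) (g i - g j) = 0 &
  forall k h, C h -> (forall i j, (i <= k)%N -> (j <= k)%N -> ip (h - g k) (g i - g j) = 0) ->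
    N (h - g k) <= 2 * N (g k.+1 - g k)].
Proof.
have [nx hnx] := choice next; have [c0 Cc0] := C0.
pose L := fix L k := if k is k'.+1 then rcons (L k') (nx (L k')) else [:: c0].
pose g k := last 0 (L k).
have gS k : g k.+1 = nx (L k) by rewrite /g /= last_rcons.
have LE k : forall a, a \in L k <-> exists2 i, (i <= k)%N & a = g i.
  elim: k => [|k IH] a /=.
    rewrite inE; split=> [/eqP ->|[i]]; first by exists 0%N.
    by rewrite leqn0 => /eqP -> ->.
  rewrite mem_rcons inE -gS; split.
    move=> /orP[/eqP ->|/IH[i ik ->]]; first by exists k.+1.
    by exists i => //; rewrite leqW.
  move=> [i]; rewrite leq_eqVlt ltnS => /orP[/eqP -> ->|ik ->]; first by rewrite eqxx.
  by apply/orP; right; apply/IH; exists i.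
have gL k : last 0 (L k) \in L k by apply/LE; exists k.
have CL k : forall a, a \in L k -> C a.
  elim: k => [|k IH] a; first by rewrite inE => /eqP ->.
  rewrite /= mem_rcons inE => /orP[/eqP ->|]; last exact: IH.
  by have [[]] := hnx (L k) IH (gL k).
exists g; split.
- by move=> k; apply: (CL k); exact: gL.
- move=> k i j ik jk; rewrite gS.
  by have [[_ h] _] := hnx (L k) (CL k) (gL k); apply: h; apply/LE; [exists i|exists j].
- move=> k h Ch hh; rewrite gS.
  have [_ H] := hnx (L k) (CL k) (gL k); apply: H; split => // a b /LE[i ik ->] /LE[j jk ->].
  exact: hh.
Qed.

(* The increments of a greedy sequence are orthogonal, so their norms tend to 0; a
   perturbation of the limit orthogonal to all iterates is admissible at each step. *)
Lemma greedy_extreme : exists g (G : nat -> V), [/\ C g, forall i, C (G i) &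
  forall u, S u -> (forall i, ip u (G i) = 0) -> C (g + u) -> N u = 0].
Proof.
have [g [Cg g_orth g_max]] := greedy_seq.
have Sg k : S (g k) := CS (Cg k).
have orth k m i j : (k <= m)%N -> (i <= k)%N -> (j <= k)%N ->
    ip (g m - g k) (g i - g j) = 0.
  move=> km ik jk; rewrite -(subnKC km); elim: (m - k)%N => [|n IH].
    rewrite addn0 subrr ip0l//; exact: SB.
  rewrite addnS.
  have -> : g (k + n).+1 - g k = (g (k + n).+1 - g (k + n)%N) + (g (k + n)%N - g k).
    by rewrite addrA subrK.
  rewrite ipDl ?IH ?addr0; try exact: SB.
  by apply: g_orth; rewrite (leq_trans _ (leq_addr _ _)).
pose s m := N (g m - g 0%N).
(* Pythagoras along the sequence: the squared distances to [g 0] increase and are bounded, so the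
   sequence is Cauchy. *)
have sE k m : (k <= m)%N -> N (g m - g k) = s m - s k.
  move=> km; rewrite -(subnKC km); elim: (m - k)%N => [|n IH].
    by rewrite addn0 !subrr ip0l.
  rewrite addnS; have step i : (i <= k + n)%N -> N (g (k + n).+1 - g i) =
      N (g (k + n).+1 - g (k + n)%N) + N (g (k + n)%N - g i).
    move=> ikn.
    have -> : g (k + n).+1 - g i = (g (k + n).+1 - g (k + n)%N) + (g (k + n)%N - g i).
      by rewrite addrA subrK.
    rewrite ND; try exact: SB.
    by rewrite (g_orth (k + n)%N (k + n)%N i)// mulr0 addr0.
  rewrite (step k) ?leq_addr// IH /s (step 0%N)//.
  by rewrite addrA.
have s_mono : nondecreasing_seq s.
  by apply/nondecreasing_seqP => n; rewrite -subr_ge0 -sE// ip_ge0//; exact: SB.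
have s_cvg : cvgn s.
  by apply: nondecreasing_is_cvgn => //; exists (4 * B) => _ [m _ <-]; exact: Ndist.
have s_lim e : 0 < e -> exists K, forall k m, (K <= k)%N -> (k <= m)%N -> s m - s k <= e.
  move=> e0; have /cvgrPdist_le/(_ _ e0)[K _ hK] := s_cvg.
  exists K => k m Kk km; have := hK k Kk; rewrite ler_norml => /andP[_].
  have := nondecreasing_cvgn_le s_mono s_cvg m.
  by move: (limn s) (s m) (s k) => *; lra.
have [||h Ch gh] := Ccomplete (F := g) => //.
  move=> e e0; have [K hK] := s_lim e e0; exists K => j k Kj Kk.
  have [jk|/ltnW kj] := leqP j k.
    by rewrite -opprB ipNl ?(ipC _ (- _)) ?ipNl ?opprK ?sE ?hK//; try exact: SB; exact/SN/SB.
  by rewrite sE ?hK.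
have Sh := CS Ch; exists h, g; split => // u Su ugi Chu.
have horth k i j : (i <= k)%N -> (j <= k)%N -> ip (h - g k) (g i - g j) = 0.
  move=> ik jk; apply/le_anti/andP; split.
    have -> : h - g k = - (g k - h) by rewrite opprB.
    rewrite ipNl ?oppr_le0; try exact: SB.
    have -> : ip (g k - h) (g i - g j) = - ip (g k - h) (g j - g i).
      rewrite ipC (_ : g i - g j = - (g j - g i)); last by rewrite opprB.
      by rewrite ipNl ?(ipC (_ - g i))//; exact: SB.
    rewrite oppr_ge0; apply: (ip_lim (F := g)) => //; first exact: SB.
    move=> e e0; exists k => // m /= km; rewrite add0r.
    have -> : g k - g m = - (g m - g k) by rewrite opprB.
    by rewrite ipNl ?orth ?oppr0 ?(ltW e0)//; exact: SB.
  have -> : h - g k = - (g k - h) by rewrite opprB.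
  rewrite ipNl ?oppr_ge0; try exact: SB.
  apply: (ip_lim (F := g)) => //; first exact: SB.
  move=> e e0; exists k => // m /= km; rewrite add0r.
  have -> : g k - g m = - (g m - g k) by rewrite opprB.
  by rewrite ipNl ?orth ?oppr0 ?(ltW e0)//; exact: SB.
apply/le_anti; rewrite ip_ge0// andbT; apply/ler_addgt0Pl => e e0; rewrite addr0.
have e8 : 0 < e / 8 by rewrite divr_gt0.
have [K hK] := s_lim _ e8; have gh8 := gh _ e8.
near \oo => k.
have k1 : N (g k - h) <= e / 8 by near: k.
have kK : (K <= k)%N by near: k; exact: nbhs_infty_ge.
(* [h + u] is an admissible competitor at stage [k], so its distance from [g k] is controlled by the
   next greedy increment. *)
have k2 : N (h + u - g k) <= 2 * N (g k.+1 - g k).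
  apply: g_max => // i j ik jk.
  have -> : h + u - g k = (h - g k) + u by rewrite addrAC.
  rewrite ipDl ?horth ?add0r ?ipBr ?ugi ?subrr//; exact: SB.
have k3 : N (g k.+1 - g k) <= e / 8 by rewrite sE ?hK.
have Shu : S (h + u - g k) by apply: SB => //; exact: SD.
have Sgh : S (g k - h) by exact: SB.
have := parallelogram Shu Sgh; have := ip_ge0 (SB Shu Sgh).
have -> : h + u - g k + (g k - h) = u by rewrite addrA subrK addrAC subrr add0r.
by move: k1 k2 k3; move: (ip _ _) (ip _ _) (ip _ _) (ip _ _) (ip _ _) => *; lra.
Unshelve. all: by end_near.
Qed.

(* Among the near-minimizers of Q choose those of nearly least norm. *)
Lemma convex_min (Q : V -> R) : (forall u, C u -> 0 <= Q u) ->
  (forall u v, C u -> C v -> C (2^-1 *: (u + v)) /\ Q (2^-1 *: (u + v)) <= (Q u + Q v) / 2) ->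
  (forall F : nat -> V, (forall k, C (F k)) ->
     (forall e, 0 < e -> exists K, forall j k, (K <= j)%N -> (K <= k)%N -> N (F j - F k) <= e) ->
     exists2 f, C f & forall K e, 0 < e -> exists2 k, (K <= k)%N & Q f <= Q (F k) + e) ->
  exists2 f, C f & forall u, C u -> Q f <= Q u.
Proof.
move=> Q0 Qmid Qlsc; have [c0 Cc0] := C0.
pose E := [set Q u | u in C]; have hE : has_inf E.
  by split; [exists (Q c0), c0|exists 0 => _ [u Cu <-]; exact: Q0].
pose q := inf E; pose h (k : nat) : R := k.+1%:R^-1.
have h0 k : 0 < h k by rewrite invr_gt0.
have q_le u : C u -> q <= Q u by move=> Cu; apply: ge_inf; [case: hE|exists u].
pose Ck k := [set u | C u /\ Q u <= q + h k].
have Ck_mono k m u : (k <= m)%N -> Ck m u -> Ck k u.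
  move=> km [Cu Qu]; split => //; rewrite (le_trans Qu)// lerD2l.
  by rewrite lef_pV2 ?posrE// ler_nat.
pose M k := inf [set N u | u in Ck k].
have hM k : has_inf [set N u | u in Ck k].
  split; last by exists 0 => _ [u [Cu _] <-]; exact/ip_ge0/CS.
  have [_ [u Cu <-] lt] := inf_adherent (h0 k) hE.
  by exists (N u), u => //; split => //; exact: ltW.
have M_le k u : Ck k u -> M k <= N u.
  by move=> Cu; apply: ge_inf; [case: (hM k)|exists u].
have /choice[F hF] : forall k, exists u, Ck k u /\ N u <= M k + h k.
  move=> k; have [_ [u Cu <-] lt] := inf_adherent (h0 k) (hM k).
  by exists u; split => //; exact: ltW.
have M_mono : nondecreasing_seq M.
  move=> k m km; apply: lb_le_inf; first by case: (hM m).
  by move=> _ [u Cu <-]; apply: M_le; exact: Ck_mono Cu.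
have MB k : M k <= B.
  have [Ck' _] := hF k; rewrite (le_trans (M_le _ _ Ck'))// CB//.
  by case: Ck'.
have M_cvg : cvgn M.
  by apply: nondecreasing_is_cvgn => //; exists B => _ [k _ <-].
have CF k : C (F k) by have [[]] := hF k.
(* The midpoint belongs to [Ck k], so its squared norm is at least [M k]; the parallelogram identity
   turns this into a Cauchy estimate. *)
have close k m : (k <= m)%N -> N (F k - F m) <= 2 * (M m - M k) + 4 * h k.
  move=> km; have [Fk Nk] := hF k; have [Fm Nm] := hF m.
  have Fm' := Ck_mono _ _ _ km Fm.
  have [Cmid Qm] := Qmid _ _ (CF k) (CF m).
  have : Ck k (2^-1 *: (F k + F m)).
    split => //; rewrite (le_trans Qm)//; have := Fk.2; have := Fm'.2.
    by move: (Q _) (Q _) (h k) => *; lra.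
  have Sk := CS (CF k); have Sm := CS (CF m); have Skm := SD Sk Sm.
  move=> /M_le; rewrite ipZl// ?ipZr//; last exact: SZ.
  have hkm : h m <= h k by rewrite lef_pV2 ?posrE// ler_nat.
  have := parallelogram (CS (CF k)) (CS (CF m)).
  by move: (ip _ _) (ip _ _) Nk Nm hkm => *; lra.
have cauchy e : 0 < e -> exists K, forall j k, (K <= j)%N -> (K <= k)%N -> N (F j - F k) <= e.
  move=> e0; have e4 : 0 < e / 4 by rewrite divr_gt0.
  have e8 : 0 < e / 8 by rewrite divr_gt0.
  have /cvgrPdist_le/(_ _ e4)[K1 _ hK1] := M_cvg; have [K2 hK2] := harmonic_small e8.
  have half j k : (maxn K1 K2 <= j)%N -> (j <= k)%N -> N (F j - F k) <= e.
    rewrite geq_max => /andP[j1 j2] jk; apply: le_trans (close _ _ jk) _.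
    have := hK1 j j1; rewrite ler_norml => /andP[_].
    have := nondecreasing_cvgn_le M_mono M_cvg k; have := hK2 j j2; rewrite -/(h j).
    by move: (limn M) (M k) (M j) (h j) => *; lra.
  exists (maxn K1 K2) => j k Kj Kk; have [jk|/ltnW kj] := leqP j k; first exact: half.
  have := half k j Kk kj; rewrite -opprB ipNl ?(ipC _ (- _)) ?ipNl ?opprK//.
  - by apply: SB; exact: CS.
  - by apply: SB; exact: CS.
  - by apply: SB; exact: CS.
  - by apply/SN/SB; exact: CS.
have [f Cf Ff] := Qlsc F CF cauchy.
exists f => // u Cu; apply: le_trans (q_le u Cu).
apply/ler_addgt0Pr => e e0; have e2 : 0 < e / 2 by rewrite divr_gt0.
have [K hK] := harmonic_small e2; have [k Kk Qk] := Ff K _ e2.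
have [[_ Qk'] _] := hF k; have := hK k Kk; rewrite -/(h k).
by move: Qk Qk'; move: (Q _) (Q _) (h k) => *; lra.
Qed.

End Greedy.

(** Closure under rational combinations is asked of [A], so that a countable family qualifies.
    Minimizing sequences are moved into [A'], where Cauchy sequences are known to converge, without
    increasing the distance to [t]. *)
Lemma projection (A A' S' : set V) t : A 0 -> A `<=` S -> A' `<=` A -> S' `<=` S -> S t ->
  (forall (q : rat) a b, A a -> A b -> A (a + ratr q *: b)) ->
  (forall a, A a -> exists2 a', A' a' & N (t - a') <= N (t - a)) ->
  norm_complete A' S' ->
  exists2 f, S' f & (forall e, 0 < e -> exists2 a, A' a & N (a - f) <= e) /\
    forall a, A a -> ip (t - f) a = 0.
Proof.
move=> A0 AS A'A S'S St Alin AA' comp.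
pose E := [set N (t - a) | a in A]; have hE : has_inf E.
  split; first by exists (N (t - 0)), 0.
  by exists 0 => _ [a Aa <-]; apply: ip_ge0; apply: SB => //; exact: AS.
pose m := inf E; have m_le a : A a -> m <= N (t - a).
  by move=> Aa; apply: ge_inf; [case: hE|exists a].
pose h (k : nat) : R := k.+1%:R^-1; have h0 k : 0 < h k by rewrite invr_gt0.
have /choice[F hF] : forall k, exists a, A' a /\ N (t - a) <= m + h k.
  move=> k; have [_ [a Aa <-] lt] := inf_adherent (h0 k) hE.
  have [a' A'a' le] := AA' _ Aa; exists a'; split => //.
  by rewrite (le_trans le)// ltW.
have A'F k : A' (F k) by case: (hF k).
have SF k : S (F k) by apply: AS; exact: A'A.
have StF k : S (t - F k) by exact: SB.
have close j k : N (F j - F k) <= 2 * h j + 2 * h k.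
  have half : 2^-1 = ratr 2^-1 :> R by rewrite fmorphV rmorph_nat.
  have Amid : A (2^-1 *: (F j + F k)).
    rewrite scalerDr half; apply: (Alin); last exact: A'A.
    by rewrite -[_ *: _]add0r; apply: (Alin) => //; exact: A'A.
  have := parallelogram (StF j) (StF k); have := m_le _ Amid.
  have -> : t - F j - (t - F k) = - (F j - F k) by rewrite !opprB addrC addrA subrK.
  have SjK : S (F j - F k) by exact: SB.
  rewrite ipNl ?(ipC _ (- _)) ?ipNl ?opprK//; last exact: SN.
  have -> : t - F j + (t - F k) = 2 *: (t - 2^-1 *: (F j + F k)).
    by rewrite scalerBr scalerA divff// scale1r scaler_nat mulr2n opprD addrACA.
  have Smid : S (t - 2^-1 *: (F j + F k)) by apply: SB => //; apply: SZ; exact: SD.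
  rewrite ipZl ?ipZr//; last exact: SZ.
  have [_ Nj] := hF j; have [_ Nk] := hF k.
  by move: Nj Nk; move: (ip _ _) (ip _ _) (ip _ _) (ip _ _) => *; lra.
have [|f S'f Ff] := comp F A'F.
  move=> e e0; have e4 : 0 < e / 4 by rewrite divr_gt0.
  have [K hK] := harmonic_small e4; exists K => j k Kj Kk; apply: le_trans (close j k) _.
  by have := hK j Kj; have := hK k Kk; rewrite -/(h j) -/(h k); move: (h j) (h k) => *; lra.
have Sf := S'S _ S'f; exists f => //; split.
  move=> e e0; have Fe := Ff _ e0; near \oo => k.
  by exists (F k) => //; near: k.
have upper a : A a -> forall b : bool, (-1) ^+ b * ip (t - f) a <= 0.
  move=> Aa b; have Sa := AS _ Aa; have Na := ip_ge0 Sa.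
  have -> : (-1) ^+ b * ip (t - f) a = ip (t - f) ((-1) ^+ b *: a) by rewrite ipZr//; exact: SB.
  apply: (ip_lim (F := F)) => //; first exact: SZ.
  move=> e e0; rewrite -/(h _).
  have Na1 : 0 < N a + 1 by rewrite ltr_wpDl.
  (* The step [1 / J.+1] is rational and so small that the quadratic term is at most [h J * e];
     dividing by the step isolates the linear term. *)
  have [J hJ] := harmonic_small (divr_gt0 e0 Na1).
  have hJ' := hJ J (leqnn J); rewrite -/(h J) in hJ'.
  have eJ : 0 < h J * e by rewrite mulr_gt0.
  have [K hK] := harmonic_small eJ.
  exists K => // k /= Kk; rewrite add0r ipZr//.
  have qE : (-1) ^+ b * h J = ratr ((-1) ^+ b * J.+1%:R^-1) :> R.
    by rewrite rmorphM rmorphXn/= rmorphN1 fmorphV rmorph_nat.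
  have : m <= N (t - (F k + ((-1) ^+ b * h J) *: a)).
    by rewrite qE; apply: m_le; apply: Alin => //; exact: A'A.
  have -> : t - (F k + ((-1) ^+ b * h J) *: a) = (t - F k) - ((-1) ^+ b * h J) *: a.
    by rewrite opprD addrA.
  rewrite NB// ?ipZr// ?ipZl// ?ipZr//; try exact: SZ.
  have [_ Nk] := hF k; have := hK k Kk; rewrite -/(h k).
  have b2 : (-1) ^+ b * h J * ((-1) ^+ b * h J * N a) = h J * (h J * N a) by case: b {qE}; ring.
  rewrite b2; have : h J * (h J * N a) <= h J * e.
    rewrite ler_pM2l// (le_trans _ (_ : e / (N a + 1) * N a <= e))//.
      by rewrite ler_wpM2r.
    by rewrite mulrAC ler_pdivrMr// ler_pM2l// lerDl.
  have := h0 J; move: Nk; rewrite -mulrA; move: ((-1) ^+ b) => sg.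
  rewrite [sg * (h J * _)]mulrCA; move: (sg * ip _ _) (N _) (h J * (h J * _)) => *; nra.
move=> a Aa; apply/le_anti; have := upper a Aa false; have := upper a Aa true.
by rewrite expr0 expr1 mul1r mulN1r oppr_le0 => -> ->.
Unshelve. all: by end_near.
Qed.

End PreHilbert.

(** * Auxiliary facts on integrals *)

Section MeasureHelpers.
Context {R : realType} {d : measure_display} {T : measurableType d}.
Variable mu : {measure set T -> \bar R}.

Lemma integrable_le_norm (f g : T -> R) : measurable_fun setT f ->
  mu.-integrable setT (EFin \o g) -> (forall w, `|f w| <= g w) ->
  mu.-integrable setT (EFin \o f).
Proof.
move=> mf ig fg; apply: le_integrable ig => //; first exact/measurable_EFinP.
by move=> w _; rewrite /= lee_fin (le_trans (fg w))// ler_norm.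
Qed.

Lemma integral_Rintegral (f : T -> R) : mu.-integrable setT (EFin \o f) ->
  (\int[mu]_w (f w)%:E)%E = (\int[mu]_w f w)%:E.
Proof. by move=> fi; rewrite /Rintegral fineK//; exact: integrable_fin_num. Qed.

Lemma measurable_mem (A : set T) : measurable A ->
  measurable_fun setT (fun w => w \in A).
Proof.
move=> mA; apply: (measurable_fun_bool true).
rewrite setTI (_ : _ @^-1` _ = A)//; apply/seteqP; split=> w /=; first by move/set_mem.
exact: mem_set.
Qed.

Lemma measurable_wsum (F : T -> nat -> R) (M : T -> R) :
  (forall w n, `|F w n| <= M w) -> (forall n, measurable_fun setT (F^~ n)) ->
  measurable_fun setT (fun w => wsum (F w)).
Proof.
move=> FM mF; apply: (measurable_fun_cvg (h := fun m w => series (fun n => F w n / 2 ^+ n.+1) m)).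
  move=> m; rewrite /series /=; apply: measurable_sum => n.
  by apply: measurable_funM => //; exact: measurable_cst.
by move=> w _; exact: cvg_wsum (FM w).
Qed.

Lemma cvgn_geometric_diff (u : nat -> R) A : 0 <= A ->
  (forall k, `|u k.+1 - u k| <= A * 2^-1 ^+ k) -> cvgn u.
Proof.
move=> A0 uA; have : cvgn (series (telescope u)).
  apply: normed_cvg; apply: (series_le_cvg (v_ := geometric A 2^-1)) => //.
  - by move=> n; rewrite normr_ge0.
  - by move=> n; rewrite /geometric /= mulr_ge0// exprn_ge0// invr_ge0.
  - by apply: is_cvg_geometric_series; rewrite ger0_norm ?invr_ge0// invf_lt1// ltr1n.
move=> cs; have -> : u = (fun n => u 0%N + series (telescope u) n).
  by apply/funext => n; rewrite -eq_sum_telescope.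
by apply: is_cvgD => //; exact: is_cvg_cst.
Qed.

End MeasureHelpers.

(** * A weighted Hilbert space of sequence-valued functions *)

Section SquareIntegrable.
Context {R : realType} {d : measure_display} {T : measurableType d}.
Variables (mu : {measure set T -> \bar R}) (b : T -> R).
Hypotheses (b_int : mu.-integrable setT (EFin \o b)) (b1 : forall w, 1 <= b w).
Implicit Types (F G : T -> nat -> R^o) (C : R).

Let b0 w : 0 < b w. Proof. exact: lt_le_trans (b1 w). Qed.

Let mb : measurable_fun setT b.
Proof. exact/measurable_EFinP/(measurable_int mu b_int). Qed.

Definition sqfun : set (T -> nat -> R^o) :=
  [set F | (forall n, measurable_fun setT (fun w => F w n : R)) /\
           exists C, forall w n, `|F w n : R| <= C * b w].

(** Both factors are bounded by multiples of [b], which is only integrable; dividing the product by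
    [b] makes it bounded by a multiple of [b] again. *)
Definition sqker F G w : R := wsum (fun n => (F w n : R) * G w n) / b w.

Definition sqip F G : R := \int[mu]_w sqker F G w.

Lemma sqfun0 : sqfun 0.
Proof.
split; first by move=> n; exact: measurable_cst.
by exists 0 => w n; rewrite mul0r normr_le0.
Qed.

Lemma sqfunD F G : sqfun F -> sqfun G -> sqfun (F + G).
Proof.
move=> [mF [C FC]] [mG [C' GC]]; split; first by move=> n; exact: measurable_funD.
by exists (C + C') => w n; rewrite mulrDl (le_trans (ler_normD _ _))// lerD.
Qed.

Lemma sqfunZ (a : R) F : sqfun F -> sqfun (a *: F).
Proof.
move=> [mF [C FC]]; split.
  by move=> n; apply: measurable_funM; [exact: measurable_cst|exact: mF].
by exists (`|a| * C) => w n; rewrite normrM -mulrA ler_wpM2l.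
Qed.

Let ker_term F G C C' w n : (forall n, `|F w n : R| <= C * b w) ->
  (forall n, `|G w n : R| <= C' * b w) -> `|(F w n : R) * G w n| <= C * b w * (C' * b w).
Proof. by move=> FC GC; rewrite normrM ler_pM. Qed.

Lemma sqker_le F G C C' w : (forall n, `|F w n : R| <= C * b w) ->
  (forall n, `|G w n : R| <= C' * b w) -> `|sqker F G w| <= C * C' * b w.
Proof.
move=> FC GC; rewrite /sqker normrM normfV (gtr0_norm (b0 w)) ler_pdivrMr//.
rewrite (le_trans (wsum_norm_le (fun n => ker_term n FC GC)))//.
by rewrite [leRHS](_ : _ = C * b w * (C' * b w))//; ring.
Qed.

Lemma measurable_sqker F G : sqfun F -> sqfun G -> measurable_fun setT (sqker F G).
Proof.
move=> [mF [C FC]] [mG [C' GC]]; apply: measurable_funM.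
  apply: (measurable_wsum (M := fun w => C * b w * (C' * b w))) => [w n|n].
    exact: ker_term.
  by apply: measurable_funM.
rewrite (_ : (fun w => _) = fun w => (b w) `^ (-1)); last first.
  by apply/funext => w; rewrite powR_inv1// ltW.
exact: (measurableT_comp (measurable_powR (-1)) mb).
Qed.

Lemma integrable_sqker F G : sqfun F -> sqfun G -> mu.-integrable setT (EFin \o sqker F G).
Proof.
move=> SF SG; have mk := measurable_sqker SF SG.
have [mF [C FC]] := SF; have [mG [C' GC]] := SG.
apply: (integrable_le_norm (g := fun w => C * C' * b w)) mk _ _; last first.
  by move=> w; exact: sqker_le.
by apply: (eq_integrable _ (fun w => (C * C')%:E * (b w)%:E)%E) => //; exact: integrableZl.
Qed.

Lemma sqipC F G : sqip F G = sqip G F.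
Proof.
apply: eq_Rintegral => w _; rewrite /sqker; congr (_ / _); congr wsum.
by apply/funext => n; rewrite mulrC.
Qed.

Lemma sqipDl F G H : sqfun F -> sqfun G -> sqfun H ->
  sqip (F + G) H = sqip F H + sqip G H.
Proof.
move=> SF SG SH; rewrite /sqip -RintegralD//; try exact: integrable_sqker.
apply: eq_Rintegral => w _; rewrite /sqker -mulrDl; congr (_ / _).
have [mF [C FC]] := SF; have [mG [C' GC]] := SG; have [mH [D HD]] := SH.
rewrite -(@wsumD _ _ _ (`|C| * b w * (D * b w) + `|C'| * b w * (D * b w))).
- by congr wsum; apply/funext => n; rewrite -mulrDl.
- move=> n; rewrite (le_trans (ker_term (F := F) (C := `|C|) (C' := D) n _ _))//.
    by move=> m; rewrite (le_trans (FC w m))// ler_wpM2r ?ler_norm// ltW.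
  rewrite lerDl mulr_ge0// ?mulr_ge0 ?(ltW (b0 w))//.
  by rewrite -(pmulr_lge0 _ (b0 w)) (le_trans (normr_ge0 _) (HD w 0%N)).
- move=> n; rewrite (le_trans (ker_term (F := G) (C := `|C'|) (C' := D) n _ _))//.
    by move=> m; rewrite (le_trans (GC w m))// ler_wpM2r ?ler_norm// ltW.
  rewrite lerDr mulr_ge0// ?mulr_ge0 ?(ltW (b0 w))//.
  by rewrite -(pmulr_lge0 _ (b0 w)) (le_trans (normr_ge0 _) (HD w 0%N)).
Qed.

Lemma sqipZl (a : R) F G : sqfun F -> sqfun G -> sqip (a *: F) G = a * sqip F G.
Proof.
move=> SF SG; rewrite /sqip -RintegralZl//; last exact: integrable_sqker.
apply: eq_Rintegral => w _; rewrite /sqker mulrA; congr (_ / _).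
have [mF [C FC]] := SF; have [mG [C' GC]] := SG.
rewrite -(wsumZ a (fun n => ker_term n (FC w) (GC w))).
by congr wsum; apply/funext => n; rewrite mulrA.
Qed.

Lemma sqker_ge0 F w : sqfun F -> 0 <= sqker F F w.
Proof.
move=> [mF [C FC]]; rewrite divr_ge0 ?(ltW (b0 w))//.
by apply: (wsum_ge0 (fun n => ker_term n (FC w) (FC w))) => n; rewrite -expr2 sqr_ge0.
Qed.

Lemma sqip_ge0 F : sqfun F -> 0 <= sqip F F.
Proof. by move=> SF; apply: Rintegral_ge0 => w _; exact: sqker_ge0. Qed.

Lemma sqip_term_ae0 F : sqfun F -> sqip F F = 0 ->
  {ae mu, forall w, forall n, (F w n : R) = 0}.
Proof.
move=> SF F0; have iF := integrable_sqker SF SF.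
have : (\int[mu]_w `|(EFin \o sqker F F) w|)%E = 0%E.
  under eq_integral do rewrite gee0_abs ?lee_fin ?sqker_ge0//.
  by rewrite integral_Rintegral// -/(sqip F F) F0.
move/(ae_eq_integral_abs mu measurableT (measurable_int mu iF)).
apply: filterS => w /(_ I) /= [qw] n; have [_ [C FC]] := SF.
apply/eqP; rewrite -sqrf_eq0 expr2; apply/eqP/le_anti; rewrite -{2}expr2 sqr_ge0 andbT.
have := le_wsum_term n (fun n => ker_term n (FC w) (FC w)) (fun n => _ : 0 <= F w n * F w n).
move: qw; rewrite /sqker => /eqP; rewrite mulf_eq0 invr_eq0 (gt_eqF (b0 w)) orbF => /eqP ->.
rewrite pmulr_lle0 ?invr_gt0 ?exprn_gt0//; apply => k; by rewrite -expr2 sqr_ge0.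
Qed.

Section Complete.
Variables (F : nat -> T -> nat -> R^o) (C : R).
Hypotheses (mF : forall k n, measurable_fun setT (fun w => F k w n : R))
  (FC : forall k w n, `|F k w n : R| <= C * b w).
Local Notation N u := (sqip u u).
Hypothesis F_cauchy : forall e, 0 < e -> exists K, forall j k, (K <= j)%N -> (K <= k)%N ->
  N (F j - F k) <= e.

Let SF k : sqfun (F k). Proof. by split => //; exists C. Qed.

Let sqfunB u v : sqfun u -> sqfun v -> sqfun (u - v).
Proof. by move=> ? ?; apply: sqfunD => //; rewrite -scaleN1r; exact: sqfunZ. Qed.

(** The factor [4 ^+ i] will make the pointwise increments geometrically small, and [2 ^+ i.+1]
    makes the integrals summable. *)
Let fast : exists phi : nat -> nat, (forall i, (i <= phi i)%N) /\
  forall i, N (F (phi i.+1) - F (phi i)) <= (4 ^+ i * 2 ^+ i.+1)^-1.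
Proof.
have e0 i : 0 < (4 ^+ i * 2 ^+ i.+1)^-1 :> R by rewrite invr_gt0 mulr_gt0 ?exprn_gt0.
have /choice[K hK] := fun i => F_cauchy (e0 i).
exists (fun i => \sum_(j < i.+1) (K j).+1)%N; split=> [i|i].
  elim: i => // i IH; rewrite big_ord_recr/= (leq_ltn_trans IH)//.
  by rewrite addnS ltnS leq_addr.
by apply: hK; rewrite ?[in X in (_ <= X)%N]big_ord_recr/= -?addnA leqNgt; lia.
Qed.

Let ae_cvg : exists phi : nat -> nat, (forall i, (i <= phi i)%N) /\
  {ae mu, forall w, forall n, cvgn (fun i => F (phi i) w n : R)}.
Proof.
have [phi [phi_ge phiN]] := fast; exists phi; split => //.
pose D i := F (phi i.+1) - F (phi i).
have SD i : sqfun (D i) by exact: sqfunB.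
pose g i w := (4 ^+ i * sqker (D i) (D i) w)%:E.
have g0 i w : (0 <= g i w)%E by rewrite lee_fin mulr_ge0 ?exprn_ge0 ?sqker_ge0.
have mg i : measurable_fun setT (g i).
  apply/measurable_EFinP; apply: measurable_funM; first exact: measurable_cst.
  exact: measurable_sqker.
have gi i : (\int[mu]_w g i w <= (1 / (2 ^ i.+1)%:R)%:E)%E.
  have iq := integrable_sqker (SD i) (SD i).
  rewrite /g; under eq_integral do rewrite EFinM.
  rewrite integralZl// integral_Rintegral// -EFinM lee_fin mul1r natrX.
  by rewrite -ler_pdivlMl ?exprn_gt0// -invfM; exact: phiN.
(* The sum of the [g i] has integral at most 1, so it is finite almost everywhere. *)
have iZ : mu.-integrable setT (fun w => \sum_(0 <= i <oo) g i w)%E.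
  apply/integrableP; split; first exact: ge0_emeasurable_sum.
  under eq_integral => w _.
    rewrite gee0_abs; last by apply: nneseries_ge0 => *; exact: g0.
    over.
  rewrite integral_nneseries//.
  apply: (@le_lt_trans _ _ (1%:E)%E); last by rewrite ltry.
  apply: (@le_trans _ _ (\sum_(0 <= i <oo) (0 + (1 / (2 ^ i.+1)%:R)%:E))%E).
    apply: lee_nneseries => i _; last by rewrite add0e.
    by move=> _; apply: integral_ge0 => w _; exact: g0.
  apply: le_trans (epsilon_trick xpredT _ _) _ => //.
  by rewrite eseries0// add0e.
apply: filterS (integrable_ae measurableT iZ) => w /(_ I) Zfin n.
pose Z := fine (\sum_(0 <= i <oo) g i w)%E.
have ZE i : 4 ^+ i * sqker (D i) (D i) w <= Z.
  rewrite -lee_fin /Z fineK//.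
  apply: le_trans (nneseries_lim_ge i.+1 (fun k _ _ => g0 k w)).
  by rewrite big_nat_recr//= leeDr// sume_ge0.
have Z0 : 0 <= Z by apply: le_trans (ZE 0%N); rewrite mulr_ge0// sqker_ge0.
(* Adding 1 gives [X <= (X + 1) ^+ 2] for [X >= 0], which avoids a square root. *)
pose A := Z * b w * 2 ^+ n.+1 + 1.
have A0' : 0 <= Z * b w * 2 ^+ n.+1 by rewrite !mulr_ge0 ?exprn_ge0 ?(ltW (b0 w)).
have A0 : 0 <= A by rewrite addr_ge0.
apply: (cvgn_geometric_diff A0) => i.
rewrite -ler_sqr ?nnegrE ?mulr_ge0 ?exprn_ge0// real_normK ?num_real//.
rewrite exprMn; apply: (@le_trans _ _ (Z * b w * 2 ^+ n.+1 * 2^-1 ^+ i ^+ 2)); last first.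
  by rewrite ler_wpM2r ?exprn_ge0// /A; nra.
have -> : (2^-1 ^+ i ^+ 2 : R) = 4 ^- i.
  by rewrite -exprM mulnC exprM -exprVn expr2 -invfM -natrM.
have [_ [C' DC]] := SD i.
have := le_wsum_term n (fun n => ker_term n (DC w) (DC w)) (fun n => _ : 0 <= D i w n * D i w n).
rewrite ler_pdivrMr ?exprn_gt0// -expr2 => h.
apply: le_trans (h _) _; first by move=> k; rewrite -expr2 sqr_ge0.
rewrite mulrAC ler_pM2r ?exprn_gt0//.
have := ZE i; rewrite /sqker mulrA ler_pdivrMr// => {}h.
by rewrite ler_pdivlMr ?exprn_gt0// mulrC.
Qed.

(** A fast subsequence converges almost everywhere, and domination by a multiple of [b] gives
    convergence in norm. The subsequence and the null set [A] are part of the statement because the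
    limit has to inherit pointwise constraints everywhere: off [A] by passing to the limit, on [A]
    because it equals [F 0] there. *)
Lemma sqip_complete : exists G (phi : nat -> nat) (A : set T),
  [/\ [/\ sqfun G, forall w n, `|G w n : R| <= C * b w & forall i, (i <= phi i)%N],
      measurable A /\ mu A = 0,
      forall w, A w -> G w = F 0%N w,
      forall w, ~ A w -> forall n, (fun i => F (phi i) w n : R) @ \oo --> (G w n : R) &
      norm_cvg sqip F G].
Proof.
have [phi [phi_ge [A [mA A0 hA]]]] := ae_cvg.
have {}hA w : ~ A w -> forall n, cvgn (fun i => F (phi i) w n : R).
  by move=> Aw; apply: contrapT => h; apply: Aw; exact: hA.
pose h i w n : R := if w \in A then F 0%N w n else F (phi i) w n.
pose G w n : R := if w \in A then F 0%N w n else limn (fun i => F (phi i) w n : R).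
have hG w n : (fun i => h i w n) @ \oo --> G w n.
  rewrite /h /G; have [Aw|/negP Aw] := boolP (w \in A); first exact: cvg_cst.
  by apply: hA => /mem_set.
have mh i n : measurable_fun setT (fun w => h i w n).
  by apply: measurable_fun_ifT => //; exact: measurable_mem.
have hC i w n : `|h i w n| <= C * b w by rewrite /h; case: ifP.
have GC w n : `|G w n| <= C * b w.
  apply: (@closed_cvg _ _ \oo _ (fun i => `|h i w n|) [set x | x <= C * b w]) => //.
    by apply: nearW => i; exact: hC.
  by apply: cvg_norm.
have SG : sqfun G.
  split; last by exists C.
  by move=> n; apply: measurable_fun_cvg (fun i => mh i n) _ => w _; exact: hG.
have phiG : (fun i => N (F (phi i) - G)) @ \oo --> (0 : R).
  have SFG i : sqfun (F (phi i) - G) by exact: sqfunB.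
  have FGC i w n : `|F (phi i) w n - G w n| <= (C + C) * b w.
    by rewrite mulrDl (le_trans (ler_normB _ _))// lerD.
  have [|||||_ _] := @dominated_convergence _ _ _ mu setT measurableT
    (fun i w => (sqker (F (phi i) - G) (F (phi i) - G) w)%:E) (cst 0%E)
    (fun w => ((C + C) * (C + C) * b w)%:E).
  - by move=> i; apply/measurable_EFinP; exact: measurable_sqker.
  - exact: measurable_cst.
  - exists A; split => // w; apply: contra_notP => Aw _; apply: cvg_EFin; first exact: nearW.
    rewrite /= (_ : 0 = wsum (fun=> 0 * 0) / b w); last by rewrite wsum_cst mulr0 mul0r.
    apply: cvgMr_tmp; apply: (wsum_cvg (M := (C + C) * b w * ((C + C) * b w))).
    + by move=> n; rewrite mulr0 normr0 -expr2 sqr_ge0.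
    + by apply: nearW => i n; rewrite normrM; apply: ler_pM; rewrite ?normr_ge0//; exact: FGC.
    + move=> n; have FG : (fun i => F (phi i) w n - G w n : R) @ \oo --> (0 : R).
        have := hG w n; rewrite /h /G; case: ifP => [/set_mem//|_] FG.
        by rewrite -(subrr (limn (fun i => F (phi i) w n : R))); apply: cvgB => //; exact: cvg_cst.
      exact: cvgM.
  - by apply: (eq_integrable _ (fun w => ((C + C) * (C + C))%:E * (b w)%:E)%E) => //; exact: integrableZl.
  - apply: aeW => w i _ /=; rewrite lee_fin; apply: sqker_le => n; exact: FGC.
  rewrite integral0 => /fine_cvg; apply: cvg_trans; apply: near_eq_cvg.
  by apply: nearW => i.
exists G, phi, A; split => //.
- by move=> w Aw; apply/funext => n; rewrite /G mem_set.
- move=> w Aw n; have AwF : (w \in A) = false by apply/negP => /set_mem.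
  by have := hG w n; rewrite /h AwF.
- move=> e e0; have e4 : 0 < e / 4 by rewrite divr_gt0.
  have [K hK] := F_cauchy e4.
  have /cvgrPdist_le/(_ _ e4)[K' _ hK'] := phiG.
  exists K => // k Kk; pose i := maxn K K'.
  have iK : (K <= phi i)%N by rewrite (leq_trans _ (phi_ge i))// leq_maxl.
  have := hK k _ Kk iK; have := hK' i (leq_maxr _ _); rewrite sub0r normrN ger0_norm; last first.
    exact/sqip_ge0/sqfunB.
  have := parallelogram sqfunD sqfunZ sqipC sqipDl sqipZl (sqfunB (SF k) (SF (phi i))) (sqfunB (SF (phi i)) SG).
  rewrite addrA subrK; have := sqip_ge0 (sqfunB (sqfunB (SF k) (SF (phi i))) (sqfunB (SF (phi i)) SG)).
  by move: (sqip _ _) (sqip _ _) (sqip _ _) (sqip _ _) => *; lra.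
Qed.

End Complete.
End SquareIntegrable.

(** * Saturation and functions orthogonal to a countable family *)

Section Saturation.
Context {R : realType} {d : measure_display} {T : measurableType d}.
Variable mu : {finite_measure set T -> \bar R}.

Let int_bounded (f : T -> R) C : measurable_fun setT f -> (forall w, `|f w| <= C) ->
  mu.-integrable setT (EFin \o f).
Proof.
move=> mf fC; apply: (integrable_le_norm (g := cst C)) => //.
exact: finite_measure_integrable_cst.
Qed.

Section Orthogonal.
Variables (E : set T) (h : nat -> T -> R) (dec : nat -> rat).
Hypotheses (dec_surj : forall q, exists n, dec n = q) (mE : measurable E) (mh : forall n, measurable_fun setT (h n))
  (hE : forall n w, ~ E w -> h n w = 0)
  (h_bnd : forall n, exists C, forall w, `|h n w| <= C).

Let clip (x : R) : R := Num.max (-1) (Num.min 1 x).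

(* The closure of the family h under rational combinations and truncation,
   enumerated by countably many terms. *)
Fixpoint lattice_term (t : GenTree.tree nat) : T -> R :=
  match t with
  | GenTree.Leaf n => h n
  | GenTree.Node n l =>
    match l with
    | [:: a] => fun w => clip (lattice_term a w)
    | [:: a; c] => fun w => lattice_term a w + ratr (dec n) * lattice_term c w
    | _ => fun=> 0
    end
  end.
Local Notation ev := lattice_term.

Let clip_le1 x : `|clip x| <= 1.
Proof.
rewrite /clip ler_norml le_max lexx ge_max ge_min lexx/= andbT.
by rewrite (le_trans (lerN10 R)).
Qed.

Let clip_dist s x : `|s| <= 1 -> `|s - clip x| <= `|s - x|.
Proof.
rewrite ler_norml => /andP[s1 s2]; rewrite /clip.
have [x1|x1] := leP 1 x.
  rewrite max_r ?lerN1l// ler0_norm ?subr_le0// -normrN ger0_norm; lra.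
have [//|x2] := leP (-1) x; rewrite !ger0_norm; lra.
Qed.

Lemma lattice_term_prop t : [/\ measurable_fun setT (ev t), exists C, forall w, `|ev t w| <= C &
  forall w, ~ E w -> ev t w = 0].
Proof.
have z : [/\ measurable_fun setT (fun _ : T => 0 : R),
    exists C, forall w : T, `|(0 : R)| <= C & forall w : T, ~ E w -> 0 = 0 :> R].
  by split => //; exists 0; rewrite normr0.
have cl a : [/\ measurable_fun setT (ev a), exists C, forall w, `|ev a w| <= C &
    forall w, ~ E w -> ev a w = 0] -> [/\ measurable_fun setT (fun w => clip (ev a w)),
    exists C, forall w, `|clip (ev a w)| <= C & forall w, ~ E w -> clip (ev a w) = 0].
  move=> [h1 h2 h3]; split.
  - by apply: measurable_maxr => //; apply: measurable_minr.
  - by exists 1 => w; exact: clip_le1.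
  - by move=> w /h3 ->; rewrite /clip (min_idPr _)// (max_idPr _)// lerN10.
have co (q : R) a c : [/\ measurable_fun setT (ev a), exists C, forall w, `|ev a w| <= C &
    forall w, ~ E w -> ev a w = 0] -> [/\ measurable_fun setT (ev c),
    exists C, forall w, `|ev c w| <= C & forall w, ~ E w -> ev c w = 0] ->
    [/\ measurable_fun setT (fun w => ev a w + q * ev c w),
    exists C, forall w, `|ev a w + q * ev c w| <= C &
    forall w, ~ E w -> ev a w + q * ev c w = 0].
  move=> [h1 [C h2] h3] [k1 [C' k2] k3]; split.
  - by apply: measurable_funD => //; apply: measurable_funM.
  - exists (C + `|q| * C') => w; rewrite (le_trans (ler_normD _ _))// lerD// normrM.
    by rewrite ler_wpM2l.
  - by move=> w Ew; rewrite h3// k3// mulr0 addr0.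
move: t; fix IH 1 => -[n|n l]; first by split; [exact: mh|exact: h_bnd|exact: hE].
by case: l => [|a [|c [|? ?]]] //=; [exact: cl|exact: co].
Qed.

Local Notation ev_prop := lattice_term_prop.

Let lift (f : T -> R) : T -> nat -> R^o := fun w _ => f w.
Let b1 (w : T) : R := 1.
Let b1_int : mu.-integrable setT (EFin \o b1).
Proof. exact: finite_measure_integrable_cst. Qed.
Let b1_ge w : 1 <= b1 w. Proof. by []. Qed.
Local Notation ip := (sqip mu b1).
Local Notation S := (sqfun b1).

Let ip_lift f g : ip (lift f) (lift g) = \int[mu]_w (f w * g w).
Proof.
by apply: eq_Rintegral => w _; rewrite /sqker /b1 divr1 (wsum_cst (f w * g w)).
Qed.

Let ip_liftB f g : ip (lift f - lift g) (lift f - lift g) =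
  \int[mu]_w ((f w - g w) * (f w - g w)).
Proof. exact: (ip_lift (fun w => f w - g w) (fun w => f w - g w)). Qed.

Let S_lift (f : T -> R) C : measurable_fun setT f -> (forall w, `|f w| <= C) -> S (lift f).
Proof. by move=> mf fC; split => //; exists C => w n; rewrite /b1 mulr1; exact: fC. Qed.

Let S_ev t : S (lift (ev t)).
Proof. by have [m1 [C m2] _] := ev_prop t; exact: S_lift m2. Qed.

Let A : set (T -> nat -> R^o) := [set F | exists t, F = lift (ev t)].
Let A1 : set (T -> nat -> R^o) :=
  [set F | exists2 t, F = lift (ev t) & forall w, `|ev t w| <= 1].
Let S1 : set (T -> nat -> R^o) := [set F | exists f, [/\ F = lift f,
  measurable_fun setT f, forall w, `|f w| <= 1 & forall w, ~ E w -> f w = 0]].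

(** The shape [lift f], the bound 1 and the support in [E] hold at every stage; they pass to the
    pointwise limit and also hold on the null set. *)
Let complete1 : norm_complete ip A1 S1.
Proof.
move=> F A1F F_cauchy; have /choice[t ht] : forall k, exists t,
    F k = lift (ev t) /\ forall w, `|ev t w| <= 1.
  by move=> k; have [t ? ?] := A1F k; exists t.
have Ft k w n : F k w n = ev (t k) w by rewrite (ht k).1.
have [||G [phi [N [[SG GC _] [mN N0] GN Gl FG]]]] :=
    @sqip_complete _ _ _ mu b1 b1_int b1_ge F 1 _ _ F_cauchy.
- by move=> k n; rewrite (ht k).1; have [] := ev_prop (t k).
- by move=> k w n; rewrite Ft mulr1; exact: (ht k).2.
exists G => //; exists (fun w => G w 0%N); split.
- apply/funext => w; apply/funext => n; rewrite /lift.
  have [Nw|Nw] := pselect (N w); first by rewrite GN// !Ft.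
  apply: (cvg_unique _ (Gl w Nw n)) => //.
  have -> : (fun i => F (phi i) w n : R) = (fun i => F (phi i) w 0%N : R).
    by apply/funext => i; rewrite !Ft.
  exact: Gl w Nw 0%N.
- by have [mG _] := SG; exact: mG.
- by move=> w; have := GC w 0%N; rewrite mulr1.
- move=> w Ew; have ev0 k : ev (t k) w = 0 by have [_ _] := ev_prop (t k); exact.
  have [Nw|Nw] := pselect (N w); first by rewrite GN// Ft.
  apply: (cvg_unique _ (Gl w Nw 0%N)) => //.
  have -> : (fun i => F (phi i) w 0%N : R) = (fun=> 0).
    by apply/funext => i; rewrite Ft ev0.
  exact: cvg_cst.
Qed.

Let A_lin (q : rat) a c : A a -> A c -> A (a + ratr q *: c).
Proof.
move=> [t ->] [u ->]; have [k <-] := dec_surj q.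
by exists (GenTree.Node k [:: t; u]).
Qed.

Let A0 : A 0. Proof. by exists (GenTree.Node 0 [::]). Qed.

(** The negation of the conclusion of [saturated_orthogonal], assumed in order to contradict
    saturation. *)
Hypothesis h_total : forall th : T -> R, measurable_fun setT th -> (forall w, `|th w| <= 1) ->
  (forall w, ~ E w -> th w = 0) -> (forall n, \int[mu]_w (th w * h n w) = 0) ->
  {ae mu, forall w, th w = 0}.

(** Clipping does not increase the distance to [f], so the projection is a limit of terms bounded by
    1. Its residue is orthogonal to every [h n], hence null by totality; it is halved to meet the
    bound 1 in [h_total]. *)
Let dense_sq (f : T -> R) e : measurable_fun setT f -> (forall w, `|f w| <= 1) ->
  (forall w, ~ E w -> f w = 0) -> 0 < e ->
  exists t, \int[mu]_w ((f w - ev t w) * (f w - ev t w)) <= e.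
Proof.
move=> mf f1 f0 e0; have Sf : S (lift f) by exact: S_lift f1.
have [||||g [k [gE mk k1 k0]] [g_app g_orth]] := projection (@sqfunD _ _ _ b1)
    (@sqfunZ _ _ _ b1) (@sqipC _ _ _ mu b1) (@sqipDl _ _ _ mu b1 b1_int b1_ge)
    (@sqipZl _ _ _ mu b1 b1_int b1_ge) (@sqip_ge0 _ _ _ mu b1 b1_ge)
    (A := A) (A' := A1) (S' := S1) (t := lift f) A0 _ _ _ Sf A_lin _ complete1.
- by move=> _ [t ->].
- by move=> _ [t -> _]; exists t.
- by move=> _ [k [-> mk k1 _]]; exact: S_lift k1.
- move=> _ [t ->]; exists (lift (fun w => clip (ev t w))).
    by exists (GenTree.Node 0 [:: t]) => // w; exact: clip_le1.
  have [mt [C tC] _] := ev_prop t.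
  have mc : measurable_fun setT (fun w => clip (ev t w)) by have [] := ev_prop (GenTree.Node 0 [:: t]).
  rewrite !ip_liftB; apply: le_Rintegral => //.
  + apply: (@int_bounded _ (2 * 2)); first by apply: measurable_funM; exact: measurable_funB.
    move=> w; have h2 : `|f w - clip (ev t w)| <= 2.
      by rewrite (le_trans (ler_normB _ _))//; have := f1 w; have := clip_le1 (ev t w); lra.
    by rewrite normrM ler_pM.
  + apply: (@int_bounded _ ((1 + C) * (1 + C))); first by apply: measurable_funM; exact: measurable_funB.
    move=> w; have h2 : `|f w - ev t w| <= 1 + C by rewrite (le_trans (ler_normB _ _))// lerD.
    by rewrite normrM ler_pM.
  + move=> w _; rewrite -!expr2 -[leLHS]real_normK ?num_real// -[leRHS]real_normK ?num_real//.
    by rewrite ler_sqr ?nnegrE// clip_dist.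
have th0 : {ae mu, forall w, (f w - k w) / 2 = 0}.
  apply: h_total.
  - by apply: measurable_funM => //; exact: measurable_funB.
  - move=> w; rewrite normrM [X in _ * X]ger0_norm ?invr_ge0// ler_pdivrMr// mul1r.
    by rewrite (le_trans (ler_normB _ _))//; have := f1 w; have := k1 w; lra.
  - by move=> w Ew; rewrite f0// k0// subrr mul0r.
  - move=> n; have An : A (lift (h n)) by exists (GenTree.Leaf n).
    have := g_orth _ An; rewrite gE -[lift f - lift k]/(lift (fun w => f w - k w)) ip_lift => /eqP.
    have [C hC] := h_bnd n.
    have -> : (fun w => (f w - k w) / 2 * h n w) = (fun w => 2^-1 * ((f w - k w) * h n w)).
      by apply/funext => w; rewrite mulrAC mulrC.
    rewrite RintegralZl//; first by move=> /eqP ->; rewrite mulr0.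
    apply: (@int_bounded _ (2 * C)); first by apply: measurable_funM => //; exact: measurable_funB.
    move=> w; rewrite normrM ler_pM//.
    by rewrite (le_trans (ler_normB _ _))//; have := f1 w; have := k1 w; lra.
have [_ [t -> _] kt] := g_app _ e0; exists t; apply: le_trans kt.
rewrite gE ip_liftB.
rewrite le_eqVlt; apply/orP; left; apply/eqP; rewrite /Rintegral; congr fine.
have [mt _ _] := ev_prop t; apply: ae_eq_integral => //.
- by apply/measurable_EFinP; apply: measurable_funM; exact: measurable_funB.
- by apply/measurable_EFinP; apply: measurable_funM; exact: measurable_funB.
apply: filterS th0 => w /eqP; rewrite mulf_eq0 invr_eq0 pnatr_eq0 orbF subr_eq0 => /eqP fk _.
by rewrite fk -opprB mulrNN.
Qed.

(** [f] is truncated at level [m], scaled into the unit ball by [M], approximated in mean square and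
    scaled back. The mean distance is recovered from [M * t <= M / 2 * dl + M / 2 / dl * t ^+ 2]. *)
Lemma lattice_term_dense (f : T -> R) e : mu.-integrable E (EFin \o f) -> 0 < e ->
  exists t, (\int[mu]_(w in E) (`|f w - ev t w|)%:E < e%:E)%E.
Proof.
move=> fi e0; pose f0 := f \_ E.
have f0i : mu.-integrable setT (EFin \o f0).
  by rewrite /f0 -restrict_EFin -integrable_mkcond.
have mf0 : measurable_fun setT f0 by exact/measurable_EFinP/(measurable_int mu f0i).
pose fm (m : nat) w := if `|f0 w| <= m%:R then f0 w else 0.
have mfm m : measurable_fun setT (fm m).
  apply: measurable_fun_ifT => //; apply: measurable_fun_ler => //.
  exact: measurableT_comp.
have fm_le m w : `|fm m w| <= `|f0 w| by rewrite /fm; case: ifP => // _; rewrite normr0.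
have fm_bnd m w : `|fm m w| <= m%:R by rewrite /fm; case: ifP => // _; rewrite normr0.
have fmi m : mu.-integrable setT (EFin \o fm m) by exact: int_bounded (fm_bnd m).
have [|||||_ /fine_cvgP[_ lim0] _] := @dominated_convergence _ _ _ mu setT measurableT
    (fun m w => (fm m w)%:E) (EFin \o f0) (fun w => (`|f0 w|)%:E).
- by move=> m; exact/measurable_EFinP.
- exact/measurable_EFinP.
- apply: aeW => w _; apply: cvg_EFin; first exact: nearW.
  apply/cvgrPdist_le => r r0; exists (Num.bound `|f0 w|) => // m /= hm.
  have fle : `|f0 w| <= m%:R.
    by rewrite (le_trans (ltW (archi_boundP (normr_ge0 (f0 w)))))// ler_nat.
  by rewrite /fm fle subrr normr0 ltW.
- exact: integrable_abse f0i.
- by apply: aeW => w m _; rewrite lee_fin.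
have [m hm] : exists m, \int[mu]_w `|fm m w - f0 w| < e / 2.
  have e2 : 0 < e / 2 by rewrite divr_gt0.
  have /cvgrPdist_lt/(_ _ e2)[m _ /(_ m (leqnn m))] := lim0.
  rewrite sub0r normrN => /(le_lt_trans (ler_norm _)) hm; exists m; exact: hm.
pose M : R := m.+1%:R; have M0 : 0 < M by rewrite ltr0n.
pose muT : R := fine (mu setT); have muT0 : 0 <= muT by exact: fine_ge0.
(* Chosen so that [M / 2 * dl * (muT + 1) = e / 4], the bound for the integral of [k2]. *)
pose dl := e / (2 * M * (muT + 1)).
have dl0 : 0 < dl by rewrite divr_gt0 ?mulr_gt0// ltr_wpDl.
pose g w := fm m w / M.
have mg : measurable_fun setT g by apply: measurable_funM.
have g1 w : `|g w| <= 1.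
  rewrite normrM normfV (gtr0_norm M0) ler_pdivrMr// mul1r.
  by rewrite (le_trans (fm_bnd m w))// ler_nat.
have g0 w : ~ E w -> g w = 0.
  by move=> Ew; rewrite /g /fm /f0 patchE memNset// normr0 ler0n mul0r.
have [t ht] := dense_sq mg g1 g0 (exprn_gt0 2 dl0).
have [mt [C tC] t0] := ev_prop t.
have [z hz] := dec_surj m.+1%:R.
exists (GenTree.Node z [:: GenTree.Node 0 [::]; t]).
pose q w := (g w - ev t w) * (g w - ev t w).
have mq : measurable_fun setT q by apply: measurable_funM; exact: measurable_funB.
have qi : mu.-integrable setT (EFin \o q).
  apply: (@int_bounded _ ((1 + C) * (1 + C))) => // w.
  have h2 : `|g w - ev t w| <= 1 + C by rewrite (le_trans (ler_normB _ _))// lerD.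
  by rewrite normrM ler_pM.
pose k1 w := `|fm m w - f0 w|; pose k2 w := M / 2 * dl + M / 2 / dl * q w.
have k1i : mu.-integrable setT (EFin \o k1).
  apply: (integrable_le_norm (g := fun w => `|fm m w| + `|f0 w|)).
  - by apply: measurableT_comp => //; exact: measurable_funB.
  - exact: (integrableD measurableT (integrable_abse (fmi m)) (integrable_abse f0i)).
  - by move=> w; rewrite normr_id ler_normB.
have k3i : mu.-integrable setT (EFin \o (fun w => M / 2 / dl * q w)).
  by apply: (eq_integrable _ (fun w => (M / 2 / dl)%:E * (q w)%:E)%E) => //; exact: integrableZl.
have cti (c : R) : mu.-integrable setT (EFin \o cst c) by exact: finite_measure_integrable_cst.
have k2i : mu.-integrable setT (EFin \o k2).
  by apply: (eq_integrable _ (fun w => (M / 2 * dl)%:E + (M / 2 / dl * q w)%:E)%E) => //;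
    apply: integrableD => //; exact: cti.
have k12 : (\int[mu]_w (k1 w + k2 w)%:E < e%:E)%E.
  rewrite integral_Rintegral; last first.
    by apply: (eq_integrable _ (fun w => (k1 w)%:E + (k2 w)%:E)%E) => //; apply: integrableD.
  have k2E : \int[mu]_w k2 w = M / 2 * dl * muT + M / 2 / dl * \int[mu]_w q w.
    by rewrite -RintegralZl// /muT -Rintegral_cst// -(RintegralD measurableT (cti _) k3i).
  rewrite lte_fin RintegralD// k2E; have : M / 2 / dl * \int[mu]_w q w <= M / 2 / dl * dl ^+ 2.
    have c0 : 0 <= M / 2 / dl by exact: divr_ge0 (divr_ge0 (ltW M0) _) (ltW dl0).
    exact: (ler_wpM2l c0 ht).
  have -> : M / 2 / dl * dl ^+ 2 = M / 2 * dl by field; rewrite gt_eqF.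
  have : M / 2 * dl * muT + M / 2 * dl = e / 4.
    by rewrite /dl; field; rewrite !gt_eqF// ltr_wpDl.
  by move: hm; rewrite -/(\int[mu]_w k1 w); move: (\int[mu]_w k1 w) (M / 2 / dl * _) => *; lra.
apply: le_lt_trans k12.
apply: (@le_trans _ _ (\int[mu]_(w in E) (k1 w + k2 w)%:E)%E).
  apply: ge0_le_integral => //.
  - apply/measurable_EFinP; apply: measurableT_comp => //.
    apply: measurable_funB; first exact/measurable_EFinP/(measurable_int mu fi).
    have [mu' _ _] := ev_prop (GenTree.Node z [:: GenTree.Node 0 [::]; t]).
    exact: measurable_funTS.
  - apply/measurable_EFinP; apply: measurable_funTS; apply: measurable_funD.
      exact/measurable_EFinP/(measurable_int mu k1i).
    exact/measurable_EFinP/(measurable_int mu k2i).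
  - move=> w Ew; rewrite lee_fin /= add0r hz ratr_nat.
    have -> : f w = f0 w by rewrite /f0 patchE mem_set.
    have -> : f0 w - M * ev t w = (f0 w - fm m w) + M * (g w - ev t w).
      by rewrite /g; field; rewrite gt_eqF.
    rewrite (le_trans (ler_normD _ _))// distrC lerD// normrM (gtr0_norm M0).
    rewrite /k2 /q -expr2 -(real_normK (num_real (g w - ev t w))).
    have -> : M / 2 * dl + M / 2 / dl * `|g w - ev t w| ^+ 2 =
        M * `|g w - ev t w| + M / (2 * dl) * (dl - `|g w - ev t w|) ^+ 2.
      by field; rewrite gt_eqF.
    rewrite lerDl; apply: mulr_ge0 (sqr_ge0 _).
    exact: divr_ge0 (ltW M0) (mulr_ge0 (ler0n _ 2) (ltW dl0)).
apply: ge0_subset_integral => //.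
  apply/measurable_EFinP; apply: measurable_funD.
    exact/measurable_EFinP/(measurable_int mu k1i).
  exact/measurable_EFinP/(measurable_int mu k2i).
move=> w _; rewrite lee_fin; apply: addr_ge0 (normr_ge0 _) _; apply: addr_ge0.
  exact: mulr_ge0 (divr_ge0 (ltW M0) (ler0n _ 2)) (ltW dl0).
apply: mulr_ge0; first exact: divr_ge0 (divr_ge0 (ltW M0) (ler0n _ 2)) (ltW dl0).
by rewrite /q -expr2 sqr_ge0.
Qed.

End Orthogonal.

(** Without such a [th], the rational lattice generated by the [h n] would be dense in the
    integrable functions on [E], and it is countable. Saturation is used in this form: countably
    many linear constraints leave room for a nonzero bounded function supported in [E]. *)
Lemma saturated_orthogonal (E : set T) (h : nat -> T -> R) : saturated mu ->
  measurable E -> (0 < mu E)%E -> (forall n, measurable_fun setT (h n)) ->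
  (forall n w, ~ E w -> h n w = 0) -> (forall n, exists C, forall w, `|h n w| <= C) ->
  exists th : T -> R, [/\ measurable_fun setT th, forall w, `|th w| <= 1,
    forall w, ~ E w -> th w = 0, forall n, \int[mu]_w (th w * h n w) = 0 &
    ~ {ae mu, forall w, th w = 0}].
Proof.
move=> sat mE muE mh hE h_bnd; apply: contrapT => no; apply: (sat E mE muE).
pose dec n : rat := odflt 0 (unpickle n).
have dec_surj q : exists n, dec n = q by exists (pickle q); rewrite /dec pickleK.
pose g n := lattice_term h dec (odflt (GenTree.Leaf 0%N) (unpickle n)).
have ev_prop := lattice_term_prop dec mh hE h_bnd.
exists g; split.
  move=> n; have [m1 [C m2] _] := ev_prop (odflt (GenTree.Leaf 0%N) (unpickle n)).
  by apply: integrableS (int_bounded m1 m2).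
move=> f fi e e0; have [|t ht] := lattice_term_dense dec_surj mE mh hE h_bnd _ fi e0.
  by move=> th h1 h2 h3 h4; apply: contrapT => h5; apply: no; exists th.
by exists (pickle t); rewrite /g pickleK.
Qed.

End Saturation.

(** * Integrals of dominated functionals and nearest points in the dual *)

Section DominatedDual.
Context {R : realType} {X : normedModType R} {d : measure_display} {T : measurableType d}.
Variables (mu : {measure set T -> \bar R}) (k : T -> R) (f : T -> dual X).
Hypotheses (k_int : mu.-integrable setT (EFin \o k)) (fk : forall w, `|f w| <= k w)
  (mf : forall u, measurable_fun setT (fun w => f w u : R)).

Lemma dominated_le w u : `|f w u : R| <= k w * `|u|.
Proof. by rewrite (le_trans (dual_norm_ub _ _))// ler_wpM2r. Qed.

Lemma dominated_integrable u : mu.-integrable setT (EFin \o (fun w => f w u : R)).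
Proof.
apply: (integrable_le_norm (g := fun w => `|u| * k w)) (mf u) _ _.
  by apply: (eq_integrable _ (fun w => `|u|%:E * (k w)%:E)%E) => //; exact: integrableZl.
by move=> w; rewrite mulrC dominated_le.
Qed.

Lemma dominated_integral_le u : `|\int[mu]_w (f w u : R)| <= (\int[mu]_w k w) * `|u|.
Proof.
have iu := dominated_integrable u.
apply: le_trans (le_normr_Rintegral _ iu) _ => //; rewrite -RintegralZr//.
apply: le_Rintegral => //.
- exact: integrable_abse iu.
- by apply: (eq_integrable _ (fun w => (k w)%:E * `|u|%:E)%E) => //; exact: integrableZr.
- by move=> w _; exact: dominated_le.
Qed.

Lemma dominated_dual_integral : exists y : dual X, forall u, y u = \int[mu]_w (f w u : R).
Proof.
apply: (dual_of (f := fun u => \int[mu]_w (f w u : R)) (M := \int[mu]_w k w)).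
- move=> u v; rewrite -RintegralD//; try exact: dominated_integrable.
  by apply: eq_Rintegral => w _; rewrite dual_add.
- move=> a u; rewrite -RintegralZl//; last exact: dominated_integrable.
  by apply: eq_Rintegral => w _; rewrite dual_scale.
- by move=> u; rewrite (le_trans (ler_norm _))// dominated_integral_le.
Qed.

End DominatedDual.

Section FrankWolfe.
Context {R : realType} {X : completeNormedModType R}.
Variable x : nat -> X.
Hypothesis dx : dense_seq x.
Local Notation v := (unit_seq x).

(** Completeness of [X] makes the weighted series of the [v n] converge to a vector representing the
    functional. Thus the derivatives of the Hilbert norm are evaluations at points of [X]. *)
Lemma weighted_vector (r : nat -> R) M : (forall n, `|r n| <= M) ->
  exists z : X, forall p : dual X, p z = wsum (fun n => r n * p (v n)).
Proof.
move=> rM; have M0 : 0 <= M := le_trans (normr_ge0 _) (rM 0%N).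
pose a n : X := (r n / 2 ^+ n.+1) *: v n.
have ca : cvgn (series a).
  apply: normed_cvg; apply: (series_le_cvg (v_ := geometric M 2^-1)).
  - by move=> n; rewrite normr_ge0.
  - by move=> n; rewrite /geometric /= mulr_ge0// exprn_ge0// invr_ge0.
  - move=> n; rewrite /geometric /= /a normrZ normrM.
    apply: (@le_trans _ _ (M * 2^-1 ^+ n * 1)); last by rewrite mulr1.
    rewrite ler_pM ?mulr_ge0 ?unit_seq_le1// ler_pM// ger0_norm ?invr_ge0 ?exprn_ge0//.
    by rewrite exprVn lef_pV2 ?posrE ?exprn_gt0// ler_eXn2l// ltr1n.
  - by apply: is_cvg_geometric_series; rewrite ger0_norm ?invr_ge0// invf_lt1// ltr1n.
exists (limn (series a)) => p.
have pv n : `|r n * p (v n)| <= M * `|p|.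
  rewrite normrM ler_pM// (le_trans (dual_norm_ub _ _))// ler_piMr// unit_seq_le1//.
apply: (cvg_unique _ _ (cvg_wsum pv)) => //.
have -> : series (fun n => r n * p (v n) / 2 ^+ n.+1) = (fun m => p (series a m) : R).
  apply/funext => m; rewrite /series /= linear_sum; apply: eq_bigr => i _.
  by rewrite [RHS]dual_scale mulrAC.
by apply: (cvg_comp _ _ ca); exact: dual_continuous.
Qed.

(** Let [z] represent the weighted difference of [p] and [y]. Minimality makes [p z] the least value
    at [z] on [K], while [y (- z)] is at most the supremum of the [q (- z)]; thus [p z - y z <= 0],
    and this number is the squared distance. The vector [z] plays the part of a separating
    hyperplane. *)
Lemma nearest_dual_eq (K : set (dual X)) (y p : dual X) : K p ->
  (forall q t, K q -> 0 <= t <= 1 -> K (p + t *: (q - p))) ->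
  (forall q, K q -> wsum (fun n => ((p (v n) : R) - y (v n)) ^+ 2) <=
                    wsum (fun n => ((q (v n) : R) - y (v n)) ^+ 2)) ->
  (forall u e, 0 < e -> exists2 q, K q & y u <= q u + e) -> p = y.
Proof.
move=> Kp Kconv p_min y_le; pose r n : R := (p (v n) : R) - y (v n).
have bnd (q : dual X) n : `|q (v n) : R| <= `|q|.
  by rewrite (le_trans (dual_norm_ub _ _))// ler_piMr// unit_seq_le1.
have rM n : `|r n| <= `|p| + `|y| by rewrite (le_trans (ler_normB _ _))// lerD.
have [z hz] := weighted_vector rM.
have first_order q : K q -> p z <= q z.
  move=> Kq; rewrite -subr_ge0; pose g := q - p.
  have ez : q z - p z = wsum (fun n => r n * g (v n)) by rewrite -hz.
  rewrite ez; set c := wsum _.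
  pose B := `|p| + `|y| + `|g|; pose M := B * B.
  have rB n : `|r n| <= B by rewrite (le_trans (rM n))// lerDl.
  have gB n : `|g (v n) : R| <= B by rewrite (le_trans (bnd g n))// lerDr addr_ge0.
  have rr n : `|r n * r n| <= M by rewrite normrM ler_pM.
  have rg n : `|r n * g (v n)| <= M by rewrite normrM ler_pM.
  have gg n : `|g (v n) * g (v n)| <= M by rewrite normrM ler_pM.
  have M0 : 0 <= M := le_trans (normr_ge0 _) (rr 0%N).
  pose D := wsum (fun n => g (v n) * g (v n)).
  have key t : 0 <= t <= 1 -> 0 <= t * (2 * c + t * D).
    move=> t01; have := p_min _ (Kconv q t Kq t01).
    have -> : (fun n => (((p + t *: (q - p)) (v n) : R) - y (v n)) ^+ 2) =
        (fun n => r n ^+ 2 + (2 * t * (r n * g (v n)) + t * t * (g (v n) * g (v n)))).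
      by apply/funext => n; rewrite dualDE dualZE -/g /r; ring.
    have b1 n : `|2 * t * (r n * g (v n))| <= `|2 * t| * M by rewrite normrM ler_wpM2l.
    have b2 n : `|t * t * (g (v n) * g (v n))| <= `|t * t| * M by rewrite normrM ler_wpM2l.
    have B1 : 0 <= `|2 * t| * M by rewrite mulr_ge0.
    have B2 : 0 <= `|t * t| * M by rewrite mulr_ge0.
    rewrite (@wsumD _ _ _ (M + (`|2 * t| * M + `|t * t| * M))).
    - rewrite (@wsumD _ _ _ (`|2 * t| * M + `|t * t| * M)) ?(wsumZ _ rg) ?(wsumZ _ gg).
      + by rewrite lerDl -/c -/D; move: c D => *; lra.
      + by move=> n; rewrite (le_trans (b1 n))// lerDl.
      + by move=> n; rewrite (le_trans (b2 n))// lerDr.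
    - by move=> n; rewrite expr2 (le_trans (rr n))// lerDl addr_ge0.
    - by move=> n; rewrite (le_trans (ler_normD _ _))// (le_trans (lerD (b1 n) (b2 n)))// lerDr.
  have D0 : 0 <= D by apply: (wsum_ge0 gg) => n; rewrite -expr2 sqr_ge0.
  rewrite leNgt; apply/negP => c0.
  (* With this step [t * D <= - c], so [2 * c + t * D] would be negative. *)
  pose t := Num.min 1 (- c / (D + 1)).
  have D1 : 0 < D + 1 by rewrite ltr_wpDl.
  have t0 : 0 < t by rewrite lt_min ltr01 divr_gt0// oppr_gt0.
  have := key t; rewrite (ltW t0) ge_min lexx => /(_ isT).
  rewrite pmulr_rge0//.
  have : t * D <= - c.
    have : t * D <= t * (D + 1) by rewrite ler_wpM2l ?(ltW t0)// lerDl.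
    move=> /le_trans; apply; rewrite -ler_pdivlMr// ge_min lexx orbT//.
  by move: (t * D) => *; lra.
have le0 : p z - y z <= 0.
  apply/ler_addgt0Pl => e e0; rewrite addr0.
  have [q Kq] := y_le (- z) e e0; rewrite !dual_opp; have := first_order q Kq.
  by move: (p z : R) (q z : R) (y z : R) => *; lra.
apply/eqP; rewrite -subr_eq0; apply/eqP; apply: (unit_seq_dual_eq0 dx) => n.
have rr m : `|r m * r m| <= (`|p| + `|y|) * (`|p| + `|y|) by rewrite normrM ler_pM.
have h1 : wsum (fun n => r n * r n) <= 0.
  by have <- : p z - y z = wsum (fun n => r n * r n) by rewrite -dualBE hz.
have h2 : r n * r n / 2 ^+ n.+1 <= wsum (fun n => r n * r n).
  by apply: (le_wsum_term n rr) => m; rewrite -expr2 sqr_ge0.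
suff r0 : r n = 0 :> R by exact: r0.
apply/eqP; rewrite -sqrf_eq0 expr2.
apply/eqP/le_anti; rewrite -{2}expr2 sqr_ge0 andbT.
by move: (le_trans h2 h1); rewrite pmulr_lle0// invr_gt0 exprn_gt0.
Qed.

End FrankWolfe.

(** * Measurable selections of minorants with a prescribed integral *)

Section Selections.
Context {R : realType} {X : completeNormedModType R} {d : measure_display}
  {T : measurableType d}.
Variables (mu : {finite_measure set T -> \bar R}) (x : nat -> X) (l : T -> R) (s : T -> X -> R).
Hypotheses (dx : dense_seq x) (l0 : forall w, 0 <= l w)
  (l_int : mu.-integrable setT (EFin \o l)) (ss : forall w, sublinear (l w) (s w))
  (ms : forall u, measurable_fun setT (s ^~ u)).
Local Notation v := (unit_seq x).
Implicit Types (f g : T -> dual X).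

Definition selection f := (forall w u, f w u <= s w u) /\
  forall u, measurable_fun setT (fun w => f w u : R).

Lemma selection_norm f w : selection f -> `|f w| <= l w.
Proof.
move=> [fs _]; apply: dual_norm_le => // u; apply: le_trans (fs w u) _.
by have [_ _] := ss w; exact.
Qed.

Lemma selection_integrable f u : selection f ->
  mu.-integrable setT (EFin \o (fun w => f w u : R)).
Proof.
move=> sf; apply: (dominated_integrable l_int) => [w|]; first exact: selection_norm.
by case: sf.
Qed.

Lemma selection_dual_integral f : selection f ->
  exists y : dual X, forall u, y u = \int[mu]_w (f w u : R).
Proof.
move=> sf; apply: (dominated_dual_integral l_int) => [w|]; first exact: selection_norm.
by case: sf.
Qed.

Lemma integrable_sublinear u : mu.-integrable setT (EFin \o s^~ u).
Proof.
apply: (integrable_le_norm (g := fun w => `|u| * l w)) (ms u) _ _.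
  by apply: (eq_integrable _ (fun w => `|u|%:E * (l w)%:E)%E) => //; exact: integrableZl.
by move=> w; rewrite mulrC; exact: sublinear_norm_le (ss w).
Qed.

(** The lexicographically maximal minorant, with [u] placed first in the sequence, is given by
    countable infima and is therefore measurable in [w]. *)
Lemma max_selection u : exists2 f, selection f & forall w, f w u = s w u.
Proof.
pose z n := if n is n'.+1 then x n' else u.
have dz : dense_seq z by move=> a e e0; have [n ?] := dx a e0; exists n.+1.
have /choice[f hf] : forall w, exists e : dual X, forall a, e a = face_limit (s w) z a.
  by move=> w; exact: face_limit_dual (ss w) dz.
have hf' w := face_limit_extreme (ss w) dz (hf w).
exists f => [|w]; last by have [] := hf' w.
split=> [w a|a]; first by have [[]] := hf' w.
by under eq_fun do rewrite hf; exact: measurable_face_limit ss ms.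
Qed.

Lemma selection_conv f g t : selection f -> selection g -> 0 <= t <= 1 ->
  selection (fun w => f w + t *: (g w - f w)).
Proof.
move=> [fs mf] [gs mg] /andP[t0 t1]; split=> [w u|u].
  rewrite dualDE dualZE dualBE; have := fs w u; have := gs w u.
  by move: (f w u : R) (g w u : R) (s w u) => *; nra.
have : measurable_fun setT (fun w => (f w u : R) + t * ((g w u : R) - f w u)).
  by apply: measurable_funD => //; apply: measurable_funM => //; exact: measurable_funB.
exact.
Qed.

Let b w : R := 1 + l w.
Let b_int : mu.-integrable setT (EFin \o b).
Proof.
apply: (eq_integrable _ (fun w => 1%:E + (l w)%:E)%E) => //; apply: integrableD => //.
exact: finite_measure_integrable_cst.
Qed.
Let b1 w : 1 <= b w. Proof. by rewrite lerDl. Qed.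
Let lb w : l w <= b w. Proof. by rewrite lerDr. Qed.
(** A selection is determined by its values on the unit sequence; domination by [l] places it in the
    weighted space for [b = 1 + l]. *)
Let emb f : T -> nat -> R^o := fun w n => f w (v n).
Local Notation ip := (sqip mu b).

Let emb_le f w n : selection f -> `|emb f w n : R| <= 1 * b w.
Proof.
move=> sf; rewrite mul1r (le_trans _ (lb w))// (le_trans (dual_norm_ub _ _))//.
rewrite (le_trans (ler_wpM2l _ (unit_seq_le1 x n)))// mulr1; exact: selection_norm.
Qed.

Let sqfun_emb f : selection f -> sqfun b (emb f).
Proof.
move=> sf; split; first by case: sf => _ mf n; exact: mf.
by exists 1 => w n; exact: emb_le.
Qed.

(** Off the null set the coordinate limits define a functional by [dual_ptlim]; on it [f 0] is kept,
    so that the limit is a selection for every [w]. The integrals converge by domination along the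
    same subsequence. *)
Let selection_complete (f : nat -> T -> dual X) : (forall k, selection (f k)) ->
  (forall e, 0 < e -> exists K, forall j k, (K <= j)%N -> (K <= k)%N ->
     ip (emb (f j) - emb (f k)) (emb (f j) - emb (f k)) <= e) ->
  exists g (phi : nat -> nat), [/\ selection g, norm_cvg ip (emb \o f) (emb g),
    forall i, (i <= phi i)%N & forall u,
      (fun i => \int[mu]_w (f (phi i) w u : R)) @ \oo --> \int[mu]_w (g w u : R)].
Proof.
move=> sf f_cauchy.
have [||G [phi [A [[SG GC phi_ge] [mA A0] GA Gl FG]]]] :=
    @sqip_complete _ _ _ mu b b_int b1 (emb \o f) 1 _ _ f_cauchy.
- by move=> k n; have [_ mf] := sf k; exact: mf.
- by move=> k w n; exact: emb_le.
have /choice[g hg] : forall w, exists q : dual X, (A w -> q = f 0%N w) /\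
    (~ A w -> forall u, (fun i => f (phi i) w u : R) @ \oo --> (q u : R)).
  move=> w; have [Aw|Aw] := pselect (A w); first by exists (f 0%N w).
  have [||q _ hq] := dual_ptlim (p := fun i => f (phi i) w) (M := l w) dx.
  - by move=> i; exact: selection_norm.
  - move=> n; rewrite (unit_seqE x n).
    have -> : (fun i => f (phi i) w ((1 + `|x n|) *: v n) : R) =
        (fun i => (1 + `|x n|) * emb (f (phi i)) w n : R).
      by apply/funext => i; rewrite dual_scale.
    by apply: cvgP; apply: cvgMl_tmp; exact: Gl.
  by exists q.
pose h i w u : R := if w \in A then f 0%N w u else f (phi i) w u.
have hlim w u : (fun i => h i w u) @ \oo --> (g w u : R).
  have [gA gAc] := hg w; rewrite /h; have [/set_mem/gA ->|/negP Aw] := boolP (w \in A).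
    exact: cvg_cst.
  by apply: gAc => /mem_set.
have hs i w u : h i w u <= s w u.
  by have [fs _] := sf (phi i); have [f0s _] := sf 0%N; rewrite /h; case: ifP.
have mh i u : measurable_fun setT (fun w => h i w u).
  have [_ mf] := sf (phi i); have [_ mf0] := sf 0%N.
  by apply: measurable_fun_ifT => //; exact: measurable_mem.
have sg : selection g.
  split=> [w u|u].
    apply: (@closed_cvg _ _ \oo _ (fun i => h i w u) [set z | z <= s w u]) => //.
    by apply: nearW => i; exact: hs.
  by apply: measurable_fun_cvg (fun i => mh i u) _ => w _; exact: hlim.
have GE : G = emb g.
  apply/funext => w; have [gA gAc] := hg w; have [Aw|Aw] := pselect (A w).
    by rewrite GA// /emb gA.
  by apply/funext => n; apply: (cvg_unique _ (Gl w Aw n)) => //; exact: gAc.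
exists g, phi; split => //; first by rewrite -GE.
move=> u; have [|||||_ _] := @dominated_convergence _ _ _ mu setT measurableT
    (fun i w => (f (phi i) w u : R)%:E) (fun w => (g w u : R)%:E) (fun w => (`|u| * l w)%:E).
- by move=> i; apply/measurable_EFinP; have [_ mf] := sf (phi i).
- by apply/measurable_EFinP; case: sg.
- exists A; split => // w; apply: contra_notP => Aw _; apply: cvg_EFin; first exact: nearW.
  by have [_ gAc] := hg w; exact: gAc.
- by apply: (eq_integrable _ (fun w => `|u|%:E * (l w)%:E)%E) => //; exact: integrableZl.
- apply: aeW => w i _; rewrite lee_fin mulrC; apply: dominated_le => w'.
  exact: selection_norm.
by rewrite (integral_Rintegral (selection_integrable u sg)) => /fine_cvg.
Qed.

(* Minimize the distance of the integral to y in the metric of nearest_dual_eq. *)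
Lemma selection_with_integral (y : dual X) : (forall u, y u <= \int[mu]_w s w u) ->
  exists2 f, selection f & forall u, y u = \int[mu]_w (f w u : R).
Proof.
move=> ys; pose L := \int[mu]_w l w.
pose Q (F : T -> nat -> R^o) := wsum (fun n => ((\int[mu]_w (F w n : R)) - y (v n)) ^+ 2).
pose C : set (T -> nat -> R^o) := [set F | exists2 f, F = emb f & selection f].
have L0 : 0 <= L by exact: Rintegral_ge0.
have int_le f n : selection f -> `|\int[mu]_w (f w (v n) : R)| <= L.
  move=> sf; apply: le_trans (dominated_integral_le l_int _ _ (v n)) _.
  - by move=> w; exact: selection_norm.
  - by case: sf.
  - by rewrite ler_piMr// unit_seq_le1.
have y_le n : `|y (v n) : R| <= `|y|.
  by rewrite (le_trans (dual_norm_ub _ _))// ler_piMr// unit_seq_le1.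
have termE a n : `|a| <= L -> `|(a - y (v n)) ^+ 2| <= (L + `|y|) ^+ 2.
  move=> aL; rewrite normrX ler_sqr ?nnegrE ?addr_ge0//.
  by rewrite (le_trans (ler_normB _ _))// lerD.
have term_le f n : selection f ->
    `|((\int[mu]_w (emb f w n : R)) - y (v n)) ^+ 2| <= (L + `|y|) ^+ 2.
  by move=> sf; apply: termE; exact: int_le.
have mid (a c z : R) : (2^-1 * (a + c) - z) ^+ 2 <= 2^-1 * ((a - z) ^+ 2 + (c - z) ^+ 2).
  rewrite -subr_ge0; have -> : 2^-1 * ((a - z) ^+ 2 + (c - z) ^+ 2) - (2^-1 * (a + c) - z) ^+ 2 =
    ((a - c) / 2) ^+ 2 by field.
  exact: sqr_ge0.
have [f0 sf0 _] := max_selection 0.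
have half01 : 0 <= (2^-1 : R) <= 1 by rewrite invr_ge0 ler0n invf_le1// ler1n.
have [||||||F [f -> sf] f_min] := convex_min (@sqfunD _ _ _ b)
    (@sqfunZ _ _ _ b) (@sqipC _ _ _ mu b) (@sqipDl _ _ _ mu b b_int b1)
    (@sqipZl _ _ _ mu b b_int b1) (@sqip_ge0 _ _ _ mu b b1) (C := C)
    (B := \int[mu]_w b w) _ _ _ (Q := Q).
- by move=> _ [f -> sf]; exact: sqfun_emb.
- by exists (emb f0), f0.
- move=> _ [f -> sf]; apply: le_Rintegral => //; first exact: integrable_sqker (sqfun_emb sf) (sqfun_emb sf).
  move=> w _; rewrite (le_trans (ler_norm _))//.
  have h := sqker_le b1 (fun n => emb_le w n sf) (fun n => emb_le w n sf).
  by rewrite (le_trans h)// !mul1r.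
- by move=> _ [f -> sf]; apply: (wsum_ge0 (fun n => term_le f n sf)) => n; rewrite sqr_ge0.
- move=> _ _ [f -> sf] [g -> sg].
  pose h w := f w + 2^-1 *: (g w - f w); have sh : selection h by exact: selection_conv.
  have hE : 2^-1 *: (emb f + emb g) = emb h.
    apply/funext => w; apply/funext => n.
    rewrite /emb dualDE dualZE dualBE -[LHS]/(2^-1 * ((f w (v n) : R) + g w (v n))).
    by move: (f w (v n) : R) (g w (v n) : R) => *; lra.
  rewrite hE; split; first by exists h.
  rewrite -(@wsumD _ _ _ _ (fun n => term_le f n sf) (fun n => term_le g n sg)).
  set a := wsum (fun n => _ + _); have -> : a / 2 = 2^-1 * a by rewrite mulrC.
  have hB n : `|(\int[mu]_w (emb f w n : R) - y (v n)) ^+ 2 +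
      (\int[mu]_w (emb g w n : R) - y (v n)) ^+ 2| <= (L + `|y|) ^+ 2 + (L + `|y|) ^+ 2.
    by rewrite (le_trans (ler_normD _ _))// lerD// term_le.
  rewrite /a -(wsumZ _ hB); apply: (le_wsum (fun n => term_le h n sh)) => n.
    by rewrite normrM (le_trans (ler_wpM2l _ (hB n)))// ger0_norm// mulrC; lra.
  have -> : \int[mu]_w (emb h w n : R) =
      2^-1 * (\int[mu]_w (emb f w n : R) + \int[mu]_w (emb g w n : R)).
    have fi := selection_integrable (v n) sf; have gi := selection_integrable (v n) sg.
    rewrite -RintegralD// -RintegralZl//; last exact: (integrableD measurableT fi gi).
    by apply: eq_Rintegral => w _; rewrite -hE.
  exact: mid.
- move=> F CF F_cauchy; have /choice[f hf] : forall k, exists f, F k = emb f /\ selection f.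
    by move=> k; have [f ? ?] := CF k; exists f.
  have FE : F = emb \o f by apply/funext => k; exact: (hf k).1.
  have sf k := (hf k).2; move: F_cauchy; rewrite FE => F_cauchy.
  have [g [phi [sg _ phi_ge g_lim]]] := selection_complete sf F_cauchy.
  exists (emb g); first by exists g.
  move=> K e e0.
  have lsc : \forall i \near \oo, Q (emb g) <= Q (emb (f (phi i))) + e.
    apply: (wsum_lsc (fun n => term_le g n sg)) e0.
      by apply: nearW => i n; exact: term_le.
    move=> n r r0.
    have : (fun i => (\int[mu]_w (emb (f (phi i)) w n : R) - y (v n)) ^+ 2) @ \oo -->
        (\int[mu]_w (emb g w n : R) - y (v n)) ^+ 2.
      rewrite expr2; under eq_fun do rewrite expr2.
      by apply: cvgM; apply: cvgB; [exact: g_lim|exact: cvg_cst|exact: g_lim|exact: cvg_cst].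
    move=> /cvgrPdist_le/(_ _ r0); apply: filterS => i.
    by rewrite ler_norml => /andP[_]; rewrite lerBlDl.
  have [N _ /(_ (maxn N K))] := lsc.
  rewrite /= leq_maxl => /(_ isT) h; exists (phi (maxn N K)) => //.
  by rewrite (leq_trans (leq_maxr N K)).
have [p hp] := selection_dual_integral sf; exists f => // u; rewrite -hp.
suff -> : p = y by [].
(* The set of integrals of selections. Maximal selections show that [y] is below its support
   function, as [nearest_dual_eq] requires. *)
pose K : set (dual X) := [set q | exists2 g, selection g &
  forall u, q u = \int[mu]_w (g w u : R)].
apply: (nearest_dual_eq dx (K := K)).
- by exists f.
- move=> q t [g sg hq] t01; exists (fun w => f w + t *: (g w - f w)); first exact: selection_conv.
  move=> a; rewrite dualDE dualZE dualBE hp hq.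
  have fi := selection_integrable a sf; have gi := selection_integrable a sg.
  rewrite -RintegralB// -RintegralZl//; last exact: (integrableB measurableT gi fi).
  rewrite -RintegralD//.
  by apply: (integrableZl measurableT t (integrableB measurableT gi fi)).
- move=> q [g sg hq]; have := f_min _ (ex_intro2 _ _ g erefl sg).
  congr (_ <= _); rewrite /Q; congr wsum; apply/funext => n; congr ((_ - _) ^+ 2).
    by rewrite hp.
  by rewrite hq.
- move=> a e e0; have [g sg ga] := max_selection a.
  have [q hq] := selection_dual_integral sg; exists q; first by exists g.
  rewrite hq; have -> : \int[mu]_w (g w a : R) = \int[mu]_w s w a.
    by apply: eq_Rintegral => w _; exact: ga.
  by rewrite (le_trans (ys a))// lerDl ltW.
Qed.

(* The extremality defect of g at w is measured by the sublinear function tau w. If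
   it is nonzero on a set of positive measure, saturation yields a perturbation of g
   which is orthogonal to the sequence G and does not change the integral. *)
Lemma extreme_selection_with_integral (y : dual X) : saturated mu ->
  (forall u, y u <= \int[mu]_w s w u) ->
  exists f, [/\ selection f, forall u, y u = \int[mu]_w (f w u : R) &
    {ae mu, forall w, extreme_minorant (s w) (f w)}].
Proof.
move=> sat ys; have [f0 sf0 f0y] := selection_with_integral ys.
pose C : set (T -> nat -> R^o) := [set F | exists f,
  [/\ F = emb f, selection f & forall u, y u = \int[mu]_w (f w u : R)]].
have [||||_ [G [[g [-> sg gy]] CG hG]]] := greedy_extreme (@sqfun0 _ _ _ b) (@sqfunD _ _ _ b)
    (@sqfunZ _ _ _ b) (@sqipC _ _ _ mu b) (@sqipDl _ _ _ mu b b_int b1)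
    (@sqipZl _ _ _ mu b b_int b1) (@sqip_ge0 _ _ _ mu b b1) (C := C)
    (B := \int[mu]_w b w) _ _ _ _.
- by move=> _ [f [-> sf _]]; exact: sqfun_emb.
- by exists (emb f0), f0.
- move=> _ [f [-> sf _]]; apply: le_Rintegral => //.
    exact: integrable_sqker (sqfun_emb sf) (sqfun_emb sf).
  move=> w _; rewrite (le_trans (ler_norm _))//.
  have h := sqker_le b1 (fun n => emb_le w n sf) (fun n => emb_le w n sf).
  by rewrite (le_trans h)// !mul1r.
- move=> F CF F_cauchy.
  have /choice[f hf] : forall k, exists f, [/\ F k = emb f, selection f &
      forall u, y u = \int[mu]_w (f w u : R)] by move=> k; exact: CF k.
  have FE : F = emb \o f by apply/funext => k; have [] := hf k.
  have sf k : selection (f k) by have [] := hf k.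
  move: F_cauchy; rewrite FE => F_cauchy.
  have [f' [phi [sf' f'_lim _ int_lim]]] := selection_complete sf F_cauchy.
  exists (emb f') => //; exists f'; split => // u.
  apply: (cvg_unique _ _ (int_lim u)) => //.
  have -> : (fun i => \int[mu]_w (f (phi i) w u : R)) = fun=> (y u : R).
    by apply/funext => i; have [_ _ <-] := hf (phi i).
  exact: cvg_cst.
exists g; split => //; have [gs mg] := sg.
pose p w u := s w u - g w u; pose M w := l w + `|g w|.
have p0 w u : 0 <= p w u by rewrite subr_ge0.
have sp w : sublinear (M w) (p w) by exact: sublinearB.
(* The minorants of [tau w] are exactly the [h] for which [g w + h] and [g w - h] are minorants of
   [s w]. *)
pose tau w := inf_conv x (p w) (p w).
have pp w h : 0 <= p w h + p w h by rewrite addr_ge0.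
have st w : sublinear (M w) (tau w) := sublinear_inf_conv dx (sp w) (sp w) (pp w).
have M2 w : M w <= 2 * l w.
  by rewrite /M; have := selection_norm w sg; move: `|g w| (l w) => *; lra.
have mp u : measurable_fun setT (p^~ u) by exact: measurable_funB.
have mt u : measurable_fun setT (tau^~ u).
  apply: measurable_fun_infs => [w _|n]; last exact: measurable_funD.
  by exists 0 => _ [n _ <-]; rewrite addr_ge0.
suff key n : {ae mu, forall w, tau w (x n) <= 0}.
  apply: filterS (ae_foralln key) => w hw; split => // h h1 h2.
  have hle (h' : dual X) n : (forall u, g w u + h' u <= s w u) ->
      (forall u, g w u - h' u <= s w u) -> h' (x n) <= 0.
    move=> k1 k2; apply: le_trans (hw n); apply: inf_conv_ge => k.
    have := k1 (x n + k); have := k2 k; rewrite /p !dual_add.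
    by move: (g w _ : R) (g w _ : R) (h' _ : R) (h' _ : R) => *; lra.
  apply: (dense_dual_eq0 dx) => n; apply/le_anti; rewrite hle//=.
  rewrite -oppr_le0 -dualNE hle// => u; rewrite dualNE ?opprK//.
(* The bound on [l] makes the constraint functions [H j] bounded. *)
pose E (m : nat) := [set w | 0 < tau w (x n)] `&` [set w | l w <= m%:R].
have ml : measurable_fun setT l by exact/measurable_EFinP/(measurable_int mu l_int).
have mE m : measurable (E m).
  apply: measurableI.
    have := mt (x n) measurableT `]0, +oo[%classic (measurable_itv _); rewrite setTI.
    by congr measurable; apply/seteqP; split=> w /=; rewrite in_itv/= andbT.
  have := ml measurableT `]-oo, m%:R]%classic (measurable_itv _); rewrite setTI.
  by congr measurable; apply/seteqP; split=> w /=; rewrite in_itv.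
suff muE m : mu (E m) = 0%E.
  apply: (@negligibleS _ _ _ mu (\bigcup_m E m)); last first.
    by apply: negligible_bigcup => m; apply/negligibleP; [exact: mE|exact: muE].
  move=> w /= /negP; rewrite -ltNge => tw; exists (Num.bound (l w)) => //; split => //=.
  exact/ltW/archi_boundP.
apply: contrapT => /eqP muE0.
have muE : (0 < mu (E m))%E by rewrite lt_neqAle eq_sym muE0 measure_ge0.
(* [x n] comes first, so that [h w (x n) = tau w (x n)], which is positive on [E m]. *)
pose z k := if k is k'.+1 then x k' else x n.
have dz : dense_seq z by move=> a e e0; have [k ?] := dx a e0; exists k.+1.
have /choice[h hh] : forall w, exists e : dual X, forall a, e a = face_limit (tau w) z a.
  by move=> w; exact: face_limit_dual (st w) dz.
have hx w : h w (x n) = tau w (x n) by have [] := face_limit_extreme (st w) dz (hh w).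
have ht w u : h w u <= tau w u by have [[]] := face_limit_extreme (st w) dz (hh w).
have hp w u : `|h w u : R| <= p w u.
  rewrite ler_norml; apply/andP; split.
    rewrite lerNl -dual_opp (le_trans (ht w _))//.
    by have := inf_conv_le_r dx (sp w) (sp w) (pp w) (- u); rewrite opprK.
  by rewrite (le_trans (ht w _))//; exact: (inf_conv_le_l dx (sp w) (sp w) (pp w)).
have mh u : measurable_fun setT (fun w => h w u : R).
  by under eq_fun do rewrite hh; exact: measurable_face_limit st mt.
have hl w : `|h w| <= 2 * l w.
  apply: dual_norm_le => [|u]; first by rewrite mulr_ge0.
  have [_ _ tM] := st w; rewrite (le_trans (ht w u))// (le_trans (tM u))//.
  by rewrite ler_wpM2r.
have hb w k : `|emb h w k : R| <= 2 * b w.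
  rewrite /emb (le_trans (dual_norm_ub _ _))// (le_trans (ler_wpM2l _ (unit_seq_le1 x k)))// mulr1.
  by rewrite (le_trans (hl w))// ler_pM2l.
have Sh : sqfun b (emb h) by split; [move=> k; exact: mh|exists 2].
have SG i : sqfun b (G i) by have [f [-> sf _]] := CG i; exact: sqfun_emb.
have GbE i w k : `|G i w k : R| <= 1 * b w by have [f [-> sf _]] := CG i; exact: emb_le.
(* Odd indices encode orthogonality to the [G i], even ones the vanishing of the integral of the
   perturbation at the [v i]. *)
pose H j w : R := \1_(E m) w *
  (if odd j then sqker b (emb h) (G j./2) w else h w (v j./2) : R).
have [|||th [mth th1 thE thH thN]] := saturated_orthogonal (h := H) sat (mE m) muE.
- move=> j; apply: measurable_funM; first exact: measurable_indic.
  by case: (odd j); [exact: (measurable_sqker b_int b1 Sh (SG _))|exact: mh].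
- by move=> j w Ew; rewrite /H indicE memNset// mul0r.
- move=> j; exists (2 * (1 + m%:R)) => w; rewrite /H indicE.
  have [/set_mem[_ /= lm]|_] := boolP (w \in E m); last by rewrite mul0r normr0 mulr_ge0// addr_ge0.
  rewrite mul1r; have bm : 2 * b w <= 2 * (1 + m%:R) by rewrite ler_pM2l// lerD2l.
  case: (odd j); last exact: le_trans (hb w _) bm.
  rewrite (le_trans (sqker_le b1 (hb w) (GbE j./2 w)))// mulr1//.
have thHE j : \int[mu]_w (th w * (if odd j then sqker b (emb h) (G j./2) w else h w (v j./2) : R)) = 0.
  rewrite -(thH j); apply: eq_Rintegral => w _; rewrite /H indicE.
  have [_|/negP Ew] := boolP (w \in E m); first by rewrite mul1r.
  by rewrite thE ?mul0r// => /mem_set.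
(* As [|th| <= 1], [g + k] is again a selection with integral [y]; [hG] forces [k] to be null, hence
   [th] too, since [h w] is nonzero on [E m]. *)
pose k w := th w *: h w.
have mk u : measurable_fun setT (fun w => k w u : R) := measurable_funM mth (mh u).
have kl w : `|k w| <= 2 * l w.
  by rewrite normrZ (le_trans _ (hl w))// ler_piMl.
have l2_int : mu.-integrable setT (EFin \o (fun w => 2 * l w)).
  by apply: (eq_integrable _ (fun w => 2%:E * (l w)%:E)%E) => //; exact: integrableZl.
have k_int u : \int[mu]_w (k w u : R) = 0.
  have [q hq] := dominated_dual_integral l2_int kl mk.
  rewrite -hq; suff -> : q = 0 by [].
  apply: (unit_seq_dual_eq0 dx) => i; rewrite hq -[RHS](thHE i.*2).
  by apply: eq_Rintegral => w _; rewrite odd_double doubleK.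
have sf : selection (fun w => g w + k w).
  split=> [w u|u]; last exact: measurable_funD (mg u) (mk u).
  rewrite dualDE -lerBrDl (le_trans _ (hp w u))// (le_trans (ler_norm _))//.
  by rewrite normrM ler_piMl.
have Sk : sqfun b (emb k).
  split; first by move=> i; exact: mk.
  exists 2 => w i; rewrite /emb (le_trans (dual_norm_ub _ _))//.
  rewrite (le_trans (ler_wpM2l _ (unit_seq_le1 x i)))// mulr1.
  by rewrite (le_trans (kl w))// ler_pM2l.
have k0 : sqip mu b (emb k) (emb k) = 0.
  apply: hG Sk _ _ => [i|].
    have := thHE i.*2.+1; rewrite /= odd_double/= uphalf_double => hi; rewrite -[RHS]hi.
    apply: eq_Rintegral => w _; rewrite /sqker mulrA; congr (_ / _).
    have bnd j : `|(emb h w j : R) * G i w j| <= (2 * b w) * (1 * b w) by rewrite normrM ler_pM.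
    by rewrite -(wsumZ _ bnd); congr wsum; apply/funext => j; rewrite mulrA.
  exists (fun w => g w + k w); split => // u.
  rewrite gy -[LHS]addr0 -(k_int u) -RintegralD//; first exact: selection_integrable.
  exact: dominated_integrable l2_int kl mk u.
apply: thN; apply: filterS (sqip_term_ae0 b_int b1 Sk k0) => w {}k0.
have [Ew|/thE//] := pselect (E m w).
have : k w = 0 by apply: (unit_seq_dual_eq0 dx) => i; exact: k0.
move=> /(congr1 (fun q : dual X => q (x n) : R)); rewrite dualZE hx dual0E => /eqP.
by rewrite mulf_eq0 => /orP[/eqP//|]; have [/= /gt_eqF ->] := Ew.
Qed.

End Selections.

(** * Weak-star compactness of sets of minorants *)

Section WeakStarCompact.
Context {R : realType} {X : completeNormedModType R}.
Variables (x : nat -> X) (M : R) (s : X -> R).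
Hypotheses (dx : dense_seq x) (ss : sublinear M s).
Local Notation v := (unit_seq x).
Let K : set (dual X) := [set p | forall u, p u <= s u].

Let K_le (p : dual X) u : K p -> - s (- u) <= p u <= s u.
Proof. by move=> Kp; rewrite Kp andbT lerNl -dual_opp. Qed.

Lemma convex_minorants : convex_set K.
Proof.
move=> p q t; rewrite !inE => Kp Kq u.
rewrite -[leLHS]/(t%:num * (p u : R) + (1 - t%:num) * q u).
have t0 : 0 <= t%:num :> R by []; have t1 : t%:num <= 1 :> R by [].
have := Kp u; have := Kq u; move: (p u : R) (q u : R) (s u) (t%:num) t0 t1 => *; nra.
Qed.

Lemma minorants_neq0 : K !=set0.
Proof. by have [e [es _] _] := hahn_banach_extreme 0 dx ss; exists e. Qed.

Lemma support_fun_minorants h : support_fun h K = (s h)%:E.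
Proof.
apply/le_anti/andP; split.
  by apply: ge_ereal_sup => _ [p Kp <-]; rewrite lee_fin.
have [e [es _] eh] := hahn_banach_extreme h dx ss.
by apply: ereal_sup_ubound; exists e => //; rewrite eh.
Qed.

(** Along an ultrafilter every evaluation converges, since its values stay in a segment; the limits
    form a linear functional below [s]. *)
Lemma wstar_compact_minorants : wstar_compact K.
Proof.
rewrite /wstar_compact compact_ultra => F UF FK.
have ev u : exists c : R, (fun p : dual X => p u : R) @ F --> c.
  have FI : ((fun p : dual X => p u : R) @ F) `[- s (- u), s u]%classic.
    by apply: (@filterS _ F _ K) FK => p Kp; have := K_le u Kp; rewrite /= in_itv.
  have [c [_ clc]] := @segment_compact R (- s (- u)) (s u) _ _ FI.
  exists c => V Vc; have [//|FV] := in_ultra_setVsetC ((fun p : dual X => p u : R) @^-1` V) UF.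
  have FV' : ((fun p : dual X => p u : R) @ F) (~` V) by [].
  by have [a [/= + Va]] := clc _ _ FV' Vc.
have {ev} /choice[L hL] := ev.
have uniq u c : (fun p : dual X => p u : R) @ F --> c -> L u = c.
  by move=> h; exact: (cvg_unique _ (hL u) h).
have Ls u : L u <= s u.
  apply: (@closed_cvg _ _ F _ (fun p : dual X => p u : R) [set z | z <= s u]) (hL u) => //.
  by apply: filterS FK => p Kp; exact: Kp.
have [|||q hq] := dual_of (f := L) (M := M).
- move=> u w; apply: uniq; have -> : (fun p : dual X => p (u + w) : R) =
      (fun p : dual X => (p u : R) + p w) by apply/funext => p; rewrite dual_add.
  by apply: cvgD.
- move=> a u; apply: uniq; have -> : (fun p : dual X => p (a *: u) : R) =
      (fun p : dual X => a * (p u : R)) by apply/funext => p; rewrite dual_scale.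
  by apply: cvgMl_tmp.
- by move=> u; rewrite (le_trans (Ls u))//; case: ss => _ _; exact.
exists q; split; first by move=> u; rewrite hq.
by apply/wdual_cvgP => u; rewrite hq.
Qed.

(* The point of K' nearest to a minorant y is y itself. *)
Lemma wstar_compact_minorants_unique (K' : set (dual X)) : wstar_compact K' ->
  convex_set K' -> (forall u, support_fun u K' = (s u)%:E) -> K' = K.
Proof.
move=> cK' vK' sK'; apply/seteqP; split=> [p K'p u|y Ky].
  by rewrite -lee_fin -sK'; apply: ereal_sup_ubound; exists p.
have K's p u : K' p -> p u <= s u.
  by move=> K'p; rewrite -lee_fin -sK'; apply: ereal_sup_ubound; exists p.
have K'M p : K' p -> `|p| <= `|M|.
  move=> K'p; apply: dual_norm_le => // u; rewrite (le_trans (K's p u K'p))//.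
  by have [_ _ h] := ss; rewrite (le_trans (h u))// ler_wpM2r// ler_norm.
have near_sup u e : 0 < e -> exists2 q, K' q & s u - e < q u.
  move=> e0; have : ((s u - e)%:E < support_fun u K')%E by rewrite sK' lte_fin gtrBl.
  by move=> /ereal_sup_gt[_ [q K'q <-]]; rewrite lte_fin; exists q.
have [p1 K'p1 _] := near_sup 0 1 ltr01.
pose D (p : dual X) := wsum (fun n => ((p (v n) : R) - y (v n)) ^+ 2).
have D_le p n : K' p -> `|((p (v n) : R) - y (v n)) ^+ 2| <= (`|M| + `|y|) ^+ 2.
  move=> K'p; rewrite normrX ler_sqr ?nnegrE ?addr_ge0// (le_trans (ler_normB _ _))// lerD//.
    rewrite (le_trans (dual_norm_ub _ _))// (le_trans (ler_wpM2l _ (unit_seq_le1 x n)))//.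
    by rewrite mulr1 K'M.
  by rewrite (le_trans (dual_norm_ub _ _))// ler_piMr// unit_seq_le1.
have hE : has_inf [set D p | p in K'].
  split; first by exists (D p1), p1.
  by exists 0 => _ [p K'p <-]; apply: (wsum_ge0 (fun n => D_le p n K'p)) => n; exact: sqr_ge0.
pose m := inf [set D p | p in K'].
have m_le p : K' p -> m <= D p by move=> K'p; apply: ge_inf; [case: hE|exists p].
have /choice[P hP] : forall k : nat, exists p, K' p /\ D p < m + k.+1%:R^-1.
  move=> k; have k0 : 0 < k.+1%:R^-1 :> R by rewrite invr_gt0.
  by have [_ [p K'p <-] lt] := inf_adherent k0 hE; exists p.
(* A cluster point of a minimizing sequence is a nearest point, because [D] is weak-star lower
   semicontinuous on [K']. *)
have [|p0 [K'p0 clp0]] := cK' (P @ \oo).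
  by exists 0%N => // k _; have [] := hP k.
have D_min p : K' p -> D p0 <= D p.
  move=> K'p; apply: le_trans (m_le p K'p); apply/ler_addgt0Pr => e e0.
  have e2 : 0 < e / 2 by rewrite divr_gt0.
  have lsc : \forall q \near within K' (nbhs (p0 : wdual X)), D p0 <= D q + e / 2.
    apply: (wsum_lsc (M := (`|M| + `|y|) ^+ 2)) e2.
    - by move=> n; exact: D_le.
    - by rewrite near_withinE; apply: nearW => q K'q n; exact: D_le.
    - move=> n r r0.
      have cn : (fun q : dual X => ((q (v n) : R) - y (v n)) ^+ 2) @ (nbhs (p0 : wdual X)) -->
          ((p0 (v n) : R) - y (v n)) ^+ 2.
        have /wdual_cvgP-/(_ (v n)) h : nbhs (p0 : wdual X) --> (p0 : wdual X) by exact: cvg_id.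
        rewrite expr2; under eq_fun do rewrite expr2.
        by apply: cvgM; apply: cvgB => //; exact: cvg_cst.
      move/cvgrPdist_le : cn => /(_ _ r0) cn; apply: filterS cn => q + _.
      by rewrite ler_norml => /andP[_]; rewrite lerBlDl.
  have [k0 hk0] : exists k0 : nat, forall k, (k0 <= k)%N -> k.+1%:R^-1 <= e / 2.
    have /cvgrPdist_le/(_ _ e2)[N _ hN] := @cvg_harmonic R.
    exists N => k Nk; have := hN k Nk; rewrite sub0r normrN ger0_norm ?invr_ge0//.
  have Ak : (P @ \oo) [set q | K' q /\ D q <= m + e / 2].
    exists k0 => // k /= hk; have [h1 h2] := hP k; split => //.
    by rewrite (le_trans (ltW h2))// lerD2l hk0.
  have [q [[K'q Dq] hq]] := clp0 _ _ Ak lsc.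
  by have := hq K'q; move: (D p0) (D q) Dq => *; lra.
suff -> : y = p0 by [].
apply/esym/(nearest_dual_eq dx (K := K')) => //.
- move=> q t K'q /andP[t0 t1].
  have := vK' q p0 (Itv01 t0 t1); rewrite !inE => /(_ K'q K'p0).
  suff -> : p0 + t *: (q - p0) = t *: q + (1 - t) *: p0 by [].
  by rewrite scalerBr scalerBl scale1r addrCA.
- move=> u e e0; have [q K'q lt] := near_sup u e e0; exists q => //.
  by have := Ky u; move: (q u : R) (y u : R) (s u) lt => *; lra.
Qed.

End WeakStarCompact.

(** * Bochner and Gelfand integrals *)

Section BochnerGelfand.
Context {R : realType} {X : normedModType R} {d : measure_display} {T : measurableType d}.
Variables (mu : {finite_measure set T -> \bar R}) (x : nat -> X).
Hypothesis dx : dense_seq x.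
Implicit Types (f s : T -> dual X) (y : dual X).

(** The norm is a countable supremum of the quotients [|f w (x n)| / |x n|]; where [x n = 0], the
    convention [0^-1 = 0] gives the harmless term 0. *)
Lemma measurable_dual_norm f : wstar_scalarly_measurable f ->
  measurable_fun setT (fun w => `|f w|).
Proof.
move=> mf; pose h n w : R := `|f w (x n) : R| * `|x n|^-1.
have h_le n w : h n w <= `|f w|.
  rewrite /h; have [->|x0] := eqVneq (x n) 0; first by rewrite normr0 invr0 mulr0.
  by rewrite ler_pdivrMr ?normr_gt0//; exact: dual_norm_ub.
have hub w : has_ubound (range (h^~ w)) by exists `|f w| => _ [n _ <-].
have -> : (fun w => `|f w|) = (fun w => sups (h^~ w) 0).
  apply/funext => w; set c := sups _ _.
  have hc n : h n w <= c by apply: ub_le_sup; [exists `|f w| => _ [k _ <-]|exists n].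
  have c0 : 0 <= c by apply: le_trans (hc 0%N); rewrite /h mulr_ge0// invr_ge0.
  apply/le_anti/andP; split; last by apply: ge_sup; [exists (h 0%N w), 0%N|move=> _ [k _ <-]].
  apply: dual_norm_le => // u; apply/ler_addgt0Pl => e e0.
  have k0 : 0 < `|f w| + c + 1 by rewrite ltr_wpDl// addr_ge0.
  have [n hn] := dx u (divr_gt0 e0 k0).
  have h1 : f w (x n) <= c * `|x n|.
    have [->|x0] := eqVneq (x n) 0; first by rewrite dual_zero normr0 mulr0.
    rewrite (le_trans (ler_norm _))// -ler_pdivrMr ?normr_gt0//; exact: hc.
  have h2 : (f w u : R) - f w (x n) <= `|f w| * `|u - x n|.
    by rewrite -dual_sub; exact: dual_ub.
  have h3 : `|x n| <= `|u| + `|u - x n|.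
    by rewrite -[x n in leLHS](subKr u) (le_trans (ler_normB _ _)).
  have h4 : (`|f w| + c + 1) * `|u - x n| <= e.
    by rewrite mulrC -ler_pdivlMr// ltW.
  have h5 := normr_ge0 (u - x n).
  have h6 : c * `|x n| <= c * `|u| + c * `|u - x n| by rewrite -mulrDr ler_wpM2l.
  move: h1 h2 h4 h5 h6; move: (f w u : R) (f w (x n) : R) `|u - x n| (c * `|x n|) => *; nra.
apply: measurable_fun_sups => [w _|n]; first exact: hub.
apply: measurable_funM; last exact: measurable_cst.
by apply: measurableT_comp => //; exact: mf.
Qed.

Section Simple.
Variable s : T -> dual X.
Hypothesis simple_s : simple_fun s.

Let A := finmap.enum_fset (fset_set (range s)).

Let simpleE w u : (s w u : R) = \sum_(p <- A) (p u : R) * \1_(s @^-1` [set p]) w.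
Proof.
have fin := simple_s.1.
have sA : s w \in A by rewrite [_ \in _](in_fset_set fin); apply/mem_set; exists w.
rewrite (bigD1_seq (s w)) ?finmap.fset_uniq//= indicE mem_set// mulr1.
rewrite big1 ?addr0// => p pw; rewrite indicE memNset ?mulr0//= => sp.
by rewrite sp eqxx in pw.
Qed.

Let int_term (p : dual X) u :
  mu.-integrable setT (fun w => ((p u : R) * \1_(s @^-1` [set p]) w)%:E).
Proof.
apply: (eq_integrable _ (fun w => (p u : R)%:E * (\1_(s @^-1` [set p]) w)%:E)%E) => //.
by apply: integrableZl => //; apply: integrable_indic; exact: simple_s.2.
Qed.

Lemma simple_fun_measurable : wstar_scalarly_measurable s.
Proof.
move=> u; under eq_fun do rewrite simpleE; apply: measurable_sum => p.
by apply: measurable_funM => //; apply: measurable_indic; exact: simple_s.2.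
Qed.

Lemma simple_fun_integrable u : mu.-integrable setT (fun w => (s w u : R)%:E).
Proof.
apply: (eq_integrable measurableT (fun w => \sum_(p <- A) ((p u : R) * \1_(s @^-1` [set p]) w)%:E)%E).
  by move=> w _; rewrite simpleE sumEFin.
by apply: integrable_sum => // p _; exact: int_term.
Qed.

Lemma simple_integralE u : (simple_integral mu s u : R) = \int[mu]_w (s w u : R).
Proof.
rewrite /simple_integral fsbig_finite; last exact: simple_s.1.
rewrite /Rintegral.
have -> : (\int[mu]_w (s w u : R)%:E)%E =
    (\int[mu]_w \sum_(p <- A) ((p u : R) * \1_(s @^-1` [set p]) w)%:E)%E.
  by apply: eq_integral => w _; rewrite simpleE sumEFin.
rewrite (integral_sum measurableT (fun p => int_term p u)).
transitivity (\sum_(p <- A) fine (mu (s @^-1` [set p])) * (p u : R)).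
  rewrite -/A; elim: A => [|p A' IH]; first by rewrite !big_nil.
  by rewrite !big_cons -IH.
rewrite (eq_bigr (fun p => (fine (mu (s @^-1` [set p])) * (p u : R))%:E)); last first.
  move=> p _; under eq_integral do rewrite EFinM.
  have mp : measurable (s @^-1` [set p]) by exact: simple_s.2.
  rewrite integralZl//; last exact: integrable_indic.
  by rewrite integral_indic// setIT EFinM fineK ?fin_num_measure// muleC.
by rewrite sumEFin.
Qed.

End Simple.

Lemma dist_integral_le f s z : wstar_scalarly_measurable f -> wstar_scalarly_measurable s ->
  (\int[mu]_w `|(f w z : R)%:E - (s w z : R)%:E| <= `|z|%:E * \int[mu]_w (`|f w - s w|)%:E)%E.
Proof.
move=> mf ms; have mD : measurable_fun setT (fun w => `|f w - s w|).
  by apply: measurable_dual_norm => a; apply: measurable_funB; [exact: mf|exact: ms].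
rewrite -ge0_integralZl//; last exact/measurable_EFinP.
apply: ge0_le_integral => //.
- by apply: measurableT_comp => //; apply/measurable_EFinP; apply: measurable_funB; [exact: mf|exact: ms].
- by apply/measurable_EFinP; apply: measurable_funM.
- by move=> w _; rewrite -EFinB abse_EFin -EFinM lee_fin -dualBE mulrC dual_norm_ub.
Qed.

Lemma dist_Rintegral_le f s z : wstar_scalarly_measurable f -> wstar_scalarly_measurable s ->
  mu.-integrable setT (fun w => (f w z : R)%:E) -> mu.-integrable setT (fun w => (s w z : R)%:E) ->
  (\int[mu]_w (`|f w - s w|)%:E)%E \is a fin_num ->
  `|\int[mu]_w (f w z : R) - \int[mu]_w (s w z : R)| <=
    fine (\int[mu]_w (`|f w - s w|)%:E)%E * `|z|.
Proof.
move=> mf ms fi si fin; rewrite -RintegralB//.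
have Di : mu.-integrable setT (EFin \o (fun w => (f w z : R) - s w z)).
  by apply: (eq_integrable _ (fun w => (f w z : R)%:E - (s w z : R)%:E)%E) => //; exact: integrableB.
apply: le_trans (le_normr_Rintegral measurableT Di) _.
rewrite -lee_fin -integral_Rintegral; last exact: integrable_abse Di.
by rewrite mulrC EFinM fineK//; exact: dist_integral_le.
Qed.

(** Simple functions are scalarly measurable and converge almost everywhere, so completeness of [mu]
    makes the limit measurable. The scalar integrals converge because the norm distance dominates
    every scalar one. *)
Lemma bochner_gelfand f y : measure_is_complete mu -> is_bochner_integral mu f y ->
  gelfand_integrable mu f /\ is_gelfand_integral mu f y.
Proof.
move=> cmu [u [us ucvg uint] uy].
have mu_ n := simple_fun_measurable (us n).
have mf : wstar_scalarly_measurable f.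
  move=> z; apply/measurable_EFinP; have [N [mN N0 hN]] := ucvg.
  pose h n w : R := if w \in N then 0 else u n w z.
  pose g w : R := if w \in N then 0 else f w z.
  apply: (ae_measurable_fun cmu (f := EFin \o g)).
    exists N; split => // w; apply: contra_notP => Nw _ /=.
    by rewrite /g memNset.
  apply/measurable_EFinP; apply: (measurable_fun_cvg (h := h)) => [n|w _].
    by apply: measurable_fun_ifT => //; [exact: measurable_mem|exact: mu_].
  rewrite /h /g; have [_|/negP Nw] := boolP (w \in N); first exact: cvg_cst.
  have uw : (fun n => u n w) @ \oo --> f w.
    by apply: contrapT => h'; apply: Nw; apply/mem_set; exact: hN.
  apply/cvgrPdist_le => e e0; have z1 : 0 < `|z| + 1 by rewrite ltr_wpDl.
  move/cvgrPdist_le : uw => /(_ _ (divr_gt0 e0 z1)); apply: filterS => n.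
  rewrite ler_pdivlMr// => le; rewrite -dualBE (le_trans (dual_norm_ub _ _))//.
  by rewrite (le_trans _ le)// ler_wpM2l// lerDl.
have mD n : measurable_fun setT (fun w => `|f w - u n w|).
  by apply: measurable_dual_norm => z; apply: measurable_funB; [exact: mf|exact: mu_].
have fi z : mu.-integrable setT (fun w => (f w z : R)%:E).
  have /fine_cvgP[[N _ /(_ N (leqnn N)) finN] _] := uint.
  have : mu.-integrable setT (fun w => ((f w z : R) - u N w z)%:E).
    apply/integrableP; split.
      by apply/measurable_EFinP; apply: measurable_funB; [exact: mf|exact: mu_].
    by apply: le_lt_trans (dist_integral_le z mf (mu_ N)) _; rewrite -(fineK finN) -EFinM ltry.
  move=> /(integrableD measurableT)/(_ (simple_fun_integrable (us N) z)).
  by apply: eq_integrable => // w _; rewrite /= -EFinD subrK.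
have fy : is_gelfand_integral mu f y.
  move=> z; split => //.
  suff -> : y z = \int[mu]_w (f w z : R) by rewrite (integral_Rintegral (fi z)).
  have lim0 : (fun n => fine (\int[mu]_w (`|f w - u n w|)%:E)%E) @ \oo --> (0 : R).
    exact: fine_cvg uint.
  have c1 : (fun n => simple_integral mu (u n) z : R) @ \oo --> (y z : R).
    apply/cvgrPdist_le => e e0; have z1 : 0 < `|z| + 1 by rewrite ltr_wpDl.
    move/cvgrPdist_le : uy => /(_ _ (divr_gt0 e0 z1)); apply: filterS => n.
    rewrite ler_pdivlMr// => le; rewrite -dualBE (le_trans (dual_norm_ub _ _))//.
    by rewrite (le_trans _ le)// ler_wpM2l// lerDl.
  apply: (cvg_unique _ c1) => //.
  apply/cvgrPdist_le => e e0; have z1 : 0 < `|z| + 1 by rewrite ltr_wpDl.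
  move/cvgrPdist_le : lim0 => /(_ _ (divr_gt0 e0 z1)) lim0.
  have /fine_cvgP[fin _] := uint; near=> n.
  have finn : (\int[mu]_w (`|f w - u n w|)%:E)%E \is a fin_num by near: n.
  have : `|0 - fine (\int[mu]_w (`|f w - u n w|)%:E)%E| <= e / (`|z| + 1) by near: n.
  rewrite sub0r normrN ger0_norm ?fine_ge0 ?integral_ge0// ler_pdivlMr// => le.
  rewrite simple_integralE//.
  have := dist_Rintegral_le mf (mu_ n) (fi z) (simple_fun_integrable (us n) z) finn.
  move=> /le_trans; apply; rewrite (le_trans _ le)// ler_wpM2l ?lerDl// fine_ge0// integral_ge0//.
  by split => //; split => //; exists y.
Unshelve. all: by end_near.
Qed.

(** Separability of the dual supplies the simple functions: [u n] takes the value nearest to [f w]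
    among 0 and the first [n] terms of [dd]. Starting from 0 gives [|f w - u n w| <= |f w|], the
    domination required for the limit. *)
Lemma gelfand_bochner (dd : nat -> dual X) (l : T -> R) f y : dense_seq dd ->
  mu.-integrable setT (EFin \o l) -> wstar_scalarly_measurable f ->
  {ae mu, forall w, `|f w| <= l w} -> is_gelfand_integral mu f y ->
  is_bochner_integral mu f y.
Proof.
move=> ddd li mf fl fy.
pose u := fix u n w : dual X := if n is n'.+1 then
  (if `|f w - dd n'| < `|f w - u n' w| then dd n' else u n' w) else 0.
have us n : simple_fun (u n) /\ wstar_scalarly_measurable (u n).
  elim: n => [|n [[fin fib] IH]].
    have s0 : simple_fun (u 0%N).
      split; first by apply: sub_finite_set (finite_set1 0) => _ [w _ <-].
      move=> p; have [->|/eqP p0] := eqVneq p 0.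
        by rewrite (_ : _ @^-1` _ = setT)//; apply/seteqP; split.
      rewrite (_ : _ @^-1` _ = set0)//; apply/seteqP; split => // w /= /esym; exact: p0.
    by split => //; exact: simple_fun_measurable.
  have mb : measurable_fun setT (fun w => `|f w - dd n| < `|f w - u n w|).
    apply: measurable_fun_ltr; apply: measurable_dual_norm => z; apply: measurable_funB;
      [exact: mf|exact: measurable_cst|exact: mf|exact: IH].
  pose B := [set w | `|f w - dd n| < `|f w - u n w|].
  have mB : measurable B.
    by have := mb measurableT [set true]; rewrite setTI; exact.
  have sn : simple_fun (u n.+1).
    split.
      apply: (@sub_finite_set _ _ (range (u n) `|` [set dd n])).
        by move=> _ [w _ <-] /=; case: ifP => _; [right|left; exists w].
      by rewrite finite_setU; split.
    move=> p; have -> : u n.+1 @^-1` [set p] =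
        (B `&` [set w | dd n = p]) `|` (~` B `&` (u n @^-1` [set p])).
      apply/seteqP; split => w /=; rewrite /B /=; case: ifPn => //.
      - by move=> h1 h2; left.
      - by move=> /negP h1 h2; right.
      - by move=> h1 [[]|[]].
      - by move=> /negP h1 [[]|[]].
    apply: measurableU; apply: measurableI => //; last exact: measurableC.
    have [dp|dp] := pselect (dd n = p).
      by rewrite (_ : [set w | dd n = p] = setT)//; apply/seteqP; split.
    by rewrite (_ : [set w | dd n = p] = set0)//; apply/seteqP; split.
  by split => //; exact: simple_fun_measurable.
have u_mono n w : `|f w - u n.+1 w| <= `|f w - u n w|.
  by rewrite /=; case: ifP => // /ltW.
have u_le n w : `|f w - u n w| <= `|f w|.
  elim: n => [|n]; first by rewrite /= subr0.
  exact: le_trans.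
have u_dd n k w : (n < k)%N -> `|f w - u k w| <= `|f w - dd n|.
  elim: k => // k IH; rewrite ltnS leq_eqVlt => /orP[/eqP <-|/IH]; last exact: le_trans.
  by rewrite /=; case: ifP => // /negbT; rewrite -leNgt.
have ucvg w : (fun n => u n w) @ \oo --> f w.
  apply/cvgrPdist_le => e e0; have [n hn] := ddd (f w) e e0.
  by exists n.+1 => // k /= nk; rewrite (le_trans (u_dd _ _ _ nk))// ltW.
have mD n : measurable_fun setT (fun w => `|f w - u n w|).
  by apply: measurable_dual_norm => z; apply: measurable_funB; [exact: mf|exact: (us n).2].
have Dle : {ae mu, forall w, forall n, setT w -> (`|(`|f w - u n w|)%:E| <= (l w)%:E)%E}.
  by apply: filterS fl => w fl n _; rewrite abse_EFin normr_id lee_fin (le_trans (u_le n w)).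
have [|||||_ _ lim] := @dominated_convergence _ _ _ mu setT measurableT
    (fun n w => (`|f w - u n w|)%:E) (cst 0%E) (fun w => (l w)%:E) => //.
- by move=> n; exact/measurable_EFinP.
- apply: aeW => w _; apply: cvg_EFin; first exact: nearW.
  rewrite [X in _ --> X](_ : _ = `|f w - f w|); last by rewrite subrr normr0.
  by apply: cvg_norm; apply: cvgB => //; exact: cvg_cst.
rewrite integral0 in lim.
exists u; first by split; [move=> n; exact: (us n).1|apply: aeW => w; exact: ucvg|].
have /fine_cvgP[fin lim0] := lim.
apply/cvgrPdist_le => e e0; move/cvgrPdist_le : lim0 => /(_ _ e0) lim0; near=> n.
have finn : (\int[mu]_w (`|f w - u n w|)%:E)%E \is a fin_num by near: n.
have : `|0 - fine (\int[mu]_w (`|f w - u n w|)%:E)%E| <= e by near: n.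
rewrite sub0r normrN ger0_norm ?fine_ge0 ?integral_ge0//; apply: le_trans.
apply: dual_norm_le => [|z]; first by rewrite fine_ge0// integral_ge0.
have [fi yz] := fy z; have ui := simple_fun_integrable (us n).1 z.
rewrite dualBE (simple_integralE (us n).1).
have -> : y z = \int[mu]_w (f w z : R) by apply: EFin_inj; rewrite yz integral_Rintegral.
apply: le_trans (ler_norm _) _; exact: dist_Rintegral_le mf (us n).2 fi ui finn.
Unshelve. all: by end_near.
Qed.

End BochnerGelfand.

(** * Comparison of integrals and the reverse Fatou lemma *)

Section RintegralLimits.
Context {R : realType} {d : measure_display} {T : measurableType d}.
Variable mu : {measure set T -> \bar R}.

Lemma le_Rintegral_ae (f g : T -> R) : mu.-integrable setT (EFin \o f) ->
  mu.-integrable setT (EFin \o g) -> {ae mu, forall w, f w <= g w} ->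
  \int[mu]_w f w <= \int[mu]_w g w.
Proof.
move=> fi gi fg; pose h w := Num.max (f w) (g w).
have mf : measurable_fun setT f by exact/measurable_EFinP/(measurable_int mu fi).
have mg : measurable_fun setT g by exact/measurable_EFinP/(measurable_int mu gi).
have mh : measurable_fun setT h by exact: measurable_maxr.
have hi : mu.-integrable setT (EFin \o h).
  apply: (integrable_le_norm (g := fun w => `|f w| + `|g w|)) mh _ _.
    exact: (integrableD measurableT (integrable_abse fi) (integrable_abse gi)).
  by move=> w; rewrite /h; case: (leP (f w) (g w)) => _; rewrite ?lerDl ?lerDr.
apply: (@le_trans _ _ (\int[mu]_w h w)).
  by apply: le_Rintegral => // w _; rewrite le_max lexx.
rewrite le_eqVlt; apply/orP; left; apply/eqP; rewrite /Rintegral; congr fine.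
apply: ae_eq_integral => //; [exact/measurable_EFinP|exact/measurable_EFinP|].
by apply: filterS fg => w fg _; rewrite /h max_r.
Qed.

(** The maximum of [q k w] and [s w] converges to [s w] and is dominated by [g], so dominated
    convergence applies although the [q k] themselves may not converge. The vanishing error
    [k.+1%:R^-1] matches the approximate inequalities fed to it. *)
Lemma reverse_fatou (q : nat -> T -> R) (s g : T -> R) c :
  (forall k, measurable_fun setT (q k)) -> measurable_fun setT s ->
  mu.-integrable setT (EFin \o g) -> (forall k w, `|q k w| <= g w) ->
  (forall w, `|s w| <= g w) ->
  (forall w e, 0 < e -> \forall k \near \oo, q k w <= s w + e) ->
  (forall k, c <= \int[mu]_w q k w + k.+1%:R^-1) -> c <= \int[mu]_w s w.
Proof.
move=> mq ms gi qg sg qs cq; pose h k w := Num.max (q k w) (s w).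
have mh k : measurable_fun setT (h k) by exact: measurable_maxr.
have hg k w : `|h k w| <= g w by rewrite /h; case: (leP (q k w) (s w)).
have hi k : mu.-integrable setT (EFin \o h k) by exact: integrable_le_norm gi (hg k).
have si : mu.-integrable setT (EFin \o s) by exact: integrable_le_norm gi sg.
have [|||||_ _] := @dominated_convergence _ _ _ mu setT measurableT
    (fun k w => (h k w)%:E) (EFin \o s) (EFin \o g) => //.
- by move=> k; exact/measurable_EFinP.
- exact/measurable_EFinP.
- apply: aeW => w _; apply: cvg_EFin; first exact: nearW.
  apply/cvgrPdist_le => e e0; apply: filterS (qs w e e0) => k hk.
  rewrite distrC ger0_norm ?subr_ge0 /h ?le_max ?lexx ?orbT// lerBlDl ge_max lerDl (ltW e0) andbT.
  by rewrite /= hk.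
- by apply: aeW => w k _; rewrite abse_EFin lee_fin.
rewrite (integral_Rintegral si) => /fine_cvg lim.
have lim2 : (fun k => \int[mu]_w h k w + k.+1%:R^-1) @ \oo --> \int[mu]_w s w + 0.
  by apply: cvgD; [exact: lim|exact: cvg_harmonic].
rewrite -[leRHS]addr0; apply: (@closed_cvg _ _ \oo _ _ [set z | c <= z]) lim2 => //.
apply: nearW => k; rewrite /= (le_trans (cq k))// lerD2r; apply: le_Rintegral => //.
  exact: integrable_le_norm gi (qg k).
by move=> w _; rewrite le_max lexx.
Qed.

End RintegralLimits.

(** * The integral functional and its subdifferentials *)

Section IntegralFunctional.
Context {R : realType} {d : measure_display} {T : measurableType d}
  {mu : {finite_measure set T -> \bar R}} {X : completeNormedModType R}.
Hypotheses (mu_complete : measure_is_complete mu) (mu_saturated : saturated mu)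
  (X_separable : separable X) (X_asplund : asplund X).
Variables (xbar : X) (phi : X -> T -> \bar R) (r : R) (l : T -> R).
Hypotheses (r0 : 0 < r) (l_ge0 : forall w, 0 <= l w)
  (l_int : mu.-integrable setT (EFin \o l))
  (phi_fin : forall w x, `|x - xbar| <= r -> phi x w \is a fin_num)
  (phi_lip : forall w x y, `|x - xbar| <= r -> `|y - xbar| <= r ->
    (`|phi x w - phi y w| <= (l w * `|x - y|)%:E)%E)
  (phi_int : forall x, `|x - xbar| <= r -> mu.-integrable setT (phi x))
  (dphi_measurable : set_wstar_scalarly_measurable
      (fun w => limiting_subdifferential (phi ^~ w) xbar)).

Let f w x : R := fine (phi x w).
Let s w : X -> R := clarke_dir (f w) xbar.
Let I x : \bar R := (\int[mu]_w phi x w)%E.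
Let L : R := \int[mu]_w l w.
Let S h : R := \int[mu]_w s w h.
Let dphi w : set (dual X) := limiting_subdifferential (phi ^~ w) xbar.
Let dcphi w : set (dual X) := generalized_gradient (phi ^~ w) xbar.
Let C : set (dual X) := [set y | forall h, y h <= S h].

Let xbar_in : `|xbar - xbar| <= r. Proof. by rewrite subrr normr0 ltW. Qed.

Let phiE w x : `|x - xbar| <= r -> phi x w = (f w x)%:E.
Proof. by move=> xr; rewrite /f fineK// phi_fin. Qed.

Let f_lip w x y : `|x - xbar| <= r -> `|y - xbar| <= r -> `|f w x - f w y| <= l w * `|x - y|.
Proof. by move=> xr yr; have := phi_lip w xr yr; rewrite !phiE// -EFinB abse_EFin lee_fin. Qed.

Let f_int x : `|x - xbar| <= r -> mu.-integrable setT (EFin \o f^~ x).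
Proof.
by move=> xr; apply: eq_integrable (phi_int xr) => // w _; rewrite phiE.
Qed.

Let mf x : `|x - xbar| <= r -> measurable_fun setT (f^~ x).
Proof. by move=> /f_int xi; exact/measurable_EFinP/(measurable_int mu xi). Qed.

Let IE x : `|x - xbar| <= r -> I x = (\int[mu]_w f w x)%:E.
Proof.
move=> xr; rewrite -integral_Rintegral; last exact: f_int.
by apply: eq_integral => w _; rewrite phiE.
Qed.

Let I_fin x : `|x - xbar| <= r -> I x \is a fin_num.
Proof. by move=> /IE ->. Qed.

Let fineI x : `|x - xbar| <= r -> fine (I x) = \int[mu]_w f w x.
Proof. by move=> /IE ->. Qed.

Let L0 : 0 <= L. Proof. by apply: Rintegral_ge0 => w _. Qed.

Let lc_int (c : R) : mu.-integrable setT (EFin \o (fun w => l w * c)).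
Proof.
by apply: (eq_integrable _ (fun w => (l w)%:E * c%:E)%E) => //; exact: integrableZr.
Qed.

Let I_lip x y : `|x - xbar| <= r -> `|y - xbar| <= r ->
  `|fine (I x) - fine (I y)| <= L * `|x - y|.
Proof.
move=> xr yr; rewrite !fineI// -RintegralB//; try exact: f_int.
have bi : mu.-integrable setT (EFin \o (fun w => f w x - f w y)).
  by have := integrableB measurableT (f_int xr) (f_int yr).
apply: le_trans (le_normr_Rintegral measurableT bi) _.
rewrite -RintegralZr//; apply: le_Rintegral => //; first exact: integrable_abse bi.
by move=> w _; exact: f_lip.
Qed.

Let phi_fin' w x : `|x - xbar| <= r -> (phi^~ w) x \is a fin_num. Proof. exact: phi_fin. Qed.

Let ss w : sublinear (l w) (s w).
Proof. exact: (sublinear_clarke_dir (phi := phi^~ w) r0 (f_lip w)). Qed.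

Let support_dphi w h : support_fun h (dphi w) = (s w h)%:E.
Proof.
exact: (support_fun_limiting X_separable X_asplund r0 (l_ge0 w) (phi_fin' w) (f_lip w)).
Qed.

Let dcphiE w : dcphi w = [set p : dual X | forall h, p h <= s w h].
Proof. exact: (generalized_gradientE r0 (phi_fin' w) (f_lip w)). Qed.

Lemma dphi_dcphi w : dphi w `<=` dcphi w.
Proof. by move=> p; exact: (limiting_sub_generalized r0 (phi_fin' w) (f_lip w)). Qed.

(** The scalar measurability assumed for the limiting subdifferential enters here: its support
    function is the Clarke derivative. *)
Let ms h : measurable_fun setT (s^~ h).
Proof.
apply/measurable_EFinP; rewrite (_ : _ \o _ = fun w => support_fun h (dphi w)).
  exact: dphi_measurable.
by apply/funext => w; rewrite support_dphi.
Qed.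

Let s_int h : mu.-integrable setT (EFin \o s^~ h).
Proof. exact: (integrable_sublinear l_int ss ms). Qed.

Let sS : sublinear L S.
Proof.
split.
- move=> u v; rewrite /S -RintegralD//; apply: le_Rintegral => //.
    by have := integrableD measurableT (s_int u) (s_int v).
  by move=> w _; have [h _ _] := ss w; exact: h.
- move=> t u t0; rewrite /S -RintegralZl//; apply: eq_Rintegral => w _.
  by have [_ h _] := ss w; exact: h.
- move=> u; rewrite /S -RintegralZr//; apply: le_Rintegral => // w _.
  by have [_ _ h] := ss w; exact: h.
Qed.

Let gelfand_sub (G : T -> set (dual X)) : (forall w, G w `<=` dcphi w) ->
  set_gelfand_integral mu G `<=` C.
Proof.
move=> GC y [g [_ gG] gy] h; have [gi yh] := gy h.
have -> : y h = \int[mu]_w (g w h : R) by apply: EFin_inj; rewrite yh integral_Rintegral.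
apply: le_Rintegral_ae => //; apply: filterS gG => w /GC.
by rewrite dcphiE; exact.
Qed.

(** By saturation the selection may be taken extreme almost everywhere, hence made of limiting
    subgradients; the bound by [l] is recorded for the Bochner integral. *)
Lemma minorant_integral y : C y -> exists g, [/\ gelfand_selectors mu dphi g,
  is_gelfand_integral mu g y & forall w, `|g w| <= l w].
Proof.
move=> Cy; have [x dx] := separable_dense_seq X_separable.
have [g [sg gy gx]] := extreme_selection_with_integral dx l_ge0 l_int ss ms mu_saturated Cy.
have yint : is_gelfand_integral mu g y.
  have gi u := selection_integrable l_ge0 l_int ss u sg.
  by move=> u; split; [exact: gi|rewrite integral_Rintegral// gy].
exists g; split => //; last by move=> w; exact: (selection_norm l_ge0 ss w sg).
split; first by split; [case: sg|exists y].
apply: filterS gx => w.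
exact: (limiting_extreme X_separable X_asplund r0 (l_ge0 w) (phi_fin' w) (f_lip w)).
Qed.

Lemma gelfand_integral_dphi : set_gelfand_integral mu dphi = C.
Proof.
apply/seteqP; split; first exact: gelfand_sub dphi_dcphi.
by move=> y /minorant_integral[g [sg gy _]]; exists g.
Qed.

Lemma gelfand_integral_dcphi : set_gelfand_integral mu dcphi = C.
Proof.
apply/seteqP; split; first by apply: gelfand_sub => w p.
move=> y /minorant_integral[g [[gi gd] gy _]]; exists g => //; split => //.
by apply: filterS gd => w; exact: dphi_dcphi.
Qed.

Lemma gelfand_integrable_dphi : set_gelfand_integrable mu dphi.
Proof.
have [x dx] := separable_dense_seq X_separable.
have [y Cy] := minorants_neq0 dx sS.
by have [g [sg _ _]] := minorant_integral Cy; exists g.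
Qed.

(** Stated for any [G] between the two subdifferentials so as to serve both of them. *)
Lemma bochner_integralE (G : T -> set (dual X)) : (forall w, dphi w `<=` G w) ->
  (forall w, G w `<=` dcphi w) -> set_bochner_integral mu G = C.
Proof.
move=> dG Gd; have [x dx] := separable_dense_seq X_separable.
apply/seteqP; split.
  move=> y [g [_ gG gy]]; have [gi gint] := bochner_gelfand dx mu_complete gy.
  by apply: (gelfand_sub Gd); exists g.
move=> y /minorant_integral[g [[[mg _] gd] gy gl]].
have [dd ddd] := asplund_dual_separable dx X_asplund.
have gb : is_bochner_integral mu g y.
  by apply: (gelfand_bochner dx ddd l_int mg _ gy); exact: aeW.
exists g; split => //; first by case: gb => u; exists u.
by apply: filterS gd => w; exact: dG.
Qed.

Lemma wstar_integral_dcphi : is_wstar_integral mu dcphi C.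
Proof.
have [x dx] := separable_dense_seq X_separable.
have supE h w : support_fun h (dcphi w) = (s w h)%:E.
  by rewrite dcphiE (support_fun_minorants dx (ss w)).
have SE h : (\int[mu]_w support_fun h (dcphi w))%E = (S h)%:E.
  by under eq_integral do rewrite supE; exact: integral_Rintegral.
split.
- by move=> h; apply: eq_integrable (s_int h) => // w _; rewrite supE.
- move=> w; rewrite dcphiE; split; first exact: minorants_neq0 dx (ss w).
  by split; [exact: wstar_compact_minorants (ss w)|exact: convex_minorants].
- split.
    split; [exact: wstar_compact_minorants sS|exact: convex_minorants|].
    by move=> h; rewrite SE (support_fun_minorants dx sS).
  move=> K [cK vK sK]; apply/esym/(wstar_compact_minorants_unique dx sS cK vK) => h.
  by rewrite sK SE.
Qed.

Let quotient_le w z t h : `|z - xbar| <= r -> `|z + t *: h - xbar| <= r -> 0 < t ->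
  `|(f w (z + t *: h) - f w z) / t| <= l w * `|h|.
Proof.
move=> zr zr' t0; rewrite normrM normfV (gtr0_norm t0) ler_pdivrMr//.
rewrite (le_trans (f_lip w zr' zr))// addrAC subrr add0r normrZ (gtr0_norm t0).
by rewrite mulrA mulrAC.
Qed.

Let Rintegral_quotient z t h : `|z - xbar| <= r -> `|z + t *: h - xbar| <= r ->
  \int[mu]_w ((f w (z + t *: h) - f w z) / t) = (fine (I (z + t *: h)) - fine (I z)) / t.
Proof.
move=> zr zr'; rewrite !fineI// -RintegralB ?RintegralZr//; try exact: f_int.
by have := integrableB measurableT (f_int zr') (f_int zr).
Qed.

Let small_ball z t h : `|z - xbar| <= r / 2 -> 0 <= t -> t * (2 * (`|h| + 1)) <= r ->
  `|z - xbar| <= r /\ `|z + t *: h - xbar| <= r.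
Proof.
move=> zr t0 tr; split; first by apply: le_trans zr _; rewrite ler_pdivrMr// ler_peMr// ?ler1n// ltW.
rewrite addrAC (le_trans (ler_normD _ _))// normrZ (ger0_norm t0).
by move: tr zr; have := mulr_ge0 t0 (normr_ge0 h); move: `|z - xbar| `|h| => *; lra.
Qed.

Let s_le w h : `|s w h| <= l w * `|h|.
Proof. exact: sublinear_norm_le (ss w). Qed.

(** A limiting subgradient yields difference quotients of [I] at nearby points; their integrands are
    eventually below [s w h + e], because the Clarke derivative allows the base point to move. *)
Lemma limiting_integral_sub : limiting_subdifferential I xbar `<=` C.
Proof.
move=> y Iy h.
(* The three bounds serve in turn the convergence of [z k] and [t k], the position of [z k], and the
   position of [z k + t k *: h] in the ball. *)
pose del (k : nat) := Num.min k.+1%:R^-1 (Num.min (r / 2) (r / (2 * (`|h| + 1)))).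
have h1 : 0 < 2 * (`|h| + 1) by rewrite mulr_gt0// ltr_wpDl.
have del0 k : 0 < del k by rewrite !lt_min invr_gt0 ltr0n !divr_gt0.
have k0 (k : nat) : 0 < k.+1%:R^-1 :> R by rewrite invr_gt0.
have /choice[zt hzt] : forall k, exists zt : X * R, [/\ `|zt.1 - xbar| < del k, 0 < zt.2 < del k
    & (y h - k.+1%:R^-1) * zt.2 <= fine (I (zt.1 + zt.2 *: h)) - fine (I zt.1)].
  by move=> k; have [z [t ?]] := limiting_quotient r0 I_fin h Iy (k0 k) (del0 k); exists (z, t).
pose z k := (zt k).1; pose t k := (zt k).2.
have zd k : `|z k - xbar| < del k by have [] := hzt k.
have t0 k : 0 < t k by have [_ /andP[]] := hzt k.
have td k : t k < del k by have [_ /andP[]] := hzt k.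
have [zr zr'] : (forall k, `|z k - xbar| <= r) /\ forall k, `|z k + t k *: h - xbar| <= r.
  have H k : `|z k - xbar| <= r /\ `|z k + t k *: h - xbar| <= r.
    apply: small_ball.
    - by move: (zd k); rewrite !lt_min => /and3P[_ /ltW].
    - exact: ltW.
    - by move: (td k); rewrite !lt_min => /and3P[_ _ /ltW]; rewrite ler_pdivlMr.
  by split=> k; case: (H k).
apply: (reverse_fatou (q := fun k w => (f w (z k + t k *: h) - f w (z k)) / t k)
  (g := fun w => l w * `|h|)) => //.
- by move=> k; apply: measurable_funM => //; apply: measurable_funB; apply: mf.
- by move=> k w; exact: quotient_le.
- move=> w e e0.
  have [c c0 hc] : clarke_le (f w) xbar h (s w h + e).
    by apply: (clarke_dir_lt (phi := phi^~ w) r0 (f_lip w)); rewrite ltrDl.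
  have /cvgrPdist_lt/(_ _ c0)[N _ hN] := @cvg_harmonic R.
  exists N => // k /= Nk; have := hN k Nk; rewrite sub0r normrN ger0_norm ?invr_ge0// => kc.
  have dc : del k < c by apply: le_lt_trans kc; rewrite ge_min lexx.
  rewrite ler_pdivrMr//; apply: hc; first exact: lt_trans dc.
  by rewrite t0 (lt_trans (td k)).
- move=> k; rewrite Rintegral_quotient// -lerBlDr ler_pdivlMr//.
  by have [] := hzt k.
Qed.

(** If the Dini inequality at [xbar] failed along some [t k] tending to 0, the reverse Fatou lemma
    for the negated quotients, which converge by regularity, would give [S h <= y h - e], against
    [y h <= S h]. *)
Lemma regular_limiting_integral : (forall w, regular_at (phi ^~ w) xbar) ->
  C `<=` limiting_subdifferential I xbar.
Proof.
move=> reg y Cy; apply: (limiting_dini X_separable X_asplund r0 L0 I_fin I_lip) => h e e0.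
apply: contrapT => nnear.
have h1 : 0 < 2 * (`|h| + 1) by rewrite mulr_gt0// ltr_wpDl.
pose del (k : nat) := Num.min k.+1%:R^-1 (r / (2 * (`|h| + 1))).
have del0 k : 0 < del k by rewrite lt_min invr_gt0 ltr0n !divr_gt0.
have /choice[t ht] : forall k, exists t, 0 < t < del k /\
    fine (I (xbar + t *: h)) - fine (I xbar) < t * (y h - e).
  move=> k; apply: contrapT => no; apply: nnear.
  near=> t; rewrite leNgt; apply/negP => lt; apply: no; exists t; split => //.
  by apply/andP; split; near: t; [exact: nbhs_right_gt|exact: nbhs_right_lt].
have t0 k : 0 < t k by have [/andP[]] := ht k.
have td k : t k < del k by have [/andP[]] := ht k.
have zr' k : `|xbar + t k *: h - xbar| <= r.
  have [] := @small_ball xbar (t k) h => //; first by rewrite subrr normr0 divr_ge0// ltW.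
    exact: ltW.
  by move: (td k); rewrite !lt_min => /andP[_ /ltW]; rewrite ler_pdivlMr.
pose q k w := (f w (xbar + t k *: h) - f w xbar) / t k.
have mq k : measurable_fun setT (q k).
  by apply: measurable_funM => //; apply: measurable_funB; apply: mf.
have ql k w : `|q k w| <= l w * `|h| by exact: quotient_le.
have q_int k : mu.-integrable setT (EFin \o q k) by exact: integrable_le_norm (lc_int _) (ql k).
suff : - (y h - e) <= \int[mu]_w (-1 * s w h).
  by rewrite RintegralZl// mulN1r -/(S h); have := Cy h; move: (y h : R) (S h) e0 => *; lra.
apply: (reverse_fatou (q := fun k w => -1 * q k w) (g := fun w => l w * `|h|)) => //.
- by move=> k; exact: measurable_funM.
- exact: measurable_funM.
- by move=> k w; rewrite mulN1r normrN.
- by move=> w; rewrite mulN1r normrN.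
- move=> w d0 d00; have := reg w h.
  rewrite (clarke_derivativeE r0 (phi_fin' w) (f_lip w)) => regw.
  have tlim : t @ \oo --> 0^'+.
    move=> A /nbhs_ballP[c /= c0 hA].
    have /cvgrPdist_lt/(_ _ c0)[N _ hN] := @cvg_harmonic R.
    exists N => // k /= Nk; have := hN k Nk; rewrite sub0r normrN ger0_norm ?invr_ge0// => kc.
    apply: hA => //=; rewrite /ball /= sub0r normrN gtr0_norm//.
    by apply: lt_trans (td k) _; apply: le_lt_trans kc; rewrite ge_min lexx.
  have qlim : (fun k => (q k w)%:E) @ \oo --> (s w h)%:E.
    apply: cvg_trans (cvg_comp _ _ tlim regw); apply: near_eq_cvg; apply: nearW => k.
    by rewrite /= !phiE//.
  move/fine_cvg : qlim => /cvgrPdist_le/(_ _ d00); apply: filterS => k /=.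
  by rewrite ler_norml => /andP[_]; rewrite !mulN1r; lra.
- move=> k; rewrite RintegralZl// Rintegral_quotient// mulN1r.
  have [_] := ht k; rewrite mulrC -ltr_pdivrMr//.
  have : 0 <= k.+1%:R^-1 :> R by rewrite invr_ge0.
  by move: (k.+1%:R^-1) (_ / t k) => *; lra.
Unshelve. all: by end_near.
Qed.

End IntegralFunctional.

(** * Passage from the neighbourhood to a closed ball *)

Theorem corollary3p5 (R : realType) (d : measure_display)
    (T : measurableType d) (mu : {finite_measure set T -> \bar R})
    (mu_complete : measure_is_complete mu) (mu_saturated : saturated mu)
    (X : completeNormedModType R)
    (X_separable : separable X) (X_asplund : asplund X)
    (xbar : X) (phi : X -> T -> \bar R)
    (phi_gtNy : forall x w, (-oo < phi x w)%E)
    (U : set X) (nbhsU : nbhs xbar U)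
    (l : T -> R) (l_ge0 : forall w, 0 <= l w)
    (l_integrable : mu.-integrable [set: T] (EFin \o l))
    (phi_fin : forall w x, U x -> phi x w \is a fin_num)
    (phi_lip : forall w x y, U x -> U y ->
      (`|phi x w - phi y w| <= (l w * `|x - y|)%:E)%E)
    (phi_measurable : forall x, U x -> measurable_fun [set: T] (phi x))
    (phi_integrable : forall x, U x -> mu.-integrable [set: T] (phi x))
    (dphi_measurable : set_wstar_scalarly_measurable
      (fun w => limiting_subdifferential (phi ^~ w) xbar)) :
  let I_phi : X -> \bar R := fun x => (\int[mu]_w phi x w)%E in
  let dphi : T -> set (dual X) :=
    fun w => limiting_subdifferential (phi ^~ w) xbar in
  let dcphi : T -> set (dual X) :=
    fun w => generalized_gradient (phi ^~ w) xbar in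
  [/\ set_gelfand_integrable mu dphi,
      limiting_subdifferential I_phi xbar `<=` set_gelfand_integral mu dphi /\
      set_gelfand_integral mu dphi = set_gelfand_integral mu dcphi,
      is_wstar_integral mu dcphi (set_gelfand_integral mu dphi),
      set_bochner_integral mu dphi = set_gelfand_integral mu dphi /\
      set_bochner_integral mu dcphi = set_gelfand_integral mu dcphi &
      (forall w, regular_at (phi ^~ w) xbar) ->
        limiting_subdifferential I_phi xbar = set_gelfand_integral mu dphi].
Proof.
move=> I_phi dphi dcphi.
have [r r0 rU] : exists2 r, 0 < r & forall x, `|x - xbar| <= r -> U x.
  have [e /= e0 eU] := (nbhs_ballP xbar U).1 nbhsU.
  exists (e / 2) => [|x xe]; first by rewrite divr_gt0.
  apply: eU; rewrite -ball_normE /= distrC (le_lt_trans xe)//.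
  by rewrite ltr_pdivrMr// ltr_pMr// ltr1n.
have fin w x : `|x - xbar| <= r -> phi x w \is a fin_num by move=> /rU; exact: phi_fin.
have lip w x y : `|x - xbar| <= r -> `|y - xbar| <= r ->
    (`|phi x w - phi y w| <= (l w * `|x - y|)%:E)%E by move=> /rU ? /rU ?; exact: phi_lip.
have int x : `|x - xbar| <= r -> mu.-integrable setT (phi x).
  by move=> /rU; exact: phi_integrable.
have dE : set_gelfand_integral mu dphi = _ := gelfand_integral_dphi mu_saturated
  X_separable X_asplund r0 l_ge0 l_integrable fin lip dphi_measurable.
have dcE : set_gelfand_integral mu dcphi = _ := gelfand_integral_dcphi mu_saturated
  X_separable X_asplund r0 l_ge0 l_integrable fin lip dphi_measurable.
have IC := limiting_integral_sub X_separable X_asplund r0 l_ge0 l_integrable fin lip int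
  dphi_measurable.
have dphi_dcphi w : dphi w `<=` dcphi w by exact: dphi_dcphi r0 fin lip w.
have bE G := bochner_integralE mu_complete mu_saturated X_separable X_asplund r0 l_ge0
  l_integrable fin lip dphi_measurable (G := G).
split.
- exact: (gelfand_integrable_dphi mu_saturated X_separable X_asplund r0 l_ge0 l_integrable
    fin lip dphi_measurable).
- by rewrite dE dcE.
- by rewrite dE; exact: (wstar_integral_dcphi X_separable X_asplund r0 l_ge0 l_integrable
    fin lip dphi_measurable).
- by rewrite dE dcE; split; apply: (bE) => w p //; exact: dphi_dcphi.
- move=> reg; rewrite dE; apply/seteqP; split; first exact: IC.
  exact: (regular_limiting_integral X_separable X_asplund r0 l_ge0 l_integrable
    fin lip int dphi_measurable reg).
Qed.
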